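(* Let $1,w_1,\dots,w_J$ be linearly independent in $L_2([0,1]^2)$, let $w^\star$ be a graphon, and let the data follow the one-graph design: $U_1,\dots,U_n$ i.i.d. uniform on $[0,1]$ and, given $U$, $A_{ij}\sim\mathrm{Bernoulli}(w^\star(U_i,U_j))$ independently for $i<j$. With the notation of the context: (i) exactly, for every $n\ge3$, $$\mathrm{Var}(S)=\frac MN+\frac{4(n-2)}{n(n-1)}\,\Sigma_g$$ (covariance matrix of the vector $S$); (ii) with residuals taken at $\beta^\circ$, $\mathbb E[\hat V(\beta^\circ)]$ equals the right-hand side of (i) for every $n$, and with residuals at $\hat\beta$, $n\hat V(\hat\beta)\to4\Sigma_g$ elementwise in probability as $n\to\infty$; (iii) consequently, for every $\ell\in\mathbb R^d$ with $\ell^\top G^{-1}\Sigma_gG^{-1}\ell>0$, $$\frac{\ell^\top(\hat\beta-\beta^\circ)}{(\ell^\top\hat\Sigma_{\mathrm{dy}}\ell)^{1/2}}\Rightarrow N(0,1)\quad\text{as } n\to\infty,$$ so that the dyadic-robust intervals $\ell^\top\hat\beta\pm z_{1-\alpha/2}(\ell^\top\hat\Sigma_{\mathrm{dy}}\ell)^{1/2}$ have asymptotic coverage $1-\alpha$ for $\ell^\top\beta^\circ$.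
   Context: A graphon is a measurable symmetric $w:[0,1]^2\to[0,1]$. Agents are graphons $w_1,\dots,w_J$; $d=J+1$; $F(u,v)=(1,w_1(u,v),\dots,w_J(u,v))^\top$; $\mathcal H=\{\beta^\top F:\beta\in\mathbb R^d\}$; $G=\int FF^\top$ over $[0,1]^2$. For the true graphon $w^\star$: $\beta^\circ=G^{-1}\int Fw^\star$, $w^\circ=(\beta^\circ)^\top F$; $\sigma^2=w^\star(1-w^\star)+(w^\star-w^\circ)^2$; $M=\int\sigma^2FF^\top$; $g(u)=\int_0^1(w^\star-w^\circ)(u,v)F(u,v)\,dv$; $\Sigma_g=\int_0^1g(u)g(u)^\top du$. With $N=n(n-1)/2$ and $F_{ij}=F(U_i,U_j)$: $S=N^{-1}\sum_{i<j}F_{ij}\{A_{ij}-w^\circ(U_i,U_j)\}$; $\hat G=N^{-1}\sum_{i<j}F_{ij}F_{ij}^\top$; $A=\hat G+\kappa I_d$ with $\kappa=\nu/(N\tau^2)$, $\nu,\tau>0$ fixed; $\hat\beta=A^{-1}N^{-1}\sum_{i<j}F_{ij}A_{ij}$ (here $A_{ij}$ are the binary outcomes, $A_{ij}=A_{ji}$). For $\beta\in\mathbb R^d$ the residuals at $\beta$ are $\xi_{ij}(\beta)=A_{ij}-\beta^\top F_{ij}$, and $$\hat V(\beta)=\frac1{N^2}\Big\{\sum_{i=1}^nr_ir_i^\top-\sum_{i<j}\xi_{ij}(\beta)^2F_{ij}F_{ij}^\top\Big\},\qquad r_i=\sum_{j\ne i}\xi_{ij}(\beta)F_{ij}.$$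 The dyadic-robust covariance is $\hat\Sigma_{\mathrm{dy}}=A^{-1}\hat V(\hat\beta)A^{-1}$; a directional variance $\ell^\top\hat\Sigma_{\mathrm{dy}}\ell$ that is negative in finite samples is floored at zero. $\Rightarrow$ is convergence in distribution. *)

(* Defs.v *)
From HB Require Import structures.
From mathcomp Require Import all_boot all_order all_algebra.
From mathcomp Require Import all_classical all_reals all_analysis.
Import Order.TTheory GRing.Theory Num.Theory.
Import numFieldNormedType.Exports.
Set Implicit Arguments.
Unset Strict Implicit.
Unset Printing Implicit Defensive.
Local Open Scope classical_set_scope.
Local Open Scope ring_scope.

Definition unit_square (R : realType) : set (R * R) :=
  [set` `[0, 1 : R]] `*` [set` `[0, 1 : R]].

(* Only the values on the unit square matter. *)
Record graphon (R : realType) (w : R -> R -> R) : Prop := Graphon {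
  graphon_measurable :
    measurable_fun (@unit_square R) (fun z : R * R => w z.1 z.2);
  graphon_sym : forall u v, u \in `[0, 1] -> v \in `[0, 1] -> w u v = w v u;
  graphon_range :
    forall u v, u \in `[0, 1] -> v \in `[0, 1] -> 0 <= w u v <= 1 }.

Definition lebesgue2 (R : realType) :=
  (@lebesgue_measure R \x @lebesgue_measure R)%E.

Definition mx_Rintegral d (T : measurableType d) (R : realType)
    (mu : {measure set T -> \bar R}) (D : set T) p q (f : T -> 'M[R]_(p, q)) :
    'M[R]_(p, q) :=
  \matrix_(k, l) \int[mu]_(x in D) f x k l.

Section population.
Context {R : realType} {J : nat} (w : 'I_J -> R -> R -> R) (ws : R -> R -> R).

Definition feature (u v : R) : 'cV[R]_J.+1 :=
  \col_k oapp (fun j => w j u v) 1 (unlift ord0 k).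

Definition lincomb (b : 'cV[R]_J.+1) (u v : R) : R :=
  (b^T *m feature u v) 0 0.

(* Being zero in L_2 means being zero almost everywhere. *)
Definition features_free : Prop :=
  forall b : 'cV[R]_J.+1,
    ae_eq (@lebesgue2 R) (@unit_square R) (fun z => lincomb b z.1 z.2) (cst 0) ->
    b = 0.

Definition int_square p q (f : R -> R -> 'M[R]_(p, q)) : 'M[R]_(p, q) :=
  mx_Rintegral (@lebesgue2 R) (@unit_square R) (fun z => f z.1 z.2).

Definition gram : 'M[R]_J.+1 :=
  int_square (fun u v => feature u v *m (feature u v)^T).

Definition beta_circ : 'cV[R]_J.+1 :=
  invmx gram *m int_square (fun u v => ws u v *: feature u v).

Definition w_circ (u v : R) : R := lincomb beta_circ u v.

Definition sigma2 (u v : R) : R :=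
  ws u v * (1 - ws u v) + (ws u v - w_circ u v) ^+ 2.

Definition M_mx : 'M[R]_J.+1 :=
  int_square (fun u v => sigma2 u v *: (feature u v *m (feature u v)^T)).

Definition g_proj (u : R) : 'cV[R]_J.+1 :=
  mx_Rintegral (@lebesgue_measure R) [set` `[0, 1]]
    (fun v => (ws u v - w_circ u v) *: feature u v).

Definition Sigma_g : 'M[R]_J.+1 :=
  mx_Rintegral (@lebesgue_measure R) [set` `[0, 1]]
    (fun u => g_proj u *m (g_proj u)^T).

Definition npairs (n : nat) : R := n%:R * (n%:R - 1) / 2.

Definition dyadic_var (n : nat) : 'M[R]_J.+1 :=
  (npairs n)^-1 *: M_mx
  + (4 * (n%:R - 2) / (n%:R * (n%:R - 1))) *: Sigma_g.

End population.

Section design.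
Context d (T : measurableType d) (R : realType) (P : probability T R).

Definition mutually_independent d' (T' : measurableType d') (I : finType)
    (X : I -> {RV P >-> T'}) : Prop :=
  forall (K : {set I}) (B : I -> set T'), (forall i, measurable (B i)) ->
    P [set x | forall i, i \in K -> B i (X i x)]
    = (\prod_(i in K) P (X i @^-1` B i))%E.

Definition is_cond_prob (G : set (set T)) (E : set T) (f : T -> R) : Prop :=
  (forall B : set R, measurable B -> G (f @^-1` B)) /\
  (forall D : set T, G D -> P (D `&` E) = (\int[P]_(x in D) (f x)%:E)%E).

(* A i j is indexed by ordered pairs; the diagonal entries are arbitrary and
   never used. The last field gives the conditional law of the outcomes above
   the diagonal, given U, as a product of Bernoulli laws. *)
Record one_graph_design (n : nat) (ws : R -> R -> R)
    (U : 'I_n -> {RV P >-> R}) (A : 'I_n -> 'I_n -> {RV P >-> bool}) : Prop :=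
  OneGraphDesign {
  design_range : forall i x, U i x \in `[0, 1];
  design_unif : forall i (B : set R), measurable B ->
    distribution P (U i) B = uniform_prob (@ltr01 R) B;
  design_indep : mutually_independent U;
  design_sym : forall i j x, A i j x = A j i x;
  design_cond : forall a : 'I_n -> 'I_n -> bool,
    is_cond_prob (g_sigma_preimage (fun i => U i : T -> R))
      [set x | forall i j : 'I_n, (i < j)%N -> A i j x = a i j]
      (fun x => \prod_(i < n) \prod_(j < n | (i < j)%N)
                  bernoulli_pmf (ws (U i x) (U j x)) (a i j)) }.

End design.

Section statistics.
Context {R : realType} {J : nat} (w : 'I_J -> R -> R -> R).
Context {d} {T : measurableType d} {P : probability T R} {n : nat}.
Context (U : 'I_n -> {RV P >-> R}) (A : 'I_n -> 'I_n -> {RV P >-> bool}).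

Local Notation N := (@npairs R n).

Definition Fpair (i j : 'I_n) (x : T) : 'cV[R]_J.+1 :=
  feature w (U i x) (U j x).

Definition score (ws : R -> R -> R) (x : T) : 'cV[R]_J.+1 :=
  N^-1 *: \sum_(i < n) \sum_(j < n | (i < j)%N)
    ((A i j x)%:R - w_circ w ws (U i x) (U j x)) *: Fpair i j x.

Definition gram_hat (x : T) : 'M[R]_J.+1 :=
  N^-1 *: \sum_(i < n) \sum_(j < n | (i < j)%N) Fpair i j x *m (Fpair i j x)^T.

Definition ridge_gram (nu tau : R) (x : T) : 'M[R]_J.+1 :=
  gram_hat x + (nu / (N * tau ^+ 2))%:M.

Definition beta_hat (nu tau : R) (x : T) : 'cV[R]_J.+1 :=
  invmx (ridge_gram nu tau x) *m
  (N^-1 *: \sum_(i < n) \sum_(j < n | (i < j)%N) (A i j x)%:R *: Fpair i j x).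

Definition residual (b : 'cV[R]_J.+1) (i j : 'I_n) (x : T) : R :=
  (A i j x)%:R - (b^T *m Fpair i j x) 0 0.

Definition row_score (b : 'cV[R]_J.+1) (i : 'I_n) (x : T) : 'cV[R]_J.+1 :=
  \sum_(j < n | j != i) residual b i j x *: Fpair i j x.

Definition V_hat (b : 'cV[R]_J.+1) (x : T) : 'M[R]_J.+1 :=
  (N ^+ 2)^-1 *:
    (\sum_(i < n) row_score b i x *m (row_score b i x)^T
     - \sum_(i < n) \sum_(j < n | (i < j)%N)
         residual b i j x ^+ 2 *: (Fpair i j x *m (Fpair i j x)^T)).

Definition Sigma_dy (nu tau : R) (x : T) : 'M[R]_J.+1 :=
  invmx (ridge_gram nu tau x) *m V_hat (beta_hat nu tau x) x
  *m invmx (ridge_gram nu tau x).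

(* Floored at zero: Sigma_dy need not be positive semidefinite. *)
Definition dir_var (nu tau : R) (l : 'cV[R]_J.+1) (x : T) : R :=
  Num.max 0 ((l^T *m Sigma_dy nu tau x *m l) 0 0).

Definition std_err (nu tau : R) (l : 'cV[R]_J.+1) (x : T) : R :=
  Num.sqrt (dir_var nu tau l x).

(* Where std_err vanishes the quotient is 0, by x / 0 = 0. *)
Definition t_stat (ws : R -> R -> R) (nu tau : R) (l : 'cV[R]_J.+1) (x : T) : R :=
  (l^T *m (beta_hat nu tau x - beta_circ w ws)) 0 0 / std_err nu tau l x.

End statistics.

(* The random variables may live on a different probability space for each n. *)
Section convergence.
Context {R : realType} (d : nat -> measure_display)
  (T : forall n, measurableType (d n)) (P : forall n, probability (T n) R).

Definition cvg_in_probability (X : forall n, T n -> R) (c : R) : Prop :=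
  forall e : R, 0 < e ->
    P n [set x | e <= `|X n x - c|] @[n --> \oo] --> 0%E.

Definition cvg_in_distribution (X : forall n, T n -> R)
    (mu : probability (measurableTypeR R) R) : Prop :=
  forall r : R, {for r, continuous (fun s : R => mu `]-oo, s]%classic)} ->
    P n [set x | X n x <= r] @[n --> \oo] --> mu `]-oo, r]%classic.

End convergence.

Definition quantile (R : realType) (mu : probability (measurableTypeR R) R)
    (p : R) : R :=
  inf [set r : R | (p%:E <= mu `]-oo, r]%classic)%E].

(* Main.v *)
Require Import Defs.
From HB Require Import structures.
From mathcomp Require Import all_boot all_order all_algebra.
From mathcomp Require Import all_classical all_reals all_analysis.
From mathcomp Require Import measurable_realfun.
From mathcomp Require Import ring lra.
Import Order.TTheory GRing.Theory Num.Theory.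
Import numFieldNormedType.Exports.
Set Implicit Arguments.
Unset Strict Implicit.
Unset Printing Implicit Defensive.
Local Open Scope classical_set_scope.
Local Open Scope ring_scope.

(** The error of the ridge estimator is a linear image of the score,
      beta_hat - beta_circ = A^-1 (S - kappa beta_circ),
    and S is an average over pairs of dyads
      h_ij = (A_ij - ws(U_i,U_j)) F_ij + (ws - w_circ)(U_i,U_j) F_ij.
    The first summand has conditional mean zero given the coordinates U; the
    second has mean zero because beta_circ solves the normal equations.

    Everything exact comes from the covariance of two dyads
    ([expectation_dyad2]).  Distinct pairs carry conditionally uncorrelated
    noise, so two dyads on the same pair have covariance M, two dyads that
    share exactly one index have covariance Sigma_g, and two dyads without a
    common index are uncorrelated.  Counting pairs of pairs gives the variance
    of S and the mean of V_hat at beta_circ.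

    The same counts give rates in L2.  The score is within O(1/n) of its
    projection (2/n) sum_i g(U_i) ([hajek_rate]), the normalised row sums
    r_i/(n-1) are within O(n^-1/2) of g(U_i) ([row_rate]), and the sample Gram
    matrix, which is a dyadic average without noise, converges to G.  Hence
    n V_hat is close to (4/n) sum_i g(U_i) g(U_i)^T, and the law of large
    numbers yields 4 Sigma_g.  Replacing beta_circ by beta_hat is harmless
    because n V_hat is locally Lipschitz in the residuals, uniformly in n
    ([dyadic_form_perturb]).

    For the limit law, put y = l^T G^-1 g and let s^2 be its variance.  By the
    projection and the convergence of A^-1, sqrt n l^T (beta_hat - beta_circ)
    differs from 2 s W by a term tending to zero in probability, where
    W = (s sqrt n)^-1 sum_i y(U_i); and sqrt n times the standard error
    converges to 2 s.  Hence the studentised error is W up to a vanishing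
    term.  The normal limit of W is proved by Stein's method: a solution f of
    f'(x) = x f(x) + h(x) - E h(Z) with bounded Lipschitz derivative
    ([stein_solution]) turns E h(W) - E h(Z) into a discrepancy that is
    O(n^-1/2) by a first order expansion in each summand of W
    ([stein_bound]), and smooth steps h squeeze the indicators of half-lines
    ([clt]).  Coverage follows, since the interval contains the target exactly
    when the studentised error is at most the quantile in absolute value,
    wherever the standard error is positive. *)

(** * Bounded measurable functions *)

Section bounded_measurable.
Context d (T : measurableType d) (R : realType).
Implicit Types (D : set T) (f g : T -> R).

(** The functions of the data and of the coordinates are bounded and measurable,
    and are integrated over sets of finite measure. These two facts are preserved
    by ring operations and settle their integrability. *)
Definition bmeas D f :=
  measurable_fun D f /\ exists K, forall x, D x -> `|f x| <= K.

Lemma eq_bmeas D f g : (forall x, D x -> f x = g x) -> bmeas D f -> bmeas D g.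
Proof.
move=> fg [mf [K fK]]; split; last by exists K => x Dx; rewrite -fg// fK.
by apply: eq_measurable_fun mf => x; rewrite inE => /fg.
Qed.

Lemma bmeas_cst D c : bmeas D (cst c).
Proof. by split; [exact: measurable_cst | exists `|c|]. Qed.

Lemma bmeasD D f g : bmeas D f -> bmeas D g -> bmeas D (fun x => f x + g x).
Proof.
move=> [mf [K fK]] [mg [L gL]]; split; first exact: measurable_funD.
by exists (K + L) => x Dx; rewrite (le_trans (ler_normD _ _))// lerD// ?fK ?gL.
Qed.

Lemma bmeasN D f : bmeas D f -> bmeas D (fun x => - f x).
Proof.
move=> [mf [K fK]]; split; first exact: measurableT_comp.
by exists K => x Dx; rewrite normrN fK.
Qed.

Lemma bmeasB D f g : bmeas D f -> bmeas D g -> bmeas D (fun x => f x - g x).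
Proof. by move=> bf bg; apply: bmeasD => //; exact: bmeasN. Qed.

Lemma bmeasM D f g : bmeas D f -> bmeas D g -> bmeas D (fun x => f x * g x).
Proof.
move=> [mf [K fK]] [mg [L gL]]; split; first exact: measurable_funM.
by exists (K * L) => x Dx; rewrite normrM ler_pM// ?fK ?gL.
Qed.

Lemma bmeasZ D c f : bmeas D f -> bmeas D (fun x => c * f x).
Proof. by move=> bf; apply: bmeasM => //; exact: bmeas_cst. Qed.

Lemma bmeasX D f n : bmeas D f -> bmeas D (fun x => f x ^+ n).
Proof.
move=> bf; elim: n => [|n IH]; first exact: bmeas_cst.
apply: (eq_bmeas (f := fun x => f x * f x ^+ n)); last exact: bmeasM.
by move=> x _; rewrite exprS.
Qed.

Lemma bmeas_sum D (I : Type) (s : seq I) (Q : pred I) (F : I -> T -> R) :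
  (forall i, Q i -> bmeas D (F i)) -> bmeas D (fun x => \sum_(i <- s | Q i) F i x).
Proof.
move=> bF; elim: s => [|i s IH].
  by apply: eq_bmeas (bmeas_cst D 0) => x _; rewrite big_nil.
case/boolP: (Q i) => [Qi|/negbTE Qi]; last first.
  by apply: eq_bmeas IH => x _; rewrite big_cons Qi.
by apply: eq_bmeas (bmeasD (bF _ Qi) IH) => x _; rewrite big_cons Qi.
Qed.

Lemma bmeas_prod D (I : Type) (s : seq I) (Q : pred I) (F : I -> T -> R) :
  (forall i, Q i -> bmeas D (F i)) ->
  bmeas D (fun x => \prod_(i <- s | Q i) F i x).
Proof.
move=> bF; elim: s => [|i s IH].
  by apply: eq_bmeas (bmeas_cst D 1) => x _; rewrite big_nil.
case/boolP: (Q i) => [Qi|/negbTE Qi]; last first.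
  by apply: eq_bmeas IH => x _; rewrite big_cons Qi.
by apply: eq_bmeas (bmeasM (bF _ Qi) IH) => x _; rewrite big_cons Qi.
Qed.

Lemma bmeas_norm D f : bmeas D f -> bmeas D (fun x => `|f x|).
Proof.
move=> [mf [K fK]]; split; first exact: measurableT_comp.
by exists K => x Dx; rewrite normr_id fK.
Qed.

Lemma bmeas_bound D f : bmeas D f ->
  exists2 K, 0 < K & forall x, D x -> `|f x| <= K.
Proof.
move=> [_ [K fK]]; exists (`|K| + 1); first by rewrite ltr_wpDl.
move=> x Dx; apply: le_trans (fK _ Dx) _.
by apply: le_trans (ler_norm K) _; rewrite lerDl.
Qed.

Section integral.
Variables (mu : {measure set T -> \bar R}) (D : set T).
Hypotheses (mD : measurable D) (muD : (mu D < +oo)%E).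

Lemma bmeas_integrable f : bmeas D f -> mu.-integrable D (EFin \o f).
Proof.
move=> [mf [K fK]]; apply: measurable_bounded_integrable => //.
exists K; split; first by rewrite num_real.
by move=> M KM x Dx; apply: le_trans (fK _ Dx) (ltW KM).
Qed.

Lemma RintD f g : bmeas D f -> bmeas D g ->
  \int[mu]_(x in D) (f x + g x) = \int[mu]_(x in D) f x + \int[mu]_(x in D) g x.
Proof. by move=> bf bg; rewrite RintegralD//; exact: bmeas_integrable. Qed.

Lemma RintB f g : bmeas D f -> bmeas D g ->
  \int[mu]_(x in D) (f x - g x) = \int[mu]_(x in D) f x - \int[mu]_(x in D) g x.
Proof. by move=> bf bg; rewrite RintegralB//; exact: bmeas_integrable. Qed.

Lemma RintZ c f : bmeas D f -> \int[mu]_(x in D) (c * f x) = c * \int[mu]_(x in D) f x.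
Proof. by move=> bf; rewrite RintegralZl//; exact: bmeas_integrable. Qed.

Lemma RintZr c f : bmeas D f -> \int[mu]_(x in D) (f x * c) = \int[mu]_(x in D) f x * c.
Proof. by move=> bf; rewrite RintegralZr//; exact: bmeas_integrable. Qed.

Lemma Rint_sum (I : Type) (s : seq I) (Q : pred I) (F : I -> T -> R) :
  (forall i, Q i -> bmeas D (F i)) ->
  \int[mu]_(x in D) (\sum_(i <- s | Q i) F i x) = \sum_(i <- s | Q i) \int[mu]_(x in D) F i x.
Proof.
move=> bF; elim: s => [|i s IH].
  rewrite big_nil; under eq_Rintegral do rewrite big_nil.
  by rewrite Rintegral_cst// mul0r.
rewrite big_cons; under eq_Rintegral do rewrite big_cons.
by case: ifPn => // Qi; rewrite RintD ?IH//; [exact: bF|exact: bmeas_sum].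
Qed.

Lemma le_Rint f g : bmeas D f -> bmeas D g -> (forall x, D x -> f x <= g x) ->
  \int[mu]_(x in D) f x <= \int[mu]_(x in D) g x.
Proof. by move=> bf bg; apply: le_Rintegral => //; exact: bmeas_integrable. Qed.

Lemma EFin_Rint f : bmeas D f ->
  (\int[mu]_(x in D) f x)%:E = (\int[mu]_(x in D) (f x)%:E)%E.
Proof.
by move=> bf; rewrite fineK//; apply: integrable_fin_num => //;
  exact: bmeas_integrable.
Qed.

End integral.
End bounded_measurable.

Lemma bmeas_comp d1 d2 (T1 : measurableType d1) (T2 : measurableType d2)
    (R : realType) (D : set T2) (f : T2 -> R) (X : T1 -> T2) :
  measurable D -> bmeas D f -> measurable_fun setT X ->
  (forall x, D (X x)) -> bmeas setT (fun x => f (X x)).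
Proof.
move=> mD [mf [K fK]] mX DX; split; last by exists K => x _; exact/fK/DX.
by apply: (measurable_comp mD) => // _ [x _ <-]; exact: DX.
Qed.

Lemma Rint_probability_cst d (T : measurableType d) (R : realType)
  (P : probability T R) (c : R) : \int[P]_x c = c.
Proof.
rewrite Rintegral_cst// [X in fine X](_ : _ = 1%E) ?mulr1//.
exact: probability_setT.
Qed.

Ltac bm := repeat first
  [ assumption | exact: bmeas_cst | apply: bmeasB | apply: bmeasD | apply: bmeasN
  | apply: bmeasM | apply: bmeasX | (apply: bmeas_sum => ? ?)
  | apply: bmeas_norm ].

(** * Independence of one coordinate from the others *)

Section freezing.
Context d d1 d2 (T : measurableType d) (T1 : measurableType d1)
  (T2 : measurableType d2) (R : realType) (P : probability T R).
Variables (V : {mfun T >-> T1}) (W : {mfun T >-> T2}).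
Hypothesis indepVW : forall A B, measurable A -> measurable B ->
  P (V @^-1` A `&` W @^-1` B) = (P (V @^-1` A) * P (W @^-1` B))%E.

Let VW (x : T) : T1 * T2 := (V x, W x).

Let mVW : measurable_fun setT VW.
Proof. exact: measurable_fun_pair. Qed.

HB.instance Definition _ := isMeasurableFun.Build _ _ _ _ VW mVW.

Let joint_law (A : set (T1 * T2)) : measurable A ->
  (distribution P V \x distribution P W)%E A = distribution P VW A.
Proof.
apply: product_measure_unique => A1 A2 mA1 mA2.
by rewrite -[RHS]indepVW.
Qed.

(** By independence the joint law of the pair is the product of the two laws, so
    Fubini integrates one variable out while the other is kept fixed. *)
Lemma integral_freeze (f : T1 * T2 -> \bar R) :
  measurable_fun setT f -> P.-integrable setT (f \o VW) ->
  (\int[P]_x f (V x, W x) =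
   \int[P]_x \int[distribution P W]_y f (V x, y))%E.
Proof.
move=> mf intf.
have intf' : (distribution P V \x distribution P W)%E.-integrable setT f.
  have h : (distribution P VW).-integrable setT f.
    by apply: integrable_pushforward => //.
  apply/integrableP; split => //.
  rewrite (eq_measure_integral (distribution P VW)); last first.
    by move=> A mA _; exact: joint_law.
  by case/integrableP : h.
rewrite -[LHS](@integral_distribution _ _ _ _ _ P VW f)//.
rewrite -(eq_measure_integral (D := setT) (f := f) (distribution P VW)
   (m1 := (distribution P V \x distribution P W)%E)); last first.
  by move=> A mA _; exact: joint_law.
rewrite -integral12_prod_meas1//.
have iF := integrable_fubini_F intf'.
have mF := measurable_int _ iF.
rewrite integral_distribution//; apply/integrableP; split.
  exact: measurableT_comp mF _.
rewrite -(@ge0_integral_distribution _ _ _ _ _ P V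
  (fun y => `|fubini_F (distribution P W) f y|%E))//.
- by case/integrableP : iF.
- exact: measurableT_comp.
Qed.

End freezing.

Notation I1 f := (\int[lebesgue_measure]_(u in [set` `[0, 1]]) f u).
Notation I2 p := (\int[@lebesgue2 _]_(z in @unit_square _) p z.1 z.2).
Definition bmeas01 (R : realType) (f : R -> R) := bmeas [set` `[0, 1 : R]] f.
Definition sqbmeas (R : realType) (p : R -> R -> R) :=
  bmeas (@unit_square R) (fun z : R * R => p z.1 z.2).
(** For independent uniform U and U', the conditional expectation of p(U, U')
    given U. *)
Definition marginal (R : realType) (p : R -> R -> R) (u : R) : R := I1 (p u).

Section population_integrals.
Context {R : realType}.
Implicit Types (p : R -> R -> R) (f : R -> R).

Lemma measurable01 : measurable ([set` `[0, 1]] : set R).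
Proof. exact: measurable_itv. Qed.

Lemma measurable_square : measurable (@unit_square R).
Proof. by apply: measurableX; exact: measurable_itv. Qed.

Lemma lebesgue01 : lebesgue_measure ([set` `[0, 1]] : set R) = 1%E.
Proof. by rewrite lebesgue_measure_itv/= lte01 oppr0 adde0. Qed.

Lemma lebesgue_square : @lebesgue2 R (@unit_square R) = 1%E.
Proof.
rewrite /lebesgue2 /unit_square product_measure1E; try exact: measurable01.
by rewrite -[RHS]mule1; congr (_ * _)%E; exact: lebesgue01.
Qed.

Lemma lebesgue01_fin : (lebesgue_measure [set` `[0, 1 : R]%R] < +oo)%E.
Proof. by rewrite lebesgue01 ltry. Qed.

Lemma lebesgue_square_fin : (@lebesgue2 R (@unit_square R) < +oo)%E.
Proof. by rewrite lebesgue_square ltry. Qed.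

Lemma sqbmeas_section p u : u \in `[0, 1] -> sqbmeas p -> bmeas01 (p u).
Proof.
move=> u01 [mp [K pK]]; split; last by exists K => v v01; exact: (pK (u, v)).
apply: (@measurable_comp _ _ _ _ _ _ _ (fun z : R * R => p z.1 z.2)
  _ (fun v => (u, v)) measurable_square) => //.
  by move=> _ [v v01 <-].
exact/measurable_funTS/pair1_measurable.
Qed.

Lemma sqbmeas_fst f : bmeas01 f -> sqbmeas (fun u _ => f u).
Proof.
move=> [mf [K fK]]; split; last by exists K => -[u v] [/= u01 _]; exact: fK.
apply: (@measurable_comp _ _ _ _ _ _ _ f _ fst measurable01) => //.
  by move=> _ [[u v] [? ?] <-].
exact: measurable_funTS.
Qed.

Lemma sqbmeas_snd f : bmeas01 f -> sqbmeas (fun _ u => f u).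
Proof.
move=> [mf [K fK]]; split; last by exists K => -[u v] [/= _ v01]; exact: fK.
apply: (@measurable_comp _ _ _ _ _ _ _ f _ snd measurable01) => //.
  by move=> _ [[u v] [? ?] <-].
exact: measurable_funTS.
Qed.

(** Only the values on the square are controlled; the extension by zero is
    measurable on the whole plane, where Fubini applies. *)
Lemma sqbmeas_patch p : sqbmeas p ->
  bmeas setT ((fun z : R * R => p z.1 z.2) \_ (@unit_square R)).
Proof.
move=> [mp [K pK]]; split.
  by apply/(measurable_restrictT _ _).1 => //; exact: measurable_square.
exists `|K| => z _; rewrite patchE; case: ifPn => [|_]; last by rewrite normr0.
by rewrite inE => /pK /le_trans; apply; exact: ler_norm.
Qed.

Lemma integrable_patch p : sqbmeas p -> (@lebesgue2 R).-integrable setT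
  (EFin \o (fun z : R * R => p z.1 z.2) \_ (@unit_square R)).
Proof.
move=> bp; rewrite -restrict_EFin.
have [+ _] := @integrable_restrict _ _ _ (@lebesgue2 R) _ measurable_square _
  measurableT (fun z : R * R => (p z.1 z.2)%:E).
apply; rewrite setTI.
exact: (@bmeas_integrable _ _ _ (@lebesgue2 R) _ measurable_square
  lebesgue_square_fin _ bp).
Qed.

Lemma bmeas_marginal p : sqbmeas p -> bmeas01 (marginal p).
Proof.
move=> bp; have [K K0 pK] := bmeas_bound bp.
pose q := (fun z : R * R => p z.1 z.2) \_ (@unit_square R).
have bq := sqbmeas_patch bp.
have qE u v : u \in `[0, 1] -> v \in `[0, 1] -> q (u, v) = p u v.
  by move=> u01 v01; rewrite /q patchE mem_set.
pose m1 := mrestr (@lebesgue_measure R) measurable01.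
split; last first.
  exists K => u u01; apply: (le_trans (le_normr_Rintegral _ _)).
  - exact: measurable01.
  - by apply: bmeas_integrable; [exact: measurable01|exact: lebesgue01_fin|
      exact: sqbmeas_section].
  - have -> : K = \int[lebesgue_measure]_(v in [set` `[0, 1]]) K :> R.
      rewrite Rintegral_cst; last exact: measurable01.
      by rewrite [X in fine X](_ : _ = 1%E) ?mulr1//; exact: lebesgue01.
    apply: le_Rint; [exact: measurable01|exact: lebesgue01_fin| |
      exact: bmeas_cst|by move=> v v01; exact: (pK (u, v))].
    by apply: bmeas_norm; exact: sqbmeas_section.
suff h : measurable_fun [set` `[0, 1 : R]%R]
    (fun u => \int[lebesgue_measure]_(v in [set` `[0, 1]%R]) (p u v)%:E)%E.
  have mf := fine_measurable (@measurableT _ (\bar R)).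
  have := measurableT_comp mf h.
  by apply.
apply: (@eq_measurable_fun _ _ _ _ _
   (fun u => \int[lebesgue_measure]_v (q (u, v))%:E)%E).
  move=> u; rewrite inE => u01; rewrite [RHS]integral_mkcond/=.
  apply: eq_integral => v _; rewrite /q restrict_EFin /= !patchE.
  case: (boolP (v \in [set` `[0, 1]])) => [|/negP v01].
    by rewrite inE => v01; rewrite mem_set.
  by rewrite memNset// => -[/= _ v01']; apply: v01; rewrite inE.
apply: measurable_funTS.
have : (@lebesgue2 R).-integrable setT (EFin \o q).
  exact: integrable_patch.
by move=> /integrable_fubini_F/measurable_int.
Qed.

Lemma I2_marginal p : sqbmeas p -> I2 p = I1 (marginal p).
Proof.
move=> bp.
pose q := (fun z : R * R => p z.1 z.2) \_ (@unit_square R).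
have iq : (@lebesgue2 R).-integrable setT (EFin \o q).
  exact: integrable_patch.
rewrite Rintegral_mkcond -/q.
rewrite /Rintegral -(integral12_prod_meas1 iq).
congr fine; rewrite [RHS]integral_mkcond; apply: eq_integral => u _.
rewrite patchE/= /fubini_F/= /q; case: ifPn => [|/negP u01].
  rewrite inE => u01.
  rewrite (@EFin_Rint _ _ _ lebesgue_measure _ measurable01 lebesgue01_fin _
    (sqbmeas_section u01 bp)).
  rewrite [RHS]integral_mkcond; apply: eq_integral => v _.
  rewrite restrict_EFin /= !patchE.
  case: (boolP (v \in [set` `[0, 1]])) => [|/negP v01].
    by rewrite inE => v01; rewrite mem_set.
  by rewrite memNset// => -[/= _ v01']; apply: v01; rewrite inE.
rewrite -[RHS](integral0 lebesgue_measure setT); apply: eq_integral => v _.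
by rewrite patchE memNset// => -[/= u01' _]; apply: u01; rewrite inE.
Qed.

End population_integrals.

Section tower.
Context d (T : measurableType d) (R : realType) (P : probability T R) (n : nat).
Variable U : 'I_n -> {RV P >-> R}.
Hypothesis U01 : forall i x, U i x \in `[0, 1].
Hypothesis Uunif : forall i (B : set R), measurable B ->
  distribution P (U i) B = uniform_prob (@ltr01 R) B.
Hypothesis Uindep : mutually_independent U.

(** The events that constrain all coordinates but the k-th: a pi-system that
    generates the sigma-algebra of these coordinates. *)
Definition off_cylinders (k : 'I_n) : set (set T) :=
  [set D | exists B : 'I_n -> set R, (forall i, measurable (B i)) /\
     D = [set x | forall i, i \in ~: [set k]%SET -> B i (U i x)]].

Definition off_algebra (k : 'I_n) := g_sigma_algebraType (off_cylinders k).

Definition off_measurable (k : 'I_n) (X : T -> R) :=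
  @measurable_fun _ _ (off_algebra k) R setT X.

Let measurable_cylinder (K : {set 'I_n}) (B : 'I_n -> set R) :
  (forall i, measurable (B i)) ->
  measurable [set x : T | forall i, i \in K -> B i (U i x)].
Proof.
move=> mB.
rewrite (_ : [set _ | _] = \big[setI/setT]_(i in K) (U i @^-1` B i)).
  apply: bigsetI_measurable => i _; rewrite -[X in measurable X]setTI.
  by apply: measurable_funP.
rewrite -bigcap_seq_cond; apply/seteqP; split => x /=.
  by move=> h i /= /andP[_ iK]; exact: h.
by move=> h i iK; apply: h => /=; rewrite mem_index_enum.
Qed.

Lemma off_cylinders_measurable k : off_cylinders k `<=` @measurable _ T.
Proof. by move=> _ [B [mB ->]]; exact: measurable_cylinder. Qed.

Lemma off_algebra_measurable k : <<s off_cylinders k >> `<=` @measurable _ T.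
Proof.
apply: smallest_sub; first exact: sigma_algebra_measurable.
exact: off_cylinders_measurable.
Qed.

Lemma off_measurable_measurable k X :
  off_measurable k X -> measurable_fun setT X.
Proof. by move=> mX _ B mB; apply: off_algebra_measurable; exact: mX. Qed.

Lemma off_measurable_coord k i : i != k -> off_measurable k (U i).
Proof.
move=> ik _ B mB; apply: sub_sigma_algebra.
exists (fun j => if j == i then B else setT); split.
  by move=> j; case: ifP.
rewrite setTI; apply/seteqP; split => x /=.
  by move=> Bx j _; case: eqP => // ->.
by move=> /(_ i); rewrite eqxx; apply; rewrite !inE.
Qed.

(** As functions of D both sides are finite measures. They agree on the
    pi-system of cylinders by mutual independence, hence on the sigma-algebra
    that it generates. *)
Lemma off_algebra_indep k D B : <<s off_cylinders k >> D -> measurable B ->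
  P (D `&` U k @^-1` B) = (P D * P (U k @^-1` B))%E.
Proof.
move=> sD mB.
have mUB : measurable (U k @^-1` B).
  by rewrite -[X in measurable X]setTI; exact: measurable_funP.
have fUB : P (U k @^-1` B) \is a fin_num by exact: fin_num_measure.
pose r : {nonneg R} := NngNum (fine_ge0 (measure_ge0 P (U k @^-1` B))).
have msE C : mscale r P C = (P (U k @^-1` B) * P C)%E by rewrite /mscale/= fineK.
rewrite muleC -msE.
apply: (@g_sigma_algebra_measure_unique _ _ _ (off_cylinders k) _
  (fun _ => setT) _ _ (mrestr P mUB) (mscale r P)) => //.
- exact: off_cylinders_measurable.
- move=> _; exists (fun _ => setT); split => //.
  by apply/seteqP; split.
- by rewrite bigcup_const.
- move=> _ _ [B1 [mB1 ->]] [B2 [mB2 ->]].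
  exists (fun i => B1 i `&` B2 i); split; first by move=> i; exact: measurableI.
  apply/seteqP; split => x /=.
    by move=> [h1 h2] i ik; split; [exact: h1|exact: h2].
  by move=> h; split => i /h[].
- move=> _ [B1 [mB1 ->]]; apply: etrans (esym (msE _)).
  pose B2 i := if i == k then B else B1 i.
  have mB2 i : measurable (B2 i) by rewrite /B2; case: ifP.
  have B2E i : i \in ~: [set k]%SET -> B2 i = B1 i.
    by rewrite !inE /B2 => /negbTE ->.
  transitivity (P [set x | forall i, i \in [set: 'I_n]%SET -> B2 i (U i x)]).
    congr (P _); apply/seteqP; split => x /=.
      move=> [h1 h2] i _; case: (eqVneq i k) => [->|ik]; first by rewrite /B2 eqxx.
      by rewrite B2E; [apply: h1|]; rewrite !inE.
    move=> h; split; last by have := h k (finset.in_setT _); rewrite /B2 eqxx.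
    by move=> i ik; rewrite -B2E//; apply: h; rewrite finset.in_setT.
  rewrite [LHS]Uindep// (bigD1 k) ?finset.in_setT//= {1}/B2 eqxx; congr (_ * _)%E.
  rewrite Uindep//; apply: eq_big => [i|i]; first by rewrite !inE.
  by move=> /andP[_ ik]; rewrite B2E// !inE.
- by move=> _; rewrite ltey_eq fin_num_measure.
Qed.

Let mU k : @measurable_fun _ _ T (measurableTypeR R) setT (U k).
Proof.
move=> mT B mB; have := @measurable_funP _ _ _ _ setT (U k) mT B; exact.
Qed.

(* The same coordinate, with values in the measurable space that carries the
   Lebesgue measure: its display differs from the default one of the reals. *)
Let coord k : T -> measurableTypeR R := U k.

HB.instance Definition _ k := isMeasurableFun.Build _ _ _ _ (coord k) (mU k).

Let integral_coord k (f : R -> R) : bmeas01 f ->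
  (\int[distribution P (coord k)]_(u in [set` `[0, 1]%R]) (f u)%:E =
   \int[lebesgue_measure]_(u in [set` `[0, 1]%R]) (f u)%:E)%E.
Proof.
move=> bf; apply: (eq_measure_integral lebesgue_measure) => A mA A01.
transitivity (uniform_prob (@ltr01 R) A); first exact: Uunif.
rewrite /uniform_prob integral_uniform_pdf.
rewrite (setIidl A01) (eq_integral (fun=> 1%E)).
  by rewrite integral_cst// mul1e.
by move=> u; rewrite inE => /A01/=; rewrite in_itv/= /uniform_pdf => ->; rewrite subr0 invr1.
Qed.

(** The pair of X and Z is a function of the other coordinates, hence independent
    of U k, whose uniform law can be integrated out first. *)
Lemma expectation_tower k (X Z : T -> R) (p : R -> R -> R) :
  off_measurable k X -> off_measurable k Z -> bmeas setT X ->
  (forall x, Z x \in `[0, 1]) -> sqbmeas p ->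
  \int[P]_x (X x * p (Z x) (U k x)) = \int[P]_x (X x * marginal p (Z x)).
Proof.
move=> oX oZ bX Z01 bp.
have mX := off_measurable_measurable oX; have mZ := off_measurable_measurable oZ.
pose V x : R * R := (X x, Z x).
have mV : measurable_fun setT V by exact: measurable_fun_pair.
have oV : @measurable_fun _ _ (off_algebra k) (R * R)%type setT V.
  exact: measurable_fun_pair.
pose V' : {mfun T >-> (R * R)%type} := mfun_Sub (mem_set mV).
have indepVU A B : measurable A -> measurable B ->
    P (V' @^-1` A `&` coord k @^-1` B) =
    (P (V' @^-1` A) * P (coord k @^-1` B))%E.
  move=> mA mB; apply: off_algebra_indep => //.
  by have := oV measurableT _ mA; rewrite setTI.
pose q := (fun z : R * R => p z.1 z.2) \_ (@unit_square R).
have bq := sqbmeas_patch bp.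
pose f (z : R * R * R) : \bar R := (z.1.1 * q (z.1.2, z.2))%:E.
have qE u v : u \in `[0, 1] -> v \in `[0, 1] -> q (u, v) = p u v.
  by move=> u01 v01; rewrite /q patchE mem_set.
have mf : measurable_fun setT f.
  apply/measurable_EFinP; apply: measurable_funM.
    exact: measurableT_comp.
  apply: (@measurableT_comp _ _ _ _ _ _ q); first by have [] := bq.
  apply: measurable_fun_pair => //.
  exact: measurableT_comp.
have bpZU : bmeas setT (fun x => p (Z x) (U k x)).
  apply: (bmeas_comp (X := fun x => (Z x, U k x)) measurable_square bp).
    exact: measurable_fun_pair.
  by move=> x; split; [exact: Z01|exact: U01].
have PT : (P setT < +oo)%E by rewrite probability_setT ltry.
have intf : P.-integrable setT (f \o (fun x => (V' x, coord k x))).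
  apply: (eq_integrable _ (EFin \o (fun x => X x * p (Z x) (U k x)))) => //.
    by move=> x _; rewrite /f /= qE// ?Z01 ?U01.
  by apply: bmeas_integrable => //; exact: bmeasM.
have := integral_freeze indepVU mf intf; rewrite /Rintegral => h.
congr fine; transitivity (\int[P]_x f (V' x, coord k x))%E.
  by apply: eq_integral => x _; rewrite /f /= qE// ?Z01 ?U01.
rewrite {}h; apply: eq_integral => x _; rewrite /f /=.
have bpz : bmeas01 (p (Z x)) by exact: sqbmeas_section.
transitivity (\int[distribution P (coord k)]_(u in [set` `[0, 1]%R]) (X x * p (Z x) u)%:E)%E.
  rewrite [RHS]integral_mkcond; apply: eq_integral => u _.
  rewrite restrict_EFin/= patchE.
  case: (boolP (u \in [set` `[0, 1]%R])) => [|/negP u01].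
    by rewrite inE => u01; rewrite qE.
  rewrite /q patchE memNset ?mulr0// => -[/= _ u01']; apply: u01.
  by rewrite inE.
rewrite (integral_coord _ (f := fun u => X x * p (Z x) u)); last exact: bmeasZ.
rewrite -(@EFin_Rint _ _ _ lebesgue_measure _ measurable01 lebesgue01_fin)//.
  by rewrite (@RintZ _ _ _ lebesgue_measure _ measurable01 lebesgue01_fin).
exact: bmeasZ.
Qed.

End tower.

(** * Conditional law of the outcomes *)

Section edges.
Context d (T : measurableType d) (R : realType) (P : probability T R) (n : nat).
Variables (ws : R -> R -> R) (U : 'I_n -> {RV P >-> R})
  (A : 'I_n -> 'I_n -> {RV P >-> bool}).
Hypothesis hws : graphon ws.
Hypothesis hd : one_graph_design ws U A.

Definition U_generators : set (set T) :=
  \big[setU/set0]_(i < n) preimage_set_system setT (U i) measurable.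

Definition U_algebra := g_sigma_algebraType U_generators.

Definition U_measurable (X : T -> R) :=
  @measurable_fun _ _ U_algebra R setT X.

Lemma preimage_U_generators i B : measurable B -> U_generators (U i @^-1` B).
Proof.
move=> mB; rewrite /U_generators (bigD1 i)//=; left.
by exists B => //; rewrite setTI.
Qed.

Lemma U_measurable_coord i : U_measurable (U i).
Proof.
move=> _ B mB; apply: sub_sigma_algebra; rewrite setTI.
exact: preimage_U_generators.
Qed.

Lemma U_generators_measurable : U_generators `<=` @measurable _ T.
Proof.
rewrite /U_generators; elim/big_ind: _ => [//|B C hB hC D [/hB|/hC]//|i _].
by move=> _ [B mB <-]; exact: measurable_funP.
Qed.

Lemma U_algebra_measurable : <<s U_generators >> `<=` @measurable _ T.
Proof.
apply: smallest_sub; first exact: sigma_algebra_measurable.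
exact: U_generators_measurable.
Qed.

Lemma U_measurable_measurable X : U_measurable X -> measurable_fun setT X.
Proof. by move=> mX _ B mB; apply: U_algebra_measurable; exact: mX. Qed.

Let PT : (P setT < +oo)%E. Proof. by rewrite probability_setT ltry. Qed.

Import HBNNSimple.

(** The hypothesis on a and b says that they have the same conditional
    expectation given U. Simple functions and monotone convergence extend it
    from events to U-measurable factors. *)
Lemma ge0_integral_density (a b X : T -> R) :
  measurable_fun setT a -> measurable_fun setT b ->
  (forall x, 0 <= a x) -> (forall x, 0 <= b x) ->
  (forall D, <<s U_generators >> D ->
    \int[P]_(x in D) (a x)%:E = \int[P]_(x in D) (b x)%:E)%E ->
  U_measurable X -> (forall x, 0 <= X x) ->
  (\int[P]_x (X x * a x)%:E = \int[P]_x (X x * b x)%:E)%E.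
Proof.
move=> ma mb a0 b0 ab mX X0.
have mEX : @measurable_fun _ _ U_algebra (\bar R) setT (EFin \o X).
  exact/measurable_EFinP.
pose f_ := nnsfun_approx measurableT mEX.
have fT k : measurable_fun setT (f_ k : T -> R).
  exact/U_measurable_measurable/measurable_funPT.
have limE (c : T -> R) : measurable_fun setT c -> (forall x, 0 <= c x) ->
   (\int[P]_x (X x * c x)%:E = lim (\int[P]_x (f_ k x * c x)%:E @[k --> \oo]))%E.
  move=> mc c0; rewrite -monotone_convergence//=.
  - apply: eq_integral => x _; apply/esym/cvg_lim => //=.
    under eq_fun do rewrite EFinM.
    rewrite EFinM; apply: cvgeZr => //.
    by apply: (cvg_nnsfun_approx measurableT mEX) => // y _; rewrite lee_fin X0.
  - by move=> k; apply/measurable_EFinP; apply: measurable_funM.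
  - by move=> k x _; rewrite lee_fin mulr_ge0.
  - move=> x _ k l kl; rewrite lee_fin ler_wpM2r//.
    by have /lefP := nd_nnsfun_approx measurableT mEX kl; exact.
rewrite !limE//; apply: congr_lim; apply/funext => k.
have sumE (c : T -> R) : measurable_fun setT c -> (forall x, 0 <= c x) ->
   (\int[P]_x (f_ k x * c x)%:E =
    \sum_(r \in range (f_ k)) r%:E * \int[P]_(x in f_ k @^-1` [set r]) (c x)%:E)%E.
  move=> mc c0.
  have mr r : @measurable d T (f_ k @^-1` [set r]).
    by have := fT k measurableT [set r] (measurable_set1 r); rewrite setTI.
  under eq_integral.
    move=> x _; rewrite EFinM fimfunE -fsumEFin// ge0_mule_fsuml; last first.
      by move=> r; rewrite EFinM nnfun_muleindic_ge0.
    over.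
  rewrite ge0_integral_fsum//; last 2 first.
  - move=> r; apply: emeasurable_funM; last exact/measurable_EFinP.
    by apply/measurable_EFinP/measurable_funM => //; exact: measurable_indic.
  - by move=> r x _; rewrite mule_ge0 ?lee_fin//; rewrite -lee_fin EFinM nnfun_muleindic_ge0.
  apply: eq_fsbigr => r _.
  case: (ltP r 0) => r0.
    rewrite preimage_nnfun0// integral_set0 mule0.
    by under eq_integral do rewrite indic0 mulr0 mul0e; rewrite integral0.
  rewrite -ge0_integralZl//; last 2 first.
  - exact/measurable_funTS/measurable_EFinP.
  - by move=> x _; rewrite lee_fin.
  rewrite [RHS]integral_mkcond.
  apply: eq_integral => x _; rewrite patchE indicE.
  by case: ifPn => _; rewrite ?mulr1 ?mulr0 ?mul0e.
rewrite !sumE//; apply: eq_fsbigr => r _; congr (_ * _)%E; apply: ab.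
have := (measurable_funPT (f_ k)) measurableT [set r] (measurable_set1 r).
by rewrite setTI.
Qed.

Let wU (p : 'I_n * 'I_n) (x : T) : R := ws (U p.1 x) (U p.2 x).

Let wU01 p x : 0 <= wU p x <= 1.
Proof. by apply: (graphon_range hws); exact: (design_range hd). Qed.

Let upper : pred ('I_n * 'I_n) := fun p => (p.1 < p.2)%N.

Let edge_pmf (a : 'I_n * 'I_n -> bool) (x : T) : R :=
  \prod_(p | upper p) bernoulli_pmf (wU p x) (a p).

Let edge_event (a : 'I_n * 'I_n -> bool) (x : T) : R :=
  \prod_(p | upper p) (A p.1 p.2 x == a p)%:R.

Let bernoulli_pmf01 p b x : 0 <= bernoulli_pmf (wU p x) b <= 1.
Proof.
have /andP[w0 w1] := wU01 p x; rewrite /bernoulli_pmf; case: b; rewrite ?w0//.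
by rewrite subr_ge0 w1 gerBl.
Qed.

Lemma U_measurable_pair (p : R -> R -> R) i j : sqbmeas p ->
  U_measurable (fun x => p (U i x) (U j x)).
Proof.
move=> [mp _].
apply: (@measurable_comp _ _ _ U_algebra _ _ _ (fun z : R * R => p z.1 z.2)
   setT (fun x => (U i x, U j x)) measurable_square) => //.
- by move=> _ [x _ <-]; split; exact: (design_range hd).
- by apply: measurable_fun_pair; exact: U_measurable_coord.
Qed.

Lemma bmeas_pair (p : R -> R -> R) i j : sqbmeas p ->
  bmeas setT (fun x => p (U i x) (U j x)).
Proof.
move=> bp; split; first exact: (U_measurable_measurable (U_measurable_pair i j bp)).
by have [K _ pK] := bmeas_bound bp; exists K => x _; apply: (pK (U i x, U j x));
  split; exact: (design_range hd).
Qed.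

Lemma sqbmeas_ws : sqbmeas ws.
Proof.
split; first exact: graphon_measurable hws.
exists 1 => -[u v] [/= u01 v01].
by have /andP[w0 w1] := graphon_range hws u01 v01; rewrite ger0_norm.
Qed.

Lemma bmeas_edge i j : bmeas setT (fun x => (A i j x)%:R : R).
Proof.
split; last by exists 1 => x _; case: (A i j x); rewrite ?normr1 ?normr0.
apply: (eq_measurable_fun (fun x => if A i j x then 1 else 0 : R)).
  by move=> x _; case: (A i j x).
apply: measurable_fun_ifT => //; exact: measurable_funPT.
Qed.

Let edge_eventE a : edge_event a =
  \1_[set x | forall i j : 'I_n, (i < j)%N -> A i j x = a (i, j)].
Proof.
apply/funext => x; rewrite indicE; case: (boolP (x \in _)).
  rewrite inE => h; rewrite /edge_event big1// => -[i j] ij.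
  by rewrite h//= eqxx.
rewrite notin_setE /= => h; apply/eqP; rewrite prodf_seq_eq0; apply/hasP.
apply: contra_notP h => h i j ij; apply/eqP; apply: contra_notT h => h.
by exists (i, j); rewrite ?mem_index_enum//= /upper/= ij (negbTE h) eqxx.
Qed.

Let edge_pmfE a : edge_pmf a = fun x => \prod_(i < n) \prod_(j < n | (i < j)%N)
  bernoulli_pmf (ws (U i x) (U j x)) (a (i, j)).
Proof.
by apply/funext => x; rewrite pair_big_dep/=; apply: eq_bigr => -[].
Qed.

Let bmeas_pmf a : bmeas setT (edge_pmf a) /\ U_measurable (edge_pmf a).
Proof.
have [h _] := design_cond hd (fun i j => a (i, j)).
have mU : U_measurable (edge_pmf a).
  by move=> _ B mB; rewrite setTI edge_pmfE; exact: h.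
split => //; split; first exact: U_measurable_measurable.
exists 1 => x _; rewrite ger0_norm; last first.
  by apply: prodr_ge0 => p _; have /andP[] := bernoulli_pmf01 p (a p) x.
by apply: prodr_ile1 => p _; exact: bernoulli_pmf01.
Qed.

Let bmeas_event a : bmeas setT (edge_event a).
Proof.
apply: bmeas_prod => p _.
apply: (eq_bmeas (f := fun x => if a p then (A p.1 p.2 x)%:R
                                else 1 - (A p.1 p.2 x)%:R : R)).
  by move=> x _; case: (a p); case: (A _ _ x); rewrite ?subr0 ?subrr.
case: (a p); first exact: bmeas_edge.
by apply: bmeasB; [exact: bmeas_cst|exact: bmeas_edge].
Qed.

Let expectation_event a X : bmeas setT X -> U_measurable X ->
  \int[P]_x (X x * edge_event a x) = \int[P]_x (X x * edge_pmf a x).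
Proof.
move=> bX mX.
have [K K0 XK] := bmeas_bound bX.
have [bp mp] := bmeas_pmf a; have be := bmeas_event a.
have key (Y : T -> R) : U_measurable Y -> (forall x, 0 <= Y x) ->
    \int[P]_x (Y x * edge_event a x) = \int[P]_x (Y x * edge_pmf a x).
  move=> mY Y0; congr fine; apply: ge0_integral_density => //.
  - by have [] := be.
  - by have [] := bp.
  - by move=> x; apply: prodr_ge0.
  - by move=> x; apply: prodr_ge0 => p _; have /andP[] := bernoulli_pmf01 p (a p) x.
  - move=> D sD; have [_ h] := design_cond hd (fun i j => a (i, j)).
    rewrite edge_pmfE -(h D sD) edge_eventE.
    rewrite (_ : (fun x => _) = EFin \o \1_[set x | forall i j : 'I_n, (i < j)%N -> A i j x = a (i, j)])//.
    rewrite integral_indic//; first by rewrite setIC.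
      exact: U_algebra_measurable.
    have := be.1 measurableT [set 1] (measurable_set1 1).
    rewrite setTI edge_eventE (_ : _ @^-1` _ = [set x | forall i j : 'I_n, (i < j)%N -> A i j x = a (i, j)])//.
    apply/seteqP; split => x /=; rewrite indicE.
      by case: (boolP (x \in _)) => [|_ /eqP]; rewrite ?inE// eq_sym oner_eq0.
    by move=> h'; rewrite mem_set.
(* Adding the bound K makes the factor nonnegative. *)
have -> : (fun x => X x * edge_event a x) =
    (fun x => (X x + K) * edge_event a x - K * edge_event a x).
  by apply/funext => x; rewrite mulrDl addrK.
have -> : (fun x => X x * edge_pmf a x) =
    (fun x => (X x + K) * edge_pmf a x - K * edge_pmf a x).
  by apply/funext => x; rewrite mulrDl addrK.
have bK : bmeas setT (fun x => X x + K) by bm.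
have mK : U_measurable (fun x => X x + K) by apply: measurable_funD.
rewrite !RintB//; try bm; congr (_ - _).
  by apply: key => // x; rewrite -lerBlDr sub0r lerNl (le_trans _ (XK x I))// -normrN ler_norm.
by apply: (key (fun=> K)) => [|_]; [exact: measurable_cst|exact: ltW].
Qed.

(** Given U the outcomes above the diagonal are independent Bernoulli variables.
    Expanding both products over all outcome configurations reduces the identity
    to a single configuration, where it is the assumed conditional law. *)
Lemma expectation_edges (g : 'I_n * 'I_n -> bool -> R) X :
  bmeas setT X -> U_measurable X ->
  \int[P]_x (X x * \prod_(p | upper p) g p (A p.1 p.2 x)) =
  \int[P]_x (X x * \prod_(p | upper p)
                     (wU p x * g p true + (1 - wU p x) * g p false)).
Proof.
move=> bX mX.
have expand (c : 'I_n * 'I_n -> bool -> T -> R) x :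
   \prod_(p | upper p) (\sum_(b : bool) c p b x * g p b) =
   \sum_(a in pfamily false upper (fun _ => predT))
     \prod_(p | upper p) g p (a p) * \prod_(p | upper p) c p (a p) x.
  rewrite (big_distr_big_dep false); apply: eq_bigr => a _.
  by rewrite -big_split/=; apply: eq_bigr => p _; rewrite mulrC.
have LE x : X x * \prod_(p | upper p) g p (A p.1 p.2 x) =
   \sum_(a in pfamily false upper (fun _ => predT))
     \prod_(p | upper p) g p (a p) * (X x * edge_event a x).
  rewrite (eq_bigr (fun p => \sum_(b : bool) (A p.1 p.2 x == b)%:R * g p b)).
    rewrite (expand (fun p b x => (A p.1 p.2 x == b)%:R)) mulr_sumr.
    by apply: eq_bigr => a _; rewrite mulrCA.
  by move=> p _; rewrite big_bool; case: (A _ _ x); rewrite /= ?mul1r ?mul0r ?addr0 ?add0r.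
have RE x : X x * \prod_(p | upper p)
      (wU p x * g p true + (1 - wU p x) * g p false) =
   \sum_(a in pfamily false upper (fun _ => predT))
     \prod_(p | upper p) g p (a p) * (X x * edge_pmf a x).
  rewrite (eq_bigr (fun p => \sum_(b : bool) bernoulli_pmf (wU p x) b * g p b)).
    rewrite (expand (fun p b x => bernoulli_pmf (wU p x) b)) mulr_sumr.
    by apply: eq_bigr => a _; rewrite mulrCA.
  by move=> p _; rewrite big_bool.
under eq_Rintegral do rewrite LE; under [RHS]eq_Rintegral do rewrite RE.
have be a : bmeas setT (fun x => X x * edge_event a x).
  by apply: bmeasM => //; exact: bmeas_event.
have bp a : bmeas setT (fun x => X x * edge_pmf a x).
  by apply: bmeasM => //; have [] := bmeas_pmf a.
rewrite !Rint_sum//; try by move=> a _; exact: bmeasZ.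
by apply: eq_bigr => a _; rewrite !RintZ// expectation_event.
Qed.

End edges.

Section noise.
Context d (T : measurableType d) (R : realType) (P : probability T R) (n : nat).
Variables (ws : R -> R -> R) (U : 'I_n -> {RV P >-> R})
  (A : 'I_n -> 'I_n -> {RV P >-> bool}).
Hypothesis hws : graphon ws.
Hypothesis hd : one_graph_design ws U A.

Definition noise (i j : 'I_n) (x : T) : R :=
  (A i j x)%:R - ws (U i x) (U j x).

Let PT : (P setT < +oo)%E. Proof. by rewrite probability_setT ltry. Qed.

Lemma noiseC i j x : noise i j x = noise j i x.
Proof.
rewrite /noise (design_sym hd) (graphon_sym hws)//; exact: (design_range hd).
Qed.

Let bw i j : bmeas setT (fun x => ws (U i x) (U j x)).
Proof. exact: (bmeas_pair hd i j (sqbmeas_ws hws)). Qed.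

Let mw i j : U_measurable U (fun x => ws (U i x) (U j x)).
Proof. exact: (U_measurable_pair hd i j (sqbmeas_ws hws)). Qed.

Let bA i j : bmeas setT (fun x => (A i j x)%:R : R).
Proof. exact: bmeas_edge. Qed.

Lemma bmeas_noise i j : bmeas setT (noise i j).
Proof. exact: bmeasB. Qed.

Lemma U_measurableM (X Y : T -> R) :
  U_measurable U X -> U_measurable U Y -> U_measurable U (fun x => X x * Y x).
Proof. by move=> mX mY; apply: measurable_funM. Qed.

Let expectation_edge (X : T -> R) (i j : 'I_n) :
  bmeas setT X -> U_measurable U X -> (i < j)%N ->
  \int[P]_x (X x * (A i j x)%:R) = \int[P]_x (X x * ws (U i x) (U j x)).
Proof.
move=> bX mX ij; pose p := (i, j).
have := expectation_edges hws hd (fun q b => if q == p then b%:R else 1) bX mX.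
under eq_Rintegral => x _.
  rewrite (bigD1 p)//= eqxx big1 ?mulr1; last by move=> q /andP[_ /negbTE ->].
  over.
move=> ->; apply: eq_Rintegral => x _; congr (_ * _).
rewrite (bigD1 p)//= eqxx big1 ?mulr1; first by rewrite mulr0 addr0.
by move=> q /andP[_ /negbTE ->]; rewrite !mulr1 addrC subrK.
Qed.

Let expectation_edge2 (X : T -> R) (i j k l : 'I_n) :
  bmeas setT X -> U_measurable U X -> (i < j)%N -> (k < l)%N -> (k, l) != (i, j) ->
  \int[P]_x (X x * ((A i j x)%:R * (A k l x)%:R)) =
  \int[P]_x (X x * (ws (U i x) (U j x) * ws (U k x) (U l x))).
Proof.
move=> bX mX ij kl pq; pose p := (i, j); pose q := (k, l).
have qp : (q == p) = false by exact: negbTE.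
have := expectation_edges hws hd
  (fun r b => if r == p then b%:R else if r == q then b%:R else 1) bX mX.
under eq_Rintegral => x _.
  rewrite (bigD1 p)//= eqxx (bigD1 q) ?kl//= qp eqxx big1 ?mulr1.
    over.
  by move=> r /andP[/andP[_ /negbTE ->] /negbTE ->].
move=> ->; apply: eq_Rintegral => x _; congr (_ * _).
rewrite (bigD1 p)//= eqxx (bigD1 q) ?kl//= qp eqxx big1 ?mulr1.
  by rewrite !mulr0 !addr0.
move=> r /andP[/andP[_ /negbTE ->] /negbTE ->].
by rewrite !mulr1 addrC subrK.
Qed.

Lemma expectation_noise X i j : bmeas setT X -> U_measurable U X -> i != j ->
  \int[P]_x (X x * noise i j x) = 0.
Proof.
move=> bX mX.
wlog ij : i j / (i < j)%N => [h|_].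
  move=> neq; case: (ltngtP i j) => [lt|lt|/val_inj eq].
  - exact: h.
  - by under eq_Rintegral do rewrite noiseC; rewrite h// eq_sym.
  - by rewrite eq eqxx in neq.
under eq_Rintegral do rewrite mulrBr.
by rewrite RintB ?expectation_edge ?subrr//; bm.
Qed.

(** A 0-1 outcome equals its square, so the squared noise is affine in it. *)
Lemma expectation_noise_sq X i j : bmeas setT X -> U_measurable U X -> i != j ->
  \int[P]_x (X x * noise i j x ^+ 2) =
  \int[P]_x (X x * (ws (U i x) (U j x) * (1 - ws (U i x) (U j x)))).
Proof.
move=> bX mX.
wlog ij : i j / (i < j)%N => [h|_].
  move=> neq; case: (ltngtP i j) => [lt|lt|/val_inj eq].
  - exact: h.
  - under eq_Rintegral do rewrite noiseC.
    rewrite h// 1?eq_sym//; apply: eq_Rintegral => x _.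
    by rewrite (graphon_sym hws)//; exact: (design_range hd).
  - by rewrite eq eqxx in neq.
pose v x := ws (U i x) (U j x).
have bv : bmeas setT v by exact: bw.
have mv : U_measurable U v by exact: mw.
pose Y x := X x * (1 - 2 * v x).
have bY : bmeas setT Y by bm.
have mY : U_measurable U Y.
  apply: U_measurableM => //; apply: measurable_funB => //.
  exact: measurable_funM.
have E x : X x * noise i j x ^+ 2 = Y x * (A i j x)%:R + X x * v x ^+ 2.
  rewrite /noise /Y -/(v x); case: (A i j x) => /=; ring.
under eq_Rintegral do rewrite E.
rewrite RintD//; try by bm.
rewrite expectation_edge// -RintD//; try by bm.
by apply: eq_Rintegral => x _; rewrite -/(v x) /Y; ring.
Qed.

(** Outcomes on different pairs are conditionally independent, so in the expanded
    product each of them may be replaced by its conditional mean. *)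
Lemma expectation_noise2 X i j k l : bmeas setT X -> U_measurable U X ->
  i != j -> k != l -> (k, l) != (i, j) -> (k, l) != (j, i) ->
  \int[P]_x (X x * (noise i j x * noise k l x)) = 0.
Proof.
move=> bX mX.
wlog ij : i j / (i < j)%N => [h|_].
  move=> neq; case: (ltngtP i j) => [lt|lt|/val_inj eq].
  - exact: h.
  - move=> kl n1 n2; under eq_Rintegral do rewrite (noiseC i j).
    by rewrite h// 1?eq_sym.
  - by rewrite eq eqxx in neq.
wlog kl : k l / (k < l)%N => [h|_].
  move=> neq; case: (ltngtP k l) => [lt|lt|/val_inj eq].
  - exact: h.
  - move=> n1 n2; under eq_Rintegral do rewrite (noiseC k l).
    rewrite h// 1?[l == k]eq_sym//.
      by move: n2; rewrite !xpair_eqE andbC.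
    by move: n1; rewrite !xpair_eqE andbC.
  - by rewrite eq eqxx in neq.
move=> nij _; pose v x := ws (U i x) (U j x); pose v' x := ws (U k x) (U l x).
have bv : bmeas setT v by exact: bw.
have mv : U_measurable U v by exact: mw.
have bv' : bmeas setT v' by exact: bw.
have mv' : U_measurable U v' by exact: mw.
have bX1 : bmeas setT (fun x => X x * v x) by bm.
have bX2 : bmeas setT (fun x => X x * v' x) by bm.
have E x : X x * (noise i j x * noise k l x) =
    X x * ((A i j x)%:R * (A k l x)%:R) - (X x * v' x) * (A i j x)%:R
    - (X x * v x) * (A k l x)%:R + X x * (v x * v' x).
  by rewrite /noise -/(v x) -/(v' x); ring.
under eq_Rintegral do rewrite E.
rewrite RintD ?RintB//; try by bm.
rewrite expectation_edge2// !expectation_edge//; try exact: U_measurableM.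
rewrite -!RintB// -?RintD//; try by bm.
transitivity (\int[P]_x (0 : R)); last by rewrite Rintegral_cst// mul0r.
by apply: eq_Rintegral => x _; rewrite -/(v x) -/(v' x); ring.
Qed.

End noise.

(** * Second moments of dyads *)

(** The data of a centred dyadic average: its summand at i, j is
    (A_ij - ws) phi + m, evaluated at the coordinates of i and j. Scores, with
    phi a feature, and centred entries of the sample Gram matrix, with phi = 0,
    are both of this form. *)
Record dyadic_kernel (R : realType) (phi m : R -> R -> R) : Prop := DyadicKernel {
  kernel_phi : sqbmeas phi;
  kernel_phi_sym : forall u v, u \in `[0, 1] -> v \in `[0, 1] -> phi u v = phi v u;
  kernel_m : sqbmeas m;
  kernel_m_sym : forall u v, u \in `[0, 1] -> v \in `[0, 1] -> m u v = m v u;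
  kernel_centred : I1 (marginal m) = 0 }.

(** The covariance of two dyads on the same pair: the Bernoulli variance of the
    outcome plus the covariance of the two functions m. *)
Definition kernel_var (R : realType) (ws phi m phi' m' : R -> R -> R) : R :=
  I2 (fun u v => ws u v * (1 - ws u v) * (phi u v * phi' u v) + m u v * m' u v).

(** The covariance of two dyads with exactly one common index: the noise drops
    out and only the projections on the common coordinate remain. *)
Definition marginal_cov (R : realType) (m m' : R -> R -> R) : R :=
  I1 (fun u => marginal m u * marginal m' u).

Section dyadic_moments.
Context d (T : measurableType d) (R : realType) (P : probability T R) (n : nat).
Variables (ws : R -> R -> R) (U : 'I_n -> {RV P >-> R})
  (A : 'I_n -> 'I_n -> {RV P >-> bool}).
Hypothesis hws : graphon ws.
Hypothesis hd : one_graph_design ws U A.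

Local Notation E := (Rintegral P setT).
Local Notation e := (noise ws U A).

Definition dyad (phi m : R -> R -> R) (i j : 'I_n) (x : T) : R :=
  e i j x * phi (U i x) (U j x) + m (U i x) (U j x).

Let PT : (P setT < +oo)%E. Proof. by rewrite probability_setT ltry. Qed.

Let U01 : forall i x, U i x \in `[0, 1]. Proof. exact: (design_range hd). Qed.

Let bp i j (p : R -> R -> R) : sqbmeas p ->
  bmeas setT (fun x => p (U i x) (U j x)).
Proof. exact: (bmeas_pair hd). Qed.

Lemma bmeas_coord i (f : R -> R) : bmeas01 f -> bmeas setT (fun x => f (U i x)).
Proof. by move=> bf; apply: (bmeas_comp measurable01 bf) => // x; exact: U01. Qed.

Let off_pair k i j (p : R -> R -> R) : i != k -> j != k -> sqbmeas p ->
  off_measurable U k (fun x => p (U i x) (U j x)).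
Proof.
move=> ik jk [mp _].
apply: (@measurable_comp _ _ _ (off_algebra U k) _ _ _
   (fun z : R * R => p z.1 z.2)
   setT (fun x => (U i x, U j x)) measurable_square) => //.
- by move=> _ [x _ <-]; split; exact: U01.
- by apply: measurable_fun_pair; exact: off_measurable_coord.
Qed.

Lemma off_coord k i (f : R -> R) : i != k -> bmeas01 f ->
  off_measurable U k (fun x => f (U i x)).
Proof. by move=> ik bf; exact: (off_pair ik ik (sqbmeas_fst bf)). Qed.

Let tower k (X Z : T -> R) p := @expectation_tower _ _ _ P n U U01
  (design_unif hd) (design_indep hd) k X Z p.

Lemma expectation_coord_indep k X (f : R -> R) : off_measurable U k X ->
  bmeas setT X -> bmeas01 f -> E (fun x => X x * f (U k x)) = E X * I1 f.
Proof.
move=> oX bX bf.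
have := @tower k X (cst 0) (fun _ v => f v) oX (@measurable_cst _ _ _ _ _ _) bX.
rewrite /marginal => ->; last 2 first.
- by move=> x; rewrite in_itv/= lexx ler01.
- exact: sqbmeas_snd.
by rewrite RintZr.
Qed.

Lemma expectation_coord k (f : R -> R) : bmeas01 f ->
  E (fun x => f (U k x)) = I1 f.
Proof.
move=> bf.
have := @expectation_coord_indep k (cst 1) f (@measurable_cst _ _ _ _ _ _)
  (bmeas_cst _ _) bf.
rewrite (Rint_probability_cst P 1) mul1r => <-.
by apply: eq_Rintegral => x _; rewrite mul1r.
Qed.

Lemma expectation_pair i j (p : R -> R -> R) : i != j -> sqbmeas p ->
  E (fun x => p (U i x) (U j x)) = I2 p.
Proof.
move=> ij bp'.
have := @tower j (cst 1) (U i) p (@measurable_cst _ _ _ _ _ _)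
  (off_measurable_coord ij) (bmeas_cst _ _) (U01 i) bp'.
under eq_Rintegral do rewrite mul1r.
under [in X in _ = X -> _]eq_Rintegral do rewrite mul1r.
by move=> ->; rewrite expectation_coord ?I2_marginal//; exact: bmeas_marginal.
Qed.

Lemma expectation_coord2 i j (f g : R -> R) : bmeas01 f -> bmeas01 g ->
  I1 g = 0 ->
  E (fun x => f (U i x) * g (U j x)) = (i == j)%:R * I1 (fun u => f u * g u).
Proof.
move=> bf bg g0; case: eqVneq => [<-|ij].
  by rewrite mul1r (expectation_coord i (f := fun u => f u * g u))//; exact: bmeasM.
rewrite expectation_coord_indep//; last exact: bmeas_coord.
  by rewrite g0 mulr0 mul0r.
exact: off_coord.
Qed.

Let kernel_sym (m : R -> R -> R) :
  (forall u v, u \in `[0, 1] -> v \in `[0, 1] -> m u v = m v u) ->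
  forall i j x, m (U i x) (U j x) = m (U j x) (U i x).
Proof. by move=> ms i j x; apply: ms; exact: U01. Qed.

Let expectation_pair_coord i j k (m : R -> R -> R) (f : R -> R) :
  i != j -> sqbmeas m ->
  (forall u v, u \in `[0, 1] -> v \in `[0, 1] -> m u v = m v u) ->
  bmeas01 f -> I1 f = 0 ->
  E (fun x => m (U i x) (U j x) * f (U k x)) =
  ((k == i)%:R + (k == j)%:R) * I1 (fun u => marginal m u * f u).
Proof.
move=> ij bm' ms bf f0.
have same a b : a != b -> E (fun x => m (U a x) (U b x) * f (U a x)) =
    I1 (fun u => marginal m u * f u).
  move=> ab; under eq_Rintegral do rewrite mulrC.
  rewrite (@tower b (fun x => f (U a x)) (U a))//.
  - rewrite (expectation_coord a (f := fun u => f u * marginal m u)).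
      by apply: eq_Rintegral => u _; rewrite mulrC.
    by apply: bmeasM => //; exact: bmeas_marginal.
  - exact: off_coord.
  - exact: off_measurable_coord.
  - exact: bmeas_coord.
case: (eqVneq k i) => [->|ki].
  by rewrite (negbTE ij) addr0 mul1r same.
case: (eqVneq k j) => [->|kj].
  rewrite add0r mul1r -(same j i) 1?eq_sym//.
  by apply: eq_Rintegral => x _; rewrite (kernel_sym ms).
rewrite addr0 mul0r expectation_coord_indep// ?f0 ?mulr0//; last exact: bp.
by apply: off_pair; rewrite // eq_sym.
Qed.

Section two_kernels.
Variables (phi m phi' m' : R -> R -> R).
Hypotheses (hk : dyadic_kernel phi m) (hk' : dyadic_kernel phi' m').

Lemma dyadC i j x : dyad phi m i j x = dyad phi m j i x.
Proof.
by rewrite /dyad (noiseC hws hd) (kernel_sym (kernel_phi_sym hk))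
  (kernel_sym (kernel_m_sym hk)).
Qed.

Lemma bmeas_dyad i j : bmeas setT (dyad phi m i j).
Proof.
apply: bmeasD; last exact: (bp _ _ (kernel_m hk)).
apply: bmeasM; [exact: (bmeas_noise hws hd)|exact: (bp _ _ (kernel_phi hk))].
Qed.

Lemma expectation_dyad i j : i != j -> E (dyad phi m i j) = 0.
Proof.
move=> ij; have bm := kernel_m hk; have bphi := kernel_phi hk.
rewrite /dyad RintD//; last 2 first.
- by apply: bmeasM; [exact: (bmeas_noise hws hd)|exact: bp].
- exact: bp.
under eq_Rintegral do rewrite mulrC.
rewrite (expectation_noise hws hd)//; [|exact: bp|exact: (U_measurable_pair hd)].
by rewrite expectation_pair// I2_marginal// (kernel_centred hk) addr0.
Qed.

Lemma expectation_dyad_coord i j k (f : R -> R) : i != j -> bmeas01 f ->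
  I1 f = 0 ->
  E (fun x => dyad phi m i j x * f (U k x)) =
  ((k == i)%:R + (k == j)%:R) * I1 (fun u => marginal m u * f u).
Proof.
move=> ij bf f0; have bm := kernel_m hk; have bphi := kernel_phi hk.
have bfk := bmeas_coord k bf.
have E x : dyad phi m i j x * f (U k x) =
  (phi (U i x) (U j x) * f (U k x)) * e i j x + m (U i x) (U j x) * f (U k x).
  by rewrite /dyad; ring.
under eq_Rintegral do rewrite E.
have bX : bmeas setT (fun x => phi (U i x) (U j x) * f (U k x)).
  by apply: bmeasM => //; exact: bp.
rewrite RintD//; last 2 first.
- by apply: bmeasM => //; exact: (bmeas_noise hws hd).
- by apply: bmeasM => //; exact: bp.
rewrite (expectation_noise hws hd)//; last first.
  apply: U_measurableM; first exact: (U_measurable_pair hd).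
  exact: (U_measurable_pair hd k k (sqbmeas_fst bf)).
by rewrite add0r expectation_pair_coord//; exact: (kernel_m_sym hk).
Qed.

Lemma bmeas_marginal_cov : bmeas01 (fun u => marginal m u * marginal m' u).
Proof.
by apply: bmeasM; apply: bmeas_marginal; [exact: (kernel_m hk)|exact: (kernel_m hk')].
Qed.

End two_kernels.

Variables (phi m phi' m' : R -> R -> R).
Hypotheses (hk : dyadic_kernel phi m) (hk' : dyadic_kernel phi' m').

Local Notation M := (kernel_var ws phi m phi' m').
Local Notation S := (marginal_cov m m').

(** Averaging over the coordinate of the unmatched index l replaces the second
    dyad by its marginal at U k, which sees the first dyad only if k is one of
    its indices. *)
Let expectation_dyad_other i j k l : i != j -> k != l -> l != i -> l != j ->
  E (fun x => dyad phi m i j x * dyad phi' m' k l x) =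
  ((k == i)%:R + (k == j)%:R) * S.
Proof.
move=> ij kl li lj.
have bm := kernel_m hk; have bphi := kernel_phi hk.
have bm' := kernel_m hk'; have bphi' := kernel_phi hk'.
pose f i j x := phi (U i x) (U j x); pose f' i j x := phi' (U i x) (U j x).
pose g i j x := m (U i x) (U j x); pose g' i j x := m' (U i x) (U j x).
have bf a b : bmeas setT (f a b) by exact: bp.
have bf' a b : bmeas setT (f' a b) by exact: bp.
have bg a b : bmeas setT (g a b) by exact: bp.
have bg' a b : bmeas setT (g' a b) by exact: bp.
have mf a b : U_measurable U (f a b) by exact: (U_measurable_pair hd).
have mf' a b : U_measurable U (f' a b) by exact: (U_measurable_pair hd).
have mg a b : U_measurable U (g a b) by exact: (U_measurable_pair hd).
have mg' a b : U_measurable U (g' a b) by exact: (U_measurable_pair hd).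
have be a b : bmeas setT (e a b) by exact: (bmeas_noise hws hd).
have E x : dyad phi m i j x * dyad phi' m' k l x =
    (f i j x * f' k l x) * (e i j x * e k l x) + (f i j x * g' k l x) * e i j x
    + (g i j x * f' k l x) * e k l x + g i j x * g' k l x.
  by rewrite /dyad -/(f i j x) -/(f' k l x) -/(g i j x) -/(g' k l x); ring.
under eq_Rintegral do rewrite E.
have b1 : bmeas setT (fun x => f i j x * f' k l x) by exact: bmeasM.
have b2 : bmeas setT (fun x => f i j x * g' k l x) by exact: bmeasM.
have b3 : bmeas setT (fun x => g i j x * f' k l x) by exact: bmeasM.
have b4 : bmeas setT (fun x => e i j x * e k l x) by exact: bmeasM.
rewrite !RintD//; try by repeat first [exact: bmeasM | apply: bmeasD].
rewrite (expectation_noise2 hws hd)//; last 3 first.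
- exact: U_measurableM.
- by rewrite xpair_eqE (negbTE lj) andbF.
- by rewrite xpair_eqE (negbTE li) andbF.
rewrite !(expectation_noise hws hd)//; try exact: U_measurableM.
rewrite !add0r.
rewrite (@tower l (g i j) (U k))//; last 2 first.
- by apply: off_pair; rewrite // eq_sym.
- exact: off_measurable_coord.
rewrite expectation_pair_coord//; first exact: (kernel_m_sym hk).
- exact: bmeas_marginal.
- exact: (kernel_centred hk').
Qed.

Let expectation_dyad_same i j : i != j ->
  E (fun x => dyad phi m i j x * dyad phi' m' i j x) = M.
Proof.
move=> ij.
have bm := kernel_m hk; have bphi := kernel_phi hk.
have bm' := kernel_m hk'; have bphi' := kernel_phi hk'.
have bw := sqbmeas_ws hws.
pose f i j x := phi (U i x) (U j x); pose f' i j x := phi' (U i x) (U j x).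
pose g i j x := m (U i x) (U j x); pose g' i j x := m' (U i x) (U j x).
have bf a b : bmeas setT (f a b) by exact: bp.
have bf' a b : bmeas setT (f' a b) by exact: bp.
have bg a b : bmeas setT (g a b) by exact: bp.
have bg' a b : bmeas setT (g' a b) by exact: bp.
have mf a b : U_measurable U (f a b) by exact: (U_measurable_pair hd).
have mf' a b : U_measurable U (f' a b) by exact: (U_measurable_pair hd).
have mg a b : U_measurable U (g a b) by exact: (U_measurable_pair hd).
have mg' a b : U_measurable U (g' a b) by exact: (U_measurable_pair hd).
have be a b : bmeas setT (e a b) by exact: (bmeas_noise hws hd).
have E x : dyad phi m i j x * dyad phi' m' i j x =
    (f i j x * f' i j x) * e i j x ^+ 2
    + (f i j x * g' i j x + g i j x * f' i j x) * e i j x + g i j x * g' i j x.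
  by rewrite /dyad -/(f i j x) -/(f' i j x) -/(g i j x) -/(g' i j x); ring.
under eq_Rintegral do rewrite E.
have b1 : bmeas setT (fun x => f i j x * f' i j x) by exact: bmeasM.
have b2 : bmeas setT (fun x => f i j x * g' i j x + g i j x * f' i j x).
  by apply: bmeasD; exact: bmeasM.
have b3 : bmeas setT (fun x => g i j x * g' i j x) by exact: bmeasM.
rewrite !RintD//; try by repeat first [exact: bmeasX | exact: bmeasM | apply: bmeasD | apply: bmeasM].
rewrite (expectation_noise_sq hws hd)//; last exact: U_measurableM.
rewrite (expectation_noise hws hd)//; last first.
  by apply: measurable_funD; exact: U_measurableM.
have bww : bmeas setT (fun x => ws (U i x) (U j x) * (1 - ws (U i x) (U j x))).
  by apply: (bp i j (p := fun u v => ws u v * (1 - ws u v))); bm.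
rewrite addr0 -RintD//; last exact: bmeasM.
rewrite /kernel_var -(@expectation_pair i j (fun u v => ws u v * (1 - ws u v) *
  (phi u v * phi' u v) + m u v * m' u v) ij); last first.
  apply: (@bmeasD _ _ _ _
   (fun z : R * R => ws z.1 z.2 * (1 - ws z.1 z.2) * (phi z.1 z.2 * phi' z.1 z.2))
   (fun z : R * R => m z.1 z.2 * m' z.1 z.2)); last exact: bmeasM.
  by apply: bmeasM; apply: bmeasM => //; apply: bmeasB => //; exact: bmeas_cst.
by apply: eq_Rintegral => x _; rewrite mulrC.
Qed.

(** Coinciding pairs contribute M and pairs with one common index contribute S.
    The last factor counts two coincidences for coinciding pairs, which is why
    the first term carries M - 2 S. *)
Lemma expectation_dyad2 i j k l : i != j -> k != l ->
  E (fun x => dyad phi m i j x * dyad phi' m' k l x) =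
  ((k == i)%:R * (l == j)%:R + (k == j)%:R * (l == i)%:R) * (M - 2 * S)
  + ((k == i)%:R + (k == j)%:R + (l == i)%:R + (l == j)%:R) * S.
Proof.
move=> ij kl.
case: (boolP ((l == i) || (l == j))) => [|]; last first.
  rewrite negb_or => /andP[li lj]; rewrite expectation_dyad_other//.
  by rewrite (negbTE li) (negbTE lj) !mulr0 !addr0 mul0r add0r.
case: (boolP ((k == i) || (k == j))) => [|]; last first.
  rewrite negb_or => /andP[ki kj] _.
  under eq_Rintegral do rewrite (dyadC hk' k l).
  rewrite expectation_dyad_other//.
    by rewrite (negbTE ki) (negbTE kj) !(mul0r, add0r).
  by rewrite eq_sym.
have ij0 := negbTE ij; have ji0 : (j == i) = false by rewrite eq_sym.
move=> /orP[] /eqP ek /orP[] /eqP el; subst k l; rewrite ?eqxx in kl *.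
- by [].
- by rewrite expectation_dyad_same// ?ij0 ?ji0/=; ring.
- under eq_Rintegral do rewrite (dyadC hk' j i).
  by rewrite expectation_dyad_same// ?ij0 ?ji0/=; ring.
- by [].
Qed.

End dyadic_moments.

Lemma sum_delta (R : realType) n (i : 'I_n) : \sum_(k < n) (k == i)%:R = 1 :> R.
Proof. by rewrite (bigD1 i)//= eqxx big1 ?addr0// => k /negbTE ->. Qed.

Lemma sum_deltaM (R : realType) n (i : 'I_n) (F : 'I_n -> R) :
  \sum_(k < n) (k == i)%:R * F k = F i.
Proof.
by rewrite (bigD1 i)//= eqxx mul1r big1 ?addr0// => k /negbTE ->; rewrite mul0r.
Qed.

Lemma sum_other (R : zmodType) n (i : 'I_n) (F : 'I_n -> R) :
  \sum_(j < n | j != i) F j = \sum_(j < n) F j - F i.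
Proof. by rewrite [in RHS](bigD1 i)//= addrAC subrr add0r. Qed.

Lemma sum_other_cst (R : realType) n (i : 'I_n) (c : R) :
  \sum_(j < n | j != i) c = (n%:R - 1) * c.
Proof. by rewrite sum_other sumr_const card_ord -[c *+ n]mulr_natl mulrBl mul1r. Qed.

Section dyadic_sums.
Context d (T : measurableType d) (R : realType) (P : probability T R) (n : nat).
Variables (ws : R -> R -> R) (U : 'I_n -> {RV P >-> R})
  (A : 'I_n -> 'I_n -> {RV P >-> bool}).
Hypothesis hws : graphon ws.
Hypothesis hd : one_graph_design ws U A.

Local Notation E := (Rintegral P setT).
Local Notation N := (n%:R : R).
Local Notation dyad := (dyad ws U A).

Let PT : (P setT < +oo)%E. Proof. by rewrite probability_setT ltry. Qed.

Definition dyad_row (phi m : R -> R -> R) (i : 'I_n) (x : T) : R :=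
  \sum_(j < n | j != i) dyad phi m i j x.

Definition dyad_total (phi m : R -> R -> R) (x : T) : R :=
  \sum_(i < n) dyad_row phi m i x.

Definition coord_total (f : R -> R) (x : T) : R := \sum_(i < n) f (U i x).

Lemma bmeas_dyad_row phi m i : dyadic_kernel phi m -> bmeas setT (dyad_row phi m i).
Proof. by move=> hk; apply: bmeas_sum => j _; exact: (bmeas_dyad hws hd hk). Qed.

Lemma bmeas_dyad_total phi m : dyadic_kernel phi m -> bmeas setT (dyad_total phi m).
Proof. by move=> hk; apply: bmeas_sum => j _; exact: bmeas_dyad_row. Qed.

Lemma bmeas_coord_total f : bmeas01 f -> bmeas setT (coord_total f).
Proof. by move=> bf; apply: bmeas_sum => j _; exact: (bmeas_coord hd). Qed.

Lemma expectation_coord_total2 (f g : R -> R) : bmeas01 f -> bmeas01 g ->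
  I1 g = 0 ->
  E (fun x => coord_total f x * coord_total g x) = N * I1 (fun u => f u * g u).
Proof.
move=> bf bg g0.
have b i j : bmeas setT (fun x => f (U i x) * g (U j x)).
  by apply: bmeasM; exact: (bmeas_coord hd).
under eq_Rintegral do rewrite big_distrlr/=.
rewrite Rint_sum//; last by move=> i _; apply: bmeas_sum.
rewrite (eq_bigr (fun=> I1 (fun u => f u * g u))).
  by rewrite sumr_const card_ord mulr_natl.
move=> i _; rewrite Rint_sum//.
under eq_bigr do rewrite (expectation_coord2 hd)// eq_sym.
by rewrite -mulr_suml sum_delta mul1r.
Qed.

Section one_kernel.
Variables (phi m : R -> R -> R) (hk : dyadic_kernel phi m).

Lemma expectation_dyad_total : E (dyad_total phi m) = 0.
Proof.
rewrite Rint_sum//; last by move=> i _; exact: bmeas_dyad_row.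
rewrite big1// => i _; rewrite Rint_sum//; last first.
  by move=> j _; exact: (bmeas_dyad hws hd hk).
by rewrite big1// => j ji; rewrite (expectation_dyad hws hd hk)// eq_sym.
Qed.

Variables (f : R -> R) (bf : bmeas01 f) (f0 : I1 f = 0).
Local Notation C := (I1 (fun u => marginal m u * f u)).

Let bdf i j k : bmeas setT (fun x => dyad phi m i j x * f (U k x)).
Proof.
by apply: bmeasM; [exact: (bmeas_dyad hws hd hk)|exact: (bmeas_coord hd)].
Qed.

Lemma expectation_row_coord i :
  E (fun x => dyad_row phi m i x * f (U i x)) = (N - 1) * C.
Proof.
under eq_Rintegral do rewrite mulr_suml.
rewrite Rint_sum// -(sum_other_cst i); apply: eq_bigr => j ji.
rewrite (expectation_dyad_coord hws hd)// 1?eq_sym//.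
by rewrite eqxx (negbTE ji) addr0 mul1r.
Qed.

Lemma expectation_total_coord :
  E (fun x => dyad_total phi m x * coord_total f x) = N * (N - 1) * (2 * C).
Proof.
under eq_Rintegral do rewrite mulr_suml.
rewrite Rint_sum//; last first.
  move=> i _; apply: bmeasM; first exact: bmeas_dyad_row.
  exact: bmeas_coord_total.
rewrite (eq_bigr (fun=> (N - 1) * (2 * C))).
  by rewrite sumr_const card_ord -[_ *+ n]mulr_natl mulrA.
move=> i _; under eq_Rintegral do rewrite mulr_suml.
rewrite Rint_sum//; last first.
  move=> j _; apply: bmeasM; first exact: (bmeas_dyad hws hd hk).
  exact: bmeas_coord_total.
rewrite -(sum_other_cst i); apply: eq_bigr => j ji.
under eq_Rintegral do rewrite mulr_sumr.
rewrite Rint_sum//.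
have ij : i != j by rewrite eq_sym.
rewrite (eq_bigr _ (fun k _ => expectation_dyad_coord hws hd hk k ij bf f0)).
by rewrite -mulr_suml big_split/= !sum_delta.
Qed.

End one_kernel.

Variables (phi m phi' m' : R -> R -> R).
Hypotheses (hk : dyadic_kernel phi m) (hk' : dyadic_kernel phi' m').

Local Notation M := (kernel_var ws phi m phi' m').
Local Notation S := (marginal_cov m m').

Let bdd i j k l : bmeas setT (fun x => dyad phi m i j x * dyad phi' m' k l x).
Proof.
by apply: bmeasM; [exact: (bmeas_dyad hws hd hk)|exact: (bmeas_dyad hws hd hk')].
Qed.

Lemma expectation_row2 i :
  E (fun x => dyad_row phi m i x * dyad_row phi' m' i x) =
  (N - 1) * (M + (N - 2) * S).
Proof.
under eq_Rintegral do rewrite mulr_suml.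
rewrite Rint_sum//; last first.
  move=> j _; apply: bmeasM; first exact: (bmeas_dyad hws hd hk).
  exact: bmeas_dyad_row.
rewrite -(sum_other_cst i); apply: eq_bigr => j ji.
have ij0 : (i == j) = false by rewrite eq_sym (negbTE ji).
under eq_Rintegral do rewrite mulr_sumr.
rewrite Rint_sum//.
rewrite (eq_bigr (fun k => (k == j)%:R * (M - S) + S)); last first.
  move=> k ki; rewrite (expectation_dyad2 hws hd hk hk')// 1?eq_sym//.
  by rewrite eqxx ij0 (negbTE ki) /=; ring.
rewrite big_split/= sum_other_cst sum_other -mulr_suml sum_delta ij0.
by rewrite mul0r; ring.
Qed.

(** Every ordered pair meets two ordered pairs with the same indices and
    4 (n - 2) ordered pairs with one common index. *)
Lemma expectation_total2 :
  E (fun x => dyad_total phi m x * dyad_total phi' m' x) =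
  N * (N - 1) * (2 * M + 4 * (N - 2) * S).
Proof.
under eq_Rintegral do rewrite mulr_suml.
rewrite Rint_sum//; last first.
  move=> j _; apply: bmeasM; first exact: bmeas_dyad_row.
  exact: bmeas_dyad_total.
rewrite (eq_bigr (fun=> (N - 1) * (2 * M + 4 * (N - 2) * S))).
  by rewrite sumr_const card_ord -[_ *+ n]mulr_natl mulrA.
move=> i _; under eq_Rintegral do rewrite mulr_suml.
rewrite Rint_sum//; last first.
  move=> j _; apply: bmeasM; first exact: (bmeas_dyad hws hd hk).
  exact: bmeas_dyad_total.
rewrite -(sum_other_cst i); apply: eq_bigr => j ji.
under eq_Rintegral do rewrite mulr_sumr.
rewrite Rint_sum//; last first.
  move=> k _; apply: bmeasM; first exact: (bmeas_dyad hws hd hk).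
  exact: bmeas_dyad_row.
have ij0 : (i == j) = false by rewrite eq_sym (negbTE ji).
pose a k : R := (k == i)%:R + (k == j)%:R.
have key k : \int[P]_x (dyad phi m i j x * dyad_row phi' m' k x) =
    a k * (M - 2 * S) + (N * a k + 2) * S
    - ((k == i)%:R * ((k == j)%:R * (2 * (M - 2 * S))) + 2 * (a k * S)).
  under eq_Rintegral do rewrite mulr_sumr.
  rewrite Rint_sum//.
  under eq_bigr => l lk.
    rewrite (expectation_dyad2 hws hd hk hk'); [over|by rewrite eq_sym|by rewrite eq_sym].
  rewrite sum_other; congr (_ - _); last by rewrite /a; ring.
  rewrite big_split/= -!mulr_suml !big_split/= -!mulr_sumr !sum_delta.
  by rewrite !sumr_const card_ord /a -[(k == i)%:R *+ n]mulr_natl -[(k == j)%:R *+ n]mulr_natl; ring.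
rewrite (eq_bigr _ (fun k _ => key k)).
have sa : \sum_(k < n) a k = 2 by rewrite big_split/= !sum_delta.
clearbody a.
rewrite big_split/= sumrN !big_split/= -!mulr_suml big_split/= -mulr_sumr sa.
rewrite sum_deltaM ij0 mul0r add0r -mulr_sumr -mulr_suml sa.
by rewrite sumr_const card_ord -[_ *+ n]mulr_natl; ring.
Qed.

End dyadic_sums.

(** * The Gaussian density and distribution function *)

Section pointwise_derivatives.
Context {R : realType}.
Implicit Types (f g : R -> R) (x a b : R).

Lemma is_deriveD_fun f g x a b : is_derive x 1 f a -> is_derive x 1 g b ->
  is_derive x 1 (fun t => f t + g t) (a + b).
Proof. by move=> ? ?; apply: is_deriveD. Qed.

Lemma is_deriveB_fun f g x a b : is_derive x 1 f a -> is_derive x 1 g b ->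
  is_derive x 1 (fun t => f t - g t) (a - b).
Proof. by move=> ? ?; apply: is_deriveB. Qed.

Lemma is_deriveM_fun f g x a b : is_derive x 1 f a -> is_derive x 1 g b ->
  is_derive x 1 (fun t => f t * g t) (a * g x + f x * b).
Proof.
move=> fa gb; apply: is_derive_eq (is_deriveM fa gb) _.
by rewrite addrC mulrC.
Qed.

Lemma is_deriveZ_fun f c x a : is_derive x 1 f a ->
  is_derive x 1 (fun t => c * f t) (c * a).
Proof. by move=> fa; apply: (is_deriveZ c fa). Qed.

End pointwise_derivatives.

Section gaussian_density.
Context {R : realType}.
Implicit Types (x t e : R).

Definition gauss x : R := normal_pdf 0 1 x.

Lemma gaussE x : gauss x = normal_peak 1 * expR (- (x ^+ 2 / 2)).
Proof.
by rewrite /gauss normal_pdfE ?oner_eq0// /normal_fun subr0 expr1n mulNr.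
Qed.

Lemma gauss_gt0 x : 0 < gauss x.
Proof. by rewrite gaussE mulr_gt0 ?expR_gt0// normal_peak_gt0// oner_eq0. Qed.

Lemma gauss_even x : gauss (- x) = gauss x.
Proof. by rewrite !gaussE sqrrN. Qed.

Global Instance is_derive_gauss x : is_derive x 1 gauss (- x * gauss x).
Proof.
have h : is_derive x 1 (fun t : R => - (t ^+ 2 / 2)) (- x).
  rewrite (_ : (fun t : R => _) = (fun t => - 2^-1 * (t * t))); last first.
    by apply/funext => t; field.
  have h := is_deriveM_fun (is_derive_id x 1) (is_derive_id x 1).
  by apply: is_derive_eq (is_deriveZ_fun (- 2^-1) h) _; field.
have h2 := is_deriveZ_fun (normal_peak 1) (is_derive1_comp (is_derive_expR _) h).
rewrite (_ : gauss = fun t => normal_peak 1 * expR (- (t ^+ 2 / 2))).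
  by apply: is_derive_eq h2 _; ring.
by apply/funext => t; rewrite gaussE.
Qed.

Lemma continuous_gauss : continuous gauss.
Proof. by apply: continuous_normal_pdf; exact: oner_neq0. Qed.

Lemma gauss_small e : 0 < e -> exists X, forall t, X <= `|t| -> gauss t <= e.
Proof.
move=> e0; pose p : R := normal_peak 1.
have p0 : 0 < p by rewrite normal_peak_gt0// oner_eq0.
exists (2 * p / e + 1) => t Xt.
have t1 : 1 <= `|t| by rewrite (le_trans _ Xt)// lerDr divr_ge0 ?mulr_ge0 ?ltW.
have tX : 2 * p / e <= `|t| by rewrite (le_trans _ Xt)// lerDl.
rewrite gaussE -/p expRN ler_pdivrMr ?expR_gt0//.
have h : t ^+ 2 / 2 <= expR (t ^+ 2 / 2).
  by rewrite (le_trans _ (expR_ge1Dx _))// lerDr.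
apply: le_trans (ler_wpM2l (ltW e0) h).
have : `|t| <= t ^+ 2 by rewrite -real_normK ?num_real// expr2 ler_peMl.
move: tX; rewrite ler_pdivrMr// => a b.
by rewrite mulrA ler_pdivlMr//; nra.
Qed.

End gaussian_density.

Section vanishing.
Context {R : realType}.
Implicit Types (f y : R -> R).

Definition vanishing f := forall e : R, 0 < e ->
  exists X, forall t, X <= `|t| -> `|f t| <= e.

Lemma derive_ndecr f (df : R -> R) (a b : R) :
  (forall x : R, is_derive x 1 f (df x)) -> a <= b ->
  (forall x, a <= x -> x <= b -> 0 <= df x) -> f a <= f b.
Proof.
move=> fdf ab df0.
have [|c cab] := @MVT_segment _ f df a b ab (fun x _ => fdf x).
  apply: continuous_subspaceT => x.
  exact/differentiable_continuous/derivable1_diffP.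
move: cab; rewrite in_itv/= => /andP[ac cb] eqf.
by rewrite -subr_ge0 eqf mulr_ge0 ?subr_ge0// df0.
Qed.

Lemma derive_lipschitz f (df : R -> R) (K a b : R) :
  (forall x : R, is_derive x 1 f (df x)) ->
  (forall x, `|df x| <= K) -> `|f b - f a| <= K * `|b - a|.
Proof.
move=> fdf dfK; wlog ab : a b / a <= b => [h|].
  by case: (leP a b) => [/h//|/ltW/h]; rewrite distrC (distrC a).
have [|c cab ->] := @MVT_segment _ f df a b ab (fun x _ => fdf x).
  apply: continuous_subspaceT => x.
  exact/differentiable_continuous/derivable1_diffP.
by rewrite normrM ler_wpM2r.
Qed.

Let ode_ub y q (K x : R) : (forall x : R, is_derive x 1 y (x * y x + q x)) ->
  (forall x, `|q x| <= K) -> vanishing (fun t => y t * gauss t) ->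
  x != 0 -> x * y x <= K.
Proof.
move=> dy qK vy x0.
have K0 : 0 <= K by exact: le_trans (qK 0).
pose c : R := K / x; pose G (t : R) : R := (y t - c) * gauss t.
have dG (t : R) : is_derive t 1 G ((q t + c * t) * gauss t).
  have h := is_deriveM_fun (is_deriveB_fun (dy t) (is_derive_cst c t 1))
    (is_derive_gauss t).
  by apply: is_derive_eq h _; rewrite /cst; ring.
have GE (t : R) : G t = y t * gauss t - c * gauss t by rewrite /G -mulrBl.
have vG : vanishing G.
  move=> e e0.
  have [X1 h1] := vy _ (divr_gt0 e0 (ltr0n R 2)).
  have [X2 h2] := @gauss_small R (e / 2 / (`|c| + 1)) ltac:(
    by rewrite divr_gt0// ?divr_gt0// ltr_wpDl).
  exists (Num.max X1 X2) => t; rewrite ge_max => /andP[tX1 tX2].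
  rewrite GE (le_trans (ler_normB _ _))// (splitr e) lerD ?h1//.
  rewrite normrM (ger0_norm (ltW (gauss_gt0 t))).
  have := h2 _ tX2; rewrite ler_pdivlMr ?ltr_wpDl// => h.
  apply: le_trans h; rewrite mulrC; apply: ler_wpM2l; first exact/ltW/gauss_gt0.
  by rewrite lerDl.
have dG0 (t : R) : 0 <= (t - x) * x -> 0 <= (q t + c * t) * gauss t.
  move=> tx; rewrite mulr_ge0 ?(ltW (gauss_gt0 t))//.
  have ct : K <= c * t.
    rewrite /c mulrAC -mulrA ler_peMr//.
    have x2 : 0 < x ^+ 2 by rewrite exprn_even_gt0.
    rewrite -(ler_pM2r x2) mul1r expr2 mulrA divfK//.
    by rewrite -subr_ge0 -mulrBl.
  have := qK t; rewrite ler_norml => /andP[h _].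
  by rewrite -lerBlDr sub0r (le_trans _ h)// lerN2.
have sign_suffices : G x * x <= 0 -> x * y x <= K.
  move=> h; have : x * y x <= x * c.
    have := gauss_gt0 x => g0.
    rewrite -(ler_pM2r g0) -subr_le0 -mulrBl; move: h; rewrite GE.
    by apply: le_trans; rewrite le_eqVlt; apply/orP; left; apply/eqP; ring.
  by rewrite /c mulrCA divff// mulr1.
apply: sign_suffices; case: (ltgtP x 0) x0 => [xn|xp|//] _.
  rewrite nmulr_lle0//.
  rewrite leNgt; apply/negP => Gx.
  have [X hX] := vG _ (divr_gt0 (y := 2) (x := - G x) ltac:(by rewrite oppr_gt0) (ltr0n R 2)).
  pose t := Num.min x (- `|X|).
  have tx : t <= x by rewrite /t ge_min lexx.
  have h' : G t <= G x.
    apply: derive_ndecr dG tx _ => s _ sx; apply: dG0.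
    by rewrite mulr_le0 ?subr_le0// ltW.
  have tX : X <= `|t|.
    rewrite (le_trans (ler_norm X))// -(normrN t) (le_trans _ (ler_norm _))//.
    by rewrite lerNr /t ge_min lexx orbT.
  have := hX _ tX; rewrite ler_norml => /andP[h _]; lra.
rewrite pmulr_lle0//.
rewrite leNgt; apply/negP => Gx.
have [X hX] := vG _ (divr_gt0 Gx (ltr0n R 2)).
pose t := Num.max x `|X|.
have tx : x <= t by rewrite /t le_max lexx.
have h' : G x <= G t.
  apply: derive_ndecr dG tx _ => s xs _; apply: dG0.
  by rewrite mulr_ge0 ?subr_ge0// ltW.
have tX : X <= `|t|.
  rewrite (le_trans (ler_norm X))// (le_trans _ (ler_norm _))//.
  by rewrite /t le_max lexx orbT.
have := hX _ tX; rewrite ler_norml => /andP[_ h]; lra.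
Qed.

(** An a priori estimate for bounded-source solutions of y' = x y + q. With c =
    K / x, the function (y - c) gauss is monotone on the half-line that starts
    at x and points away from 0, and vanishes at its end; its sign at x bounds
    y x by K. The same applies to - y. *)
Lemma ode_bound y q (K x : R) : (forall x : R, is_derive x 1 y (x * y x + q x)) ->
  (forall x, `|q x| <= K) -> vanishing (fun t => y t * gauss t) ->
  `|x * y x| <= K.
Proof.
move=> dy qK vy.
have [->|x0] := eqVneq x 0; first by rewrite mul0r normr0; exact: le_trans (qK 0).
rewrite ler_norml (ode_ub dy qK vy x0) andbT lerNl -mulrN.
apply: (@ode_ub (- y) (- q)) => //.
- move=> t; apply: is_derive_eq (is_deriveN (dy t)) _.
  by rewrite -![(- _) t]/(- _); ring.
- by move=> t; rewrite normrN.
- move=> e e0; have [X h] := vy e e0; exists X => t /h.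
  by rewrite mulNr normrN.
Qed.

End vanishing.

Section gaussian_cdf.
Context {R : realType}.
Notation mu := (@lebesgue_measure R).
Implicit Types (x e : R) (q : R -> R).

(** Divided by the density, this solves y' = x y + q. *)
Definition lower_integral q x : R :=
  \int[mu]_(t in [set` `]-oo, x]]) (q t * gauss t).

Definition Phi : R -> R := lower_integral (cst 1).

Lemma integrable_gauss q K : continuous q -> (forall x, `|q x| <= K) ->
  mu.-integrable setT (EFin \o (fun t => q t * gauss t)).
Proof.
move=> cq qK.
have mq : measurable_fun setT q by exact: continuous_measurable_fun.
have mg : measurable_fun setT (@gauss R).
  by apply: continuous_measurable_fun; exact: continuous_gauss.
have iK : mu.-integrable setT (fun t => K%:E * (gauss t)%:E)%E.
  by apply: integrableZl => //; exact: integrable_normal_pdf.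
apply: le_integrable iK => //; first exact/measurable_EFinP/measurable_funM.
move=> t _; rewrite -EFinM !abse_EFin lee_fin !normrM ler_wpM2r//.
exact: le_trans (qK t) (ler_norm K).
Qed.

Lemma integral_gauss : \int[mu]_t gauss t = 1.
Proof. by rewrite /Rintegral integral_normal_pdf. Qed.

Section lower.
Variables (q : R -> R) (K : R).
Hypotheses (cq : continuous q) (qK : forall x, `|q x| <= K).

Let iq := integrable_gauss cq qK.

Lemma is_derive_lower x : is_derive x 1 (lower_integral q) (q x * gauss x).
Proof.
have h : {for x, continuous (fun t => q t * gauss t)}.
  by apply: cvgM; [exact: cq|exact: continuous_gauss].
have xx1 : x < x + 1 by rewrite ltrDl.
have iqx : mu.-integrable [set` Interval -oo%O (BRight (x + 1))]
    (EFin \o (fun t => q t * gauss t)).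
  by apply: integrableS iq => //; exact: measurable_itv.
have [] := @continuous_FTC1 R (fun t => q t * gauss t) -oo%O x (x + 1) xx1 iqx.
- by rewrite ltNyr.
- exact: h.
by rewrite derive1E => dF dFE; exact: DeriveDef.
Qed.

Let integrable_on (D : set R) : measurable D ->
  mu.-integrable D (EFin \o (fun t => q t * gauss t)).
Proof. by move=> mD; apply: integrableS iq. Qed.

Let upperE x : \int[mu]_t (q t * gauss t) - lower_integral q x =
  \int[mu]_(t in [set` `]x, +oo[]) (q t * gauss t).
Proof.
rewrite -(@Rintegral_itvB R (fun t => q t * gauss t) -oo%O +oo%O x)//.
  by rewrite set_itvNyy.
by rewrite set_itvNyy.
Qed.

Let integrable_gauss_on (D : set R) : measurable D ->
  mu.-integrable D (EFin \o (@gauss R)).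
Proof.
move=> mD; have ig : mu.-integrable setT (EFin \o (@gauss R)).
  exact: integrable_normal_pdf.
by apply: integrableS ig.
Qed.

Let bound_on (D : set R) : measurable D ->
  `|\int[mu]_(t in D) (q t * gauss t)| <= K * \int[mu]_(t in D) gauss t.
Proof.
move=> mD; apply: le_trans (le_normr_Rintegral _ _) _ => //.
  exact: integrable_on.
rewrite -RintegralZl//; last exact: integrable_gauss_on.
apply: le_Rintegral => //.
- by have := integrable_norm (integrable_on mD); exact: eq_integrable.
- have iK : mu.-integrable D (fun t => K%:E * (gauss t)%:E)%E.
    by apply: integrableZl => //; exact: integrable_gauss_on.
  by apply: eq_integrable iK.
- by move=> t _; rewrite normrM (ger0_norm (ltW (gauss_gt0 t))) ler_wpM2r// ltW ?gauss_gt0.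
Qed.

Lemma norm_lower_le x : `|lower_integral q x| <= K * Phi x.
Proof.
rewrite /lower_integral; apply: le_trans (bound_on (measurable_itv _)) _.
rewrite le_eqVlt; apply/orP; left; apply/eqP; congr (_ * _).
by apply: eq_Rintegral => t _; rewrite mul1r.
Qed.

Lemma norm_upper_le x :
  `|\int[mu]_t (q t * gauss t) - lower_integral q x| <=
  K * \int[mu]_(t in [set` `]x, +oo[]) gauss t.
Proof. by rewrite upperE; exact: bound_on (measurable_itv _). Qed.

End lower.

Let c1 : continuous (cst (1 : R) : R -> R).
Proof. by move=> x; exact: cvg_cst. Qed.

Let n1 (x : R) : `|cst 1 x| <= (1 : R). Proof. by rewrite normr1. Qed.

Lemma is_derive_Phi x : is_derive x 1 Phi (gauss x).
Proof. by have := is_derive_lower c1 n1 x; rewrite mul1r. Qed.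

Let Phi_integral x : Phi x = \int[mu]_(t in [set` `]-oo, x]]) gauss t.
Proof. by apply: eq_Rintegral => t _; rewrite mul1r. Qed.

Lemma PhiE x : normal_prob 0 1 [set` `]-oo, x]] = (Phi x)%:E.
Proof.
rewrite Phi_integral /Rintegral fineK//.
apply: (@fin_num_measure _ _ _ (normal_prob 0 1)); exact: measurable_itv.
Qed.

Lemma Phi_upper x : 1 - Phi x = \int[mu]_(t in [set` `]x, +oo[]) gauss t.
Proof.
rewrite -integral_gauss Phi_integral.
rewrite -(@Rintegral_itvB R (@gauss R) -oo%O +oo%O x)//.
  by rewrite set_itvNyy.
by rewrite set_itvNyy; exact: integrable_normal_pdf.
Qed.

Lemma Phi_ge0 x : 0 <= Phi x.
Proof. by rewrite -lee_fin -PhiE. Qed.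

Lemma Phi_le1 x : Phi x <= 1.
Proof.
rewrite -subr_ge0 Phi_upper; apply: Rintegral_ge0 => t _.
exact/ltW/gauss_gt0.
Qed.

Lemma Phi_ndecr x y : x <= y -> Phi x <= Phi y.
Proof.
move=> xy; apply: (derive_ndecr is_derive_Phi xy) => t _ _.
exact/ltW/gauss_gt0.
Qed.

Lemma Phi_limits e : 0 < e ->
  exists X, forall x, X <= x -> 1 - Phi x <= e /\ Phi (- x) <= e.
Proof.
move=> e0.
have cvg1 : normal_prob (0 : R) 1 (`]-oo, k%:R]) @[k --> \oo] --> (1 : R)%:E.
  rewrite -(probability_setT (normal_prob (0 : R) 1)).
  have <- : \bigcup_k [set` `]-oo, (k%:R : R)]] = setT.
    rewrite -subTset => t _ /=; exists (Num.truncn t).+1 => //=.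
    by rewrite in_itv/= ltW// truncnS_gt.
  apply: nondecreasing_cvg_mu => //.
  - by apply: bigcup_measurable => k _; exact: measurable_itv.
  - move=> k l kl; apply/subsetPset => x /=; rewrite !in_itv/= => /le_trans.
    by apply; rewrite ler_nat.
have cvg0 : normal_prob (0 : R) 1 (`]-oo, - k%:R]) @[k --> \oo] --> 0%E.
  rewrite -(measure0 (normal_prob (0 : R) 1)).
  have <- : \bigcap_k [set` `]-oo, (- k%:R : R)]] = set0.
    rewrite -subset0 => t /(_ (Num.truncn (- t)).+1 I).
    by rewrite /= in_itv/= leNgt => /negP; apply; rewrite ltrNl truncnS_gt.
  apply: nonincreasing_cvg_mu => //.
  - by rewrite (le_lt_trans (probability_le1 _ _)) ?ltry//; exact: measurable_itv.
  - by apply: bigcap_measurable => // k _; exact: measurable_itv.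
  - move=> k l kl; apply/subsetPset => x /=; rewrite !in_itv/= => /le_trans.
    by apply; rewrite lerN2 ler_nat.
have {}cvg1 : Phi k%:R @[k --> \oo] --> (1 : R).
  rewrite (_ : (fun _ => _) = fine \o (fun k => normal_prob (0 : R) 1 (`]-oo, k%:R]))).
    exact: fine_cvg.
  by apply/funext => k; rewrite /= PhiE.
have {}cvg0 : Phi (- k%:R) @[k --> \oo] --> (0 : R).
  rewrite (_ : (fun _ => _) = fine \o (fun k => normal_prob (0 : R) 1 (`]-oo, - k%:R]))).
    exact: fine_cvg.
  by apply/funext => k; rewrite /= PhiE.
move/cvgrPdist_le : cvg1 => /(_ e e0)[N1 _ h1].
move/cvgrPdist_le : cvg0 => /(_ e e0)[N2 _ h2].
exists (maxn N1 N2)%:R => x Nx; split.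
  apply: (@le_trans _ _ (1 - Phi N1%:R)).
    by rewrite lerB// Phi_ndecr// (le_trans _ Nx)// ler_nat leq_maxl.
  by have := h1 N1 (leqnn _); rewrite ler_norml => /andP[].
apply: (@le_trans _ _ (Phi (- N2%:R))).
  by rewrite Phi_ndecr// lerN2 (le_trans _ Nx)// ler_nat leq_maxr.
by have := h2 N2 (leqnn _); rewrite sub0r normrN ler_norml => /andP[].
Qed.

(** The sum of Phi x and Phi (- x) has derivative zero and tends to one. *)
Lemma Phi_symm x : Phi (- x) = 1 - Phi x.
Proof.
pose S t := Phi t + Phi (- t).
have dS (t : R) : is_derive t 1 S 0.
  have h := is_derive1_comp (is_derive_Phi (- t)) (is_deriveNid t 1).
  apply: is_derive_eq (is_deriveD_fun (is_derive_Phi t) h) _.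
  by rewrite gauss_even; ring.
have SE t : S t = S x.
  by apply: is_derive_0_is_cst => s; exact: dS.
suff : S x = 1 by rewrite /S => <-; rewrite addrC addKr.
apply/eqP; rewrite -subr_eq0 -normr_le0; apply/ler_addgt0Pl => e e0.
rewrite addr0; have [X hX] := Phi_limits (divr_gt0 e0 (ltr0n R 2)).
have [h1 h2] := hX _ (lexx X).
have h3 := Phi_ge0 (- X); have h4 := Phi_le1 X.
by rewrite -(SE X) /S ler_norml; apply/andP; split; lra.
Qed.

(** Both tails are small: the left one directly, the right one because the total
    integral vanishes. *)
Lemma lower_vanishing q K : continuous q -> (forall x, `|q x| <= K) ->
  \int[mu]_t (q t * gauss t) = 0 -> vanishing (lower_integral q).
Proof.
move=> cq qK q0 e e0.
have K0 : 0 <= K by exact: le_trans (qK 0).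
have [X hX] := Phi_limits (divr_gt0 e0 (ltr_wpDl K0 ltr01)).
have Ke y : 0 <= y -> y <= e / (K + 1) -> K * y <= e.
  move=> y0; rewrite ler_pdivlMr ?ltr_wpDl// => h.
  by apply: le_trans h; rewrite mulrC ler_wpM2l// lerDl.
exists X => t; have [t0|t0] := leP 0 t => /hX[h1 h2].
  rewrite -normrN -sub0r -q0 (le_trans (norm_upper_le cq qK t))// -Phi_upper.
  by rewrite ger0_norm// in h1; rewrite Ke// subr_ge0 Phi_le1.
rewrite ltr0_norm// opprK in h2; rewrite (le_trans (norm_lower_le cq qK t))//.
by rewrite Ke// Phi_ge0.
Qed.

End gaussian_cdf.

(** * Stein's equation *)

Section stein_equation.
Context {R : realType}.
Notation mu := (@lebesgue_measure R).

Lemma is_derive_continuous (f df : R -> R) :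
  (forall x : R, is_derive x 1 f (df x)) -> continuous f.
Proof. by move=> fdf x; exact/differentiable_continuous/derivable1_diffP. Qed.

Lemma gauss_center (x : R) : `|x| <= 1 -> gauss (1 : R) <= gauss x.
Proof.
move=> x1; rewrite !gaussE ler_wpM2l//.
  by rewrite ltW// normal_peak_gt0// oner_eq0.
rewrite ler_expR lerN2 ler_pM2r ?invr_gt0// expr1n.
by rewrite -[x ^+ 2]real_normK ?num_real// exprn_ile1.
Qed.

(** The solution is the lower integral of h - E h(Z) divided by the density. Both
    f and f' solve an equation y' = x y + q with q bounded: q is h - E h(Z) for f
    and f + h' for f'. Hence x f and x f' are bounded by [ode_bound], and with
    them f' and f''. Away from the origin the bound on x f also bounds f; near
    the origin the density is bounded below. *)
Lemma stein_solution (h dh : R -> R) (K K' : R) :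
  (forall x : R, is_derive x 1 h (dh x)) ->
  (forall x, `|h x| <= K) -> (forall x, `|dh x| <= K') ->
  exists f f' : R -> R, exists B L : R,
  [/\ forall x : R, is_derive x 1 f (f' x),
      forall x, f' x = x * f x + (h x - \int[mu]_t (h t * gauss t)),
      forall x, `|f x| <= B, forall x, `|f' x| <= B &
      forall x y, `|f' y - f' x| <= L * `|y - x|].
Proof.
move=> hdh hK dhK.
pose c := \int[mu]_t (h t * gauss t); pose q x := h x - c.
pose Kq := K + `|c|.
have qK x : `|q x| <= Kq by rewrite (le_trans (ler_normB _ _))// lerD2r.
have Kq0 : 0 <= Kq by exact: le_trans (qK 0).
have dq (x : R) : is_derive x 1 q (dh x).
  by apply: is_derive_eq (is_deriveB_fun (hdh x) (is_derive_cst c x 1)) _; rewrite subr0.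
have ch := is_derive_continuous hdh; have cq := is_derive_continuous dq.
have q0 : \int[mu]_t (q t * gauss t) = 0.
  under eq_Rintegral do rewrite mulrBl.
  rewrite RintegralB//; last 2 first.
  - exact: integrable_gauss hK.
  - by apply: (@integrable_gauss _ (cst c) `|c|) => // x; exact: cvg_cst.
  by rewrite RintegralZl ?integral_gauss ?mulr1 ?subrr//; exact: integrable_normal_pdf.
pose H := lower_integral q; pose u x : R := (gauss x)^-1.
have g0 x : gauss x != 0 :> R by rewrite gt_eqF// gauss_gt0.
have du (x : R) : is_derive x 1 u (x * u x).
  have := is_deriveV (g0 x) (is_derive_gauss x) => hu.
  apply: is_derive_eq hu _; rewrite /u /GRing.scale/=; field; exact: g0.
pose f x := H x * u x; pose f' x := x * f x + q x.
have df (x : R) : is_derive x 1 f (f' x).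
  have := is_deriveM_fun (is_derive_lower cq qK x) (du x) => hf.
  apply: is_derive_eq hf _; rewrite /f' /f -/H /u; field; exact: g0.
have fg x : f x * gauss x = H x by rewrite /f /u mulfVK.
have xf x : `|x * f x| <= Kq.
  apply: (@ode_bound R f q Kq x df qK) => e e0.
  have [X hX] := lower_vanishing cq qK q0 e0; exists X => t /hX.
  by rewrite fg.
pose B1 := Kq + Kq * u 1.
have u0 x : 0 < u x by rewrite invr_gt0 gauss_gt0.
have fB x : `|f x| <= B1.
  have [x1|x1] := leP `|x| 1; last first.
    rewrite (@le_trans _ _ Kq)// ?lerDl ?mulr_ge0 ?(ltW (u0 _))//.
    by rewrite (le_trans _ (xf x))// [`|x * _|]normrM ler_peMl// ltW.
  rewrite (@le_trans _ _ (Kq * u 1))// ?lerDr// normrM (ger0_norm (ltW (u0 x))).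
  apply: ler_pM => //; first exact: ltW.
    rewrite (le_trans (norm_lower_le cq qK x))// ler_piMr// Phi_le1//.
  by rewrite lef_pV2 ?posrE ?gauss_gt0// gauss_center.
have f'B x : `|f' x| <= 2 * Kq.
  by rewrite mulr_natl mulr2n (le_trans (ler_normD _ _))// lerD.
pose q2 x := f x + dh x; pose L := B1 + K'.
have q2L x : `|q2 x| <= L by rewrite (le_trans (ler_normD _ _))// lerD.
have df' (x : R) : is_derive x 1 f' (x * f' x + q2 x).
  have := is_deriveD_fun (is_deriveM_fun (is_derive_id x 1) (df x)) (dq x) => hf'.
  by apply: is_derive_eq hf' _; rewrite /q2; ring.
have xf' x : `|x * f' x| <= L.
  apply: (@ode_bound R f' q2 L x df' q2L) => e e0.
  have e1 : 0 < e / (2 * Kq + 1) by rewrite divr_gt0// ltr_wpDl// mulr_ge0.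
  have [X hX] := gauss_small e1; exists X => t /hX.
  rewrite ler_pdivlMr ?ltr_wpDl ?mulr_ge0// => ht.
  rewrite normrM (ger0_norm (ltW (gauss_gt0 t))) mulrC.
  apply: le_trans ht; apply: ler_wpM2l; first exact/ltW/gauss_gt0.
  by rewrite (le_trans (f'B t))// lerDl.
exists f, f', (B1 + 2 * Kq), (2 * L); split => //.
- by move=> x; rewrite (le_trans (fB x))// lerDl mulr_ge0.
- move=> x; rewrite (le_trans (f'B x))// lerDr addr_ge0// mulr_ge0// ltW//.
- move=> x y; apply: derive_lipschitz df' _ => t.
  by rewrite mulr_natl mulr2n (le_trans (ler_normD _ _))// lerD.
Qed.

(** The mean value theorem for the function s |-> f s - s f' x. *)
Lemma taylor_lipschitz (f f' : R -> R) (L : R) :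
  (forall x : R, is_derive x 1 f (f' x)) ->
  (forall x y, `|f' y - f' x| <= L * `|y - x|) ->
  forall x t, `|f (x + t) - f x - t * f' x| <= L * t ^+ 2.
Proof.
move=> df f'L x t.
have L0 : 0 <= L by have := f'L 0 1; rewrite subr0 normr1 mulr1; exact: le_trans.
pose k s := f s - s * f' x.
have dk (s : R) : is_derive s 1 k (f' s - f' x).
  have := is_deriveB_fun (df s) (is_deriveM_fun (is_derive_id s 1) (is_derive_cst (f' x) s 1)) => hk.
  by apply: is_derive_eq hk _; rewrite /cst; ring.
have mvt a b : a <= b -> exists2 z, a <= z <= b & k b - k a = (f' z - f' x) * (b - a).
  move=> ab; have [|z zab e] := @MVT_segment R k _ a b ab (fun s _ => dk s).
    exact/continuous_subspaceT/(is_derive_continuous dk).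
  by exists z => //; move: zab; rewrite in_itv.
have -> : f (x + t) - f x - t * f' x = k (x + t) - k x by rewrite /k; ring.
have [z zx ->] : exists2 z, `|z - x| <= `|t| & k (x + t) - k x = (f' z - f' x) * t.
  have [t0|t0] := leP 0 t.
    have [|z /andP[z1 z2] e] := mvt x (x + t); first by rewrite lerDl.
    exists z; last by rewrite e; congr (_ * _); ring.
    by rewrite !ger0_norm ?subr_ge0// lerBlDl.
  have [|z /andP[z1 z2] e] := mvt (x + t) x; first by rewrite gerDl ltW.
  exists z; last by rewrite -opprB e; ring.
  by rewrite ler0_norm ?subr_le0// ltr0_norm// opprB lerBlDl -lerBlDr opprK.
rewrite normrM -[t ^+ 2]real_normK ?num_real// expr2 mulrA ler_wpM2r//.
by rewrite (le_trans (f'L x z))// ler_wpM2l.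
Qed.

End stein_equation.

Section smooth_step.
Context {R : realType}.

Lemma is_derive_quadratic (f : R -> R) (x D : R) :
  (forall t, `|f (x + t) - f x - t * D| <= t ^+ 2) -> is_derive x 1 f D.
Proof.
move=> fD.
have lim : h^-1 *: ((f \o shift x) (h *: (1 : R)) - f x) @[h --> 0^'] --> D.
  apply/cvgrPdist_le => e e0; near=> h.
  have h0 : h != 0 by near: h; exact: nbhs_dnbhs_neq.
  have he : `|h| <= e by near: h; exact: dnbhs0_le.
  have -> : D - h^-1 *: ((f \o shift x) (h *: (1 : R)) - f x) =
      - (f (x + h) - f x - h * D) / h.
    rewrite /= [h *: 1]mulr1 [h + x]addrC /GRing.scale/=; field; exact: h0.
  rewrite normrM normrN normfV ler_pdivrMr ?normr_gt0//.
  rewrite (le_trans (fD h))// -[h ^+ 2]real_normK ?num_real// expr2.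
  by rewrite ler_wpM2r.
apply: DeriveDef; first by apply/cvg_ex; exists D.
by apply: cvg_lim => //; exact: lim.
Unshelve. all: by end_near. Qed.

Let pos2 (x : R) : R := Num.max 0 x ^+ 2.

Let is_derive_pos2 (x : R) : is_derive x 1 pos2 (2 * Num.max 0 x).
Proof.
apply: is_derive_quadratic => t.
rewrite /pos2 !maxEle; case: ifPn; case: ifPn => //; rewrite -?ltNge => h1 h2;
  by rewrite ler_norml; apply/andP; split; nra.
Qed.

(** Stein's equation needs test functions with a bounded derivative, so half-line
    indicators are approximated by steps glued from parabolas. *)
Lemma smooth_step_exists (a b : R) : a < b ->
  exists h dh : R -> R, exists K : R,
  [/\ forall x : R, is_derive x 1 h (dh x),
      forall x, 0 <= h x <= 1, forall x, `|dh x| <= K,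
      forall x, x <= a -> h x = 1 & forall x, b <= x -> h x = 0].
Proof.
move=> ab; pose l := (b - a)^-1.
have l0 : 0 < l by rewrite invr_gt0 subr_gt0.
(* On [0, 1] this rises from 0 to 1 along two parabolas that meet at 1/2. *)
pose S (s : R) := 2 * pos2 s - 4 * pos2 (s - 2^-1) + 2 * pos2 (s - 1).
pose dS (s : R) : R := 4 * Num.max 0 s - 8 * Num.max 0 (s - 2^-1)
  + 4 * Num.max 0 (s - 1).
have shiftD (c s : R) : is_derive s 1 (fun t => pos2 (t - c)) (2 * Num.max 0 (s - c)).
  have h := is_deriveB_fun (is_derive_id s 1) (is_derive_cst c s 1).
  by apply: is_derive_eq (@is_derive1_comp R pos2 (fun t => t - c) s _ _
    (is_derive_pos2 (s - c)) h) _; rewrite subr0 mulr1.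
have DS (s : R) : is_derive s 1 S (dS s).
  have h := is_deriveD_fun (is_deriveB_fun (is_deriveZ_fun 2 (is_derive_pos2 s))
    (is_deriveZ_fun 4 (shiftD 2^-1 s))) (is_deriveZ_fun 2 (shiftD 1 s)).
  by apply: is_derive_eq h _; rewrite /dS; ring.
have S01 s : 0 <= S s <= 1.
  rewrite /S /pos2 !maxEle; case: ifPn; case: ifPn; case: ifPn => //;
    rewrite -?ltNge => h1 h2 h3; apply/andP; split; nra.
have dS2 s : `|dS s| <= 2.
  rewrite /dS !maxEle; case: ifPn; case: ifPn; case: ifPn => //;
    rewrite -?ltNge => h1 h2 h3; rewrite ler_norml; apply/andP; split; lra.
pose L x := (x - a) * l.
have DL (x : R) : is_derive x 1 L l.
  have h := is_deriveM_fun (is_deriveB_fun (is_derive_id x 1) (is_derive_cst a x 1))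
    (is_derive_cst l x 1).
  by apply: is_derive_eq h _; rewrite /cst; ring.
exists (fun x => 1 - S (L x)), (fun x => - (dS (L x) * l)), (2 * l); split.
- move=> x; have h := is_deriveB_fun (is_derive_cst (1 : R) x 1)
    (is_derive1_comp (DS (L x)) (DL x)).
  by apply: is_derive_eq h _; rewrite sub0r.
- by move=> x; have /andP[s0 s1] := S01 (L x); apply/andP; split; lra.
- move=> x; rewrite normrN normrM (ger0_norm (ltW l0)) ler_wpM2r// ltW//.
- move=> x xa; have Lx : L x <= 0 by rewrite pmulr_lle0// subr_le0.
  suff -> : S (L x) = 0 by rewrite subr0.
  rewrite /S /pos2 !maxEle; case: ifPn; case: ifPn; case: ifPn => //;
    rewrite -?ltNge => h1 h2 h3; nra.
- move=> x bx; have Lx : 1 <= L x.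
    by rewrite /L /l ler_pdivlMr ?subr_gt0// mul1r lerD2r.
  suff -> : S (L x) = 1 by rewrite subrr.
  rewrite /S /pos2 !maxEle; case: ifPn; case: ifPn; case: ifPn => //;
    rewrite -?ltNge => h1 h2 h3; nra.
Qed.

End smooth_step.

(** * Stein's discrepancy of a standardised sum *)

Section stein_sum.
Context {R : realType}.
Notation mu := (@lebesgue_measure R).
Variables (y : R -> R) (s : R).
Hypotheses (by_ : bmeas01 y) (y0 : I1 y = 0) (s0 : 0 < s)
  (ys : I1 (fun u => y u ^+ 2) = s ^+ 2).

Definition standardized d (T : measurableType d) (P : probability T R) n
  (U : 'I_n -> {RV P >-> R}) (x : T) : R :=
  (s * Num.sqrt n%:R)^-1 * coord_total U y x.

Section fixed_n.
Context d (T : measurableType d) (P : probability T R) (n : nat).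
Variables (ws : R -> R -> R) (U : 'I_n -> {RV P >-> R})
  (A : 'I_n -> 'I_n -> {RV P >-> bool}).
Hypothesis hd : one_graph_design ws U A.
Hypothesis n0 : (0 < n)%N.

Local Notation E := (Rintegral P setT).
Let PT : (P setT < +oo)%E. Proof. by rewrite probability_setT ltry. Qed.

Lemma bmeas_standardized : bmeas setT (standardized U).
Proof. by apply: bmeasZ; exact: (bmeas_coord_total hd). Qed.

Variables (f f' : R -> R) (B L K : R).
Hypotheses (fD : forall x : R, is_derive x 1 f (f' x)) (cf' : continuous f')
  (fB : forall x, `|f x| <= B) (f'B : forall x, `|f' x| <= B)
  (f'L : forall x y, `|f' y - f' x| <= L * `|y - x|)
  (yK : forall u, u \in `[0, 1] -> `|y u| <= K) (K0 : 0 <= K).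

Let a : R := (s * Num.sqrt n%:R)^-1.
Let W := standardized U.
Let X i x := y (U i x).
Let V i x := a * \sum_(j < n | j != i) X j x.

Let WV i x : W x = V i x + a * X i x.
Proof.
rewrite /W /standardized /coord_total -/a /V -mulrDr; congr (_ * _).
by rewrite (bigD1 i)//= addrC.
Qed.

Let bX i : bmeas setT (X i). Proof. exact: (bmeas_coord hd). Qed.

Let bV i : bmeas setT (V i).
Proof. by apply: bmeasZ; apply: bmeas_sum => j _; exact: bX. Qed.

Let offV i : off_measurable U i (V i).
Proof.
apply: measurable_funM => //.
rewrite (_ : (fun x => _) = (fun x => \sum_(j < n) (if j != i then X j x else 0))).
  apply: measurable_sum => j; case: (boolP (j != i)) => [ji|_] //=.
  exact: (@off_coord _ _ _ _ _ _ _ _ hd i j y ji by_).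
by apply/funext => x; rewrite -big_mkcond.
Qed.

Let bcomp (g : R -> R) (C : R) (Z : T -> R) : continuous g ->
  (forall x, `|g x| <= C) -> bmeas setT Z -> bmeas setT (fun x => g (Z x)).
Proof.
move=> cg gC [mZ _]; split; last by exists C.
by apply: measurableT_comp mZ; exact: continuous_measurable_fun.
Qed.

Let cf : continuous f. Proof. exact: is_derive_continuous fD. Qed.

Let L0 : 0 <= L.
Proof. by have := f'L 0 1; rewrite subr0 normr1 mulr1; exact: le_trans. Qed.

Let a0 : 0 < a.
Proof. by rewrite invr_gt0 mulr_gt0// sqrtr_gt0 ltr0n. Qed.

Let na2 : n%:R * (a ^+ 2 * s ^+ 2) = 1.
Proof.
rewrite /a exprVn exprMn sqr_sqrtr//.
have ? : s != 0 by rewrite gt_eqF.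
have ? : n%:R != 0 :> R by rewrite pnatr_eq0 -lt0n.
by field; apply/andP.
Qed.

Let D : R := K ^+ 3 * L + s ^+ 2 * L * K.

Let XK i x : `|X i x| <= K. Proof. by apply: yK; exact: (design_range hd). Qed.

Let one_term i :
  `|E (fun x => X i x * f (W x)) - a * s ^+ 2 * E (fun x => f' (W x))| <=
  a ^+ 2 * D.
Proof.
have bfV := bcomp cf fB (bV i); have bf'V := bcomp cf' f'B (bV i).
have bW := bmeas_standardized.
have bfW := bcomp cf fB bW; have bf'W := bcomp cf' f'B bW.
have offf : off_measurable U i (fun x => f (V i x)).
  apply: (@measurableT_comp _ _ _ (off_algebra U i) _ _ f _ (V i)).
    exact: continuous_measurable_fun.
  exact: offV.
have offf' : off_measurable U i (fun x => f' (V i x)).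
  apply: (@measurableT_comp _ _ _ (off_algebra U i) _ _ f' _ (V i)).
    exact: continuous_measurable_fun.
  exact: offV.
have e1 : E (fun x => f (V i x) * X i x) = 0.
  by rewrite (expectation_coord_indep hd offf)// y0 mulr0.
have e2 : E (fun x => f' (V i x) * X i x ^+ 2) = E (fun x => f' (V i x)) * s ^+ 2.
  rewrite -ys (expectation_coord_indep hd (f := fun u => y u ^+ 2) offf')//.
  exact: bmeasX.
pose r x := X i x * f (W x) - f (V i x) * X i x
  - a * (f' (V i x) * X i x ^+ 2).
pose r' x := f' (W x) - f' (V i x).
have rE : E (fun x => X i x * f (W x)) - a * s ^+ 2 * E (fun x => f' (W x)) =
   E r - a * s ^+ 2 * E r'.
  rewrite /r /r' !RintB//; try by bm.
  by rewrite RintZ// ?e1 ?e2; [ring|bm].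
have rB x : `|r x| <= a ^+ 2 * (K ^+ 3 * L).
  have -> : r x = X i x * (f (V i x + a * X i x) - f (V i x) - (a * X i x) * f' (V i x)).
    by rewrite /r (WV i); ring.
  rewrite normrM.
  apply: (@le_trans _ _ (K * (L * (a * X i x) ^+ 2))).
    by apply: ler_pM => //; exact: taylor_lipschitz.
  have -> : a ^+ 2 * (K ^+ 3 * L) = K * (L * (a ^+ 2 * K ^+ 2)) by ring.
  rewrite exprMn !ler_wpM2l// ?sqr_ge0//.
  rewrite -[X i x ^+ 2]real_normK ?num_real//.
  by rewrite ler_pXn2r ?nnegrE.
have r'B x : `|r' x| <= L * (a * K).
  rewrite (le_trans (f'L _ _))// ler_wpM2l// {1}(WV i x) addrAC subrr add0r.
  by rewrite normrM (ger0_norm (ltW a0)) ler_wpM2l// ltW.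
have normE g C : bmeas setT g -> (forall x, `|g x| <= C) -> `|E g| <= C.
  move=> bg gC; rewrite -(Rint_probability_cst P C).
  apply: le_trans (le_normr_Rintegral _ (bmeas_integrable _ PT bg)) _ => //.
  by apply: le_Rint => //; [exact: bmeas_norm|exact: bmeas_cst].
rewrite rE (le_trans (ler_normB _ _))//.
have br : bmeas setT r by bm.
have br' : bmeas setT r' by bm.
rewrite /D mulrDr; apply: lerD; first exact: normE br rB.
rewrite normrM ger0_norm ?mulr_ge0 ?sqr_ge0 ?(ltW a0) ?(ltW s0)//.
have -> : a ^+ 2 * (s ^+ 2 * L * K) = a * s ^+ 2 * (L * (a * K)) by ring.
apply: ler_wpM2l; first by rewrite !mulr_ge0 ?(ltW a0) ?(ltW s0).
exact: normE br' r'B.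
Qed.

(** Write W = V_i + a X_i with V_i independent of X_i. To first order f(W) is
    f(V_i) + a X_i f'(V_i); after multiplication by the centred X_i the first
    term has mean zero and the second has mean a s^2 E f'(V_i). The errors are of
    order a^2 for each i, and a^3 n = O(n^-1/2) after summation. *)
Lemma stein_discrepancy :
  `|E (fun x => W x * f (W x)) - E (fun x => f' (W x))| <=
  (s * Num.sqrt n%:R)^-1 * (D / s ^+ 2).
Proof.
have bW := bmeas_standardized.
have bfW := bcomp cf fB bW; have bf'W := bcomp cf' f'B bW.
have WE x : W x * f (W x) = \sum_(i < n) a * (X i x * f (W x)).
  by rewrite -mulr_sumr -mulr_suml mulrA.
under eq_Rintegral do rewrite WE.
have bXf i : bmeas setT (fun x => X i x * f (W x)) by bm.
rewrite Rint_sum//; last by move=> i _; exact: bmeasZ.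
have -> : E (fun x => f' (W x)) =
    \sum_(i < n) a * (a * s ^+ 2 * E (fun x => f' (W x))).
  rewrite sumr_const card_ord -[_ *+ n]mulr_natl.
  by rewrite -[LHS]mul1r -{1}na2; ring.
rewrite -sumrB (le_trans (ler_norm_sum _ _ _))//.
apply: (@le_trans _ _ (\sum_(i < n) a * (a ^+ 2 * D))).
  apply: ler_sum => i _; rewrite RintZ// -mulrBr normrM (ger0_norm (ltW a0)).
  by rewrite ler_wpM2l// ltW.
rewrite sumr_const card_ord -[_ *+ n]mulr_natl -/a.
have s2 : s ^+ 2 != 0 by rewrite expf_neq0// gt_eqF.
rewrite le_eqVlt; apply/orP; left; apply/eqP.
have -> : n%:R * (a * (a ^+ 2 * D)) = (n%:R * (a ^+ 2 * s ^+ 2)) * (a * (D / s ^+ 2)).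
  by field; rewrite gt_eqF.
by rewrite na2 mul1r.
Qed.

End fixed_n.

(** The constant depends only on the test function and on y, so the bound holds
    along a sequence of designs on varying probability spaces. *)
Lemma stein_bound (h dh : R -> R) (K K' : R) :
  (forall x : R, is_derive x 1 h (dh x)) ->
  (forall x, `|h x| <= K) -> (forall x, `|dh x| <= K') ->
  exists2 C, 0 <= C & forall d (T : measurableType d) (P : probability T R) n
    ws (U : 'I_n -> {RV P >-> R}) (A : 'I_n -> 'I_n -> {RV P >-> bool}),
    one_graph_design ws U A -> (0 < n)%N ->
    `|\int[P]_x h (standardized U x) - \int[mu]_t (h t * gauss t)|
      <= (Num.sqrt n%:R)^-1 * C.
Proof.
move=> hD hK dhK.
have [f [f' [B [L [fD fE fB f'B f'L]]]]] := stein_solution hD hK dhK.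
set c := \int[mu]_t (h t * gauss t) in fE *.
have [Ky Ky0 yK] := bmeas_bound by_.
have L0 : 0 <= L.
  by have := f'L 0 1; rewrite subr0 normr1 mulr1; exact: le_trans.
pose D := Ky ^+ 3 * L + s ^+ 2 * L * Ky.
have D0 : 0 <= D by rewrite addr_ge0// !mulr_ge0 ?exprn_ge0// ltW.
exists (s^-1 * (D / s ^+ 2)).
  by rewrite mulr_ge0 ?invr_ge0 ?divr_ge0 ?exprn_ge0// ltW.
move=> d T P n ws U A hd n0.
have cf := is_derive_continuous fD.
have ch := is_derive_continuous hD.
have cf' : continuous f'.
  rewrite (_ : f' = fun x => x * f x + (h x - c)); last by apply/funext => x; exact: fE.
  move=> x; apply: cvgD; first by apply: cvgM; [exact: cvg_id|exact: cf].
  by apply: cvgB; [exact: ch|exact: cvg_cst].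
have bW := bmeas_standardized hd.
have bc (g : R -> R) C : continuous g -> (forall x, `|g x| <= C) ->
    bmeas setT (fun x => g (standardized U x)).
  move=> cg gC; split; last by exists C.
  by apply: measurableT_comp bW.1; exact: continuous_measurable_fun.
have bfW := bc _ _ cf fB; have bf'W := bc _ _ cf' f'B; have bhW := bc _ _ ch hK.
have PT : (P setT < +oo)%E by rewrite probability_setT ltry.
have -> : \int[P]_x h (standardized U x) - c =
    - (\int[P]_x (standardized U x * f (standardized U x))
       - \int[P]_x f' (standardized U x)).
  rewrite -(Rint_probability_cst P c) -!RintB//; try by bm.
  rewrite -[RHS]mulN1r -RintZ//; last by bm.
  by apply: eq_Rintegral => x _; rewrite fE; ring.
rewrite normrN.
apply: le_trans (stein_discrepancy hd n0 fD cf' fB f'B f'L yK (ltW Ky0)) _.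
by rewrite invfM le_eqVlt; apply/orP; left; apply/eqP; rewrite -/D; ring.
Qed.

End stein_sum.

(** * Convergence in probability *)

Section real_probability.
Context d (T : measurableType d) (R : realType) (P : probability T R).
Implicit Types (A B : set T) (X : T -> R).

Definition pr A : R := fine (P A).

Lemma prK A : measurable A -> (pr A)%:E = P A.
Proof. by move=> mA; rewrite /pr fineK// fin_num_measure. Qed.

Lemma pr_ge0 A : 0 <= pr A. Proof. by rewrite fine_ge0. Qed.

Lemma pr_le A B : measurable A -> measurable B -> A `<=` B -> pr A <= pr B.
Proof. by move=> mA mB AB; rewrite -lee_fin !prK// le_measure// inE. Qed.

Lemma pr_setU A B : measurable A -> measurable B -> pr (A `|` B) <= pr A + pr B.
Proof.
move=> mA mB; rewrite -lee_fin EFinD !prK//; last exact: measurableU.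
exact: measureU2.
Qed.

Lemma pr_le_setU A B C : measurable A -> measurable B -> measurable C ->
  A `<=` B `|` C -> pr A <= pr B + pr C.
Proof.
move=> mA mB mC ABC; apply: le_trans (pr_setU mB mC).
by apply: pr_le => //; exact: measurableU.
Qed.

Lemma pr_setD A B : measurable A -> measurable B -> B `<=` A ->
  pr (A `\` B) = pr A - pr B.
Proof.
move=> mA mB BA; apply/eqP; rewrite eq_sym subr_eq; apply/eqP.
have h : pr (A `\` B) + pr B = pr A; last by rewrite h.
apply: EFin_inj; rewrite EFinD !prK//; last exact: measurableD.
rewrite -measureU//; last 2 first.
- exact: measurableD.
- by rewrite setDE -setIA setICl setI0.
by rewrite setUC setDUK.
Qed.

Lemma bmeas_indic A : measurable A -> bmeas setT (\1_A : T -> R).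
Proof.
move=> mA; split; first exact: measurable_indic.
by exists 1 => x _; rewrite indicE; case: (x \in A); rewrite ?normr1 ?normr0.
Qed.

Lemma pr_indic A : measurable A -> pr A = \int[P]_x (\1_A x).
Proof. by move=> mA; rewrite /Rintegral integral_indic// setIT. Qed.

Lemma measurable_le X c : measurable_fun setT X -> measurable [set x | X x <= c].
Proof.
move=> mX; have := mX measurableT [set` `]-oo, c]] (measurable_itv _).
by rewrite setTI (_ : _ @^-1` _ = [set x | X x <= c])//;
  apply/seteqP; split => x /=; rewrite in_itv.
Qed.

Lemma measurable_ge X c : measurable_fun setT X -> measurable [set x | c <= X x].
Proof.
move=> mX; have := mX measurableT [set` `[c, +oo[] (measurable_itv _).
by rewrite setTI (_ : _ @^-1` _ = [set x | c <= X x])//;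
  apply/seteqP; split => x /=; rewrite in_itv/= andbT.
Qed.

Lemma measurable_dist X (c e : R) : measurable_fun setT X ->
  measurable [set x | e <= `|X x - c|].
Proof.
move=> mX; apply: (@measurable_ge (fun x => `|X x - c|)).
by apply: measurableT_comp => //; exact: measurable_funB.
Qed.

Lemma pr_markov2 X K : bmeas setT X -> 0 < K ->
  pr [set x | K <= `|X x|] <= \int[P]_x (X x ^+ 2) / K ^+ 2.
Proof.
move=> bX K0; have mS : measurable [set x | K <= `|X x|].
  by apply: measurable_ge; apply: measurableT_comp => //; exact: bX.1.
have PT : (P setT < +oo)%E by rewrite probability_setT ltry.
have K2 : 0 < K ^+ 2 by rewrite exprn_gt0.
rewrite ler_pdivlMr// mulrC pr_indic// -RintZ//; last exact: bmeas_indic.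
apply: le_Rint => //; [exact/bmeasZ/bmeas_indic|exact: bmeasX|].
move=> x _; rewrite indicE; case: (boolP (x \in _)) => [|_].
  rewrite inE mulr1 => /= h; rewrite -[X x ^+ 2]real_normK ?num_real//.
  by rewrite ler_pXn2r ?nnegrE// ltW.
by rewrite mulr0 sqr_ge0.
Qed.

End real_probability.

Lemma measurable_invr_comp d (T : measurableType d) (R : realType) (X : T -> R) :
  measurable_fun setT X -> measurable_fun setT (fun x => (X x)^-1).
Proof.
move=> mX.
rewrite (_ : (fun x => _) = (fun x => X x * (X x ^+ 2) `^ (-1))).
  apply: measurable_funM => //.
  apply: (@measurableT_comp _ _ _ _ _ _ (fun y : R => y `^ (-1))).
    exact: measurable_powR.
  exact: measurable_funX.
apply/funext => x; rewrite powR_inv1 ?sqr_ge0//.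
have [->|x0] := eqVneq (X x) 0; first by rewrite invr0 mul0r.
by field.
Qed.

Lemma measurable_sqrt_comp d (T : measurableType d) (R : realType) (X : T -> R) :
  measurable_fun setT X -> measurable_fun setT (fun x => Num.sqrt (X x)).
Proof.
move=> mX; apply: (@measurableT_comp _ _ _ _ _ _ (@Num.sqrt R)) => //.
apply: nondecreasing_measurable => // x y xy.
exact: ler_wsqrtr.
Qed.

Section convergence_in_probability.
Context {R : realType} (d : nat -> measure_display)
  (T : forall n, measurableType (d n)) (P : forall n, probability (T n) R).
Implicit Types (X Y Z : forall n, T n -> R) (c : R).

(** Convergence in probability, bundled with the measurability that makes the
    probabilities meaningful, so that limits can be composed. *)
Definition cvgP X c := (forall n, measurable_fun setT (X n)) /\
  forall e eta : R, 0 < e -> 0 < eta -> exists N, forall n, (N <= n)%N ->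
    pr (P n) [set x | e <= `|X n x - c|] <= eta.

Lemma cvg_ereal_eps (A : forall n, set (T n)) (a : R) :
  (forall n, measurable (A n)) ->
  (forall eta, 0 < eta -> exists N, forall n, (N <= n)%N ->
     `|pr (P n) (A n) - a| <= eta) ->
  P n (A n) @[n --> \oo] --> a%:E.
Proof.
move=> mA h.
have -> : (fun n => P n (A n)) = (fun n => (pr (P n) (A n))%:E).
  by apply/funext => n; rewrite prK.
apply: cvg_EFin; first by near=> n.
apply/cvgrPdist_le => e e0; have [N hN] := h e e0.
by exists N => // n /= Nn; rewrite distrC; exact: hN.
Unshelve. all: by end_near. Qed.

Lemma cvgP_cvg X c : cvgP X c -> cvg_in_probability P X c.
Proof.
move=> [mX h] e e0; apply: cvg_ereal_eps => [n|eta eta0].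
  exact: measurable_dist.
have [N hN] := h e eta e0 eta0; exists N => n /hN.
by rewrite subr0 ger0_norm ?pr_ge0.
Qed.

(** The continuous mapping theorem at a constant limit. *)
Lemma cvgP_comp2 X Y c c' (F : R -> R -> R) : cvgP X c -> cvgP Y c' ->
  (forall n, measurable_fun setT (fun x => F (X n x) (Y n x))) ->
  (forall e, 0 < e -> exists2 r, 0 < r &
     forall x y, `|x - c| < r -> `|y - c'| < r -> `|F x y - F c c'| < e) ->
  cvgP (fun n x => F (X n x) (Y n x)) (F c c').
Proof.
move=> [mX hX] [mY hY] mF hF; split => // e eta e0 eta0.
have [r r0 hr] := hF e e0; have eta2 : 0 < eta / 2 by rewrite divr_gt0.
have [N hN] := hX r (eta / 2) r0 eta2; have [N' hN'] := hY r (eta / 2) r0 eta2.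
exists (maxn N N') => n; rewrite geq_max => /andP[Nn N'n].
rewrite [eta]splitr; apply: le_trans _ (lerD (hN n Nn) (hN' n N'n)).
apply: pr_le_setU; [exact: measurable_dist..|].
move=> x /= h; have [h1|h1] := leP r `|X n x - c|; first by left.
have [h2|h2] := leP r `|Y n x - c'|; first by right.
by have := hr _ _ h1 h2; rewrite ltNge h.
Qed.

Lemma cvgP_comp1 X c (F : R -> R) : cvgP X c ->
  (forall n, measurable_fun setT (fun x => F (X n x))) ->
  (forall e, 0 < e -> exists2 r, 0 < r &
     forall x, `|x - c| < r -> `|F x - F c| < e) ->
  cvgP (fun n x => F (X n x)) (F c).
Proof.
move=> hX mF hF; apply: (cvgP_comp2 (F := fun x _ => F x) hX hX) => // e /hF.
by move=> [r r0 h]; exists r => // x y xr _; exact: h.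
Qed.

Lemma cvgP_cst c : cvgP (fun n _ => c) c.
Proof.
split => // e eta e0 eta0; exists 0%N => n _.
have -> : [set x | e <= `|c - c|] = set0 :> set (T n).
  by apply/seteqP; split => [x /=|x []]; rewrite subrr normr0 leNgt e0.
by rewrite /pr measure0 ltW.
Qed.

Lemma cvgPD X Y c c' : cvgP X c -> cvgP Y c' ->
  cvgP (fun n x => X n x + Y n x) (c + c').
Proof.
move=> hX hY; apply: (cvgP_comp2 (F := fun x y => x + y) hX hY) => [n|e e0].
  by apply: measurable_funD; [exact: hX.1|exact: hY.1].
exists (e / 2); first by rewrite divr_gt0.
move=> x y hx hy; rewrite opprD addrACA (le_lt_trans (ler_normD _ _))//.
by rewrite [e]splitr ltrD.
Qed.

Lemma cvgPM X Y c c' : cvgP X c -> cvgP Y c' ->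
  cvgP (fun n x => X n x * Y n x) (c * c').
Proof.
move=> hX hY; apply: (cvgP_comp2 (F := fun x y => x * y) hX hY) => [n|e e0].
  by apply: measurable_funM; [exact: hX.1|exact: hY.1].
pose k := `|c| + `|c'| + 1.
have k0 : 0 < k by rewrite ltr_wpDl// addr_ge0.
exists (Num.min 1 (e / k)); first by rewrite lt_min ltr01 divr_gt0.
move=> x y; rewrite !lt_min => /andP[x1 xe] /andP[y1 ye].
have -> : x * y - c * c' = (x - c) * (y - c') + (x - c) * c' + c * (y - c') by ring.
rewrite (le_lt_trans (ler_normD _ _))//.
rewrite (le_lt_trans (lerD (ler_normD _ _) (lexx _)))// !normrM.
have h1 : `|x - c| * `|y - c'| <= 1 * `|y - c'| by rewrite ler_wpM2r// ltW.
have h2 : `|x - c| * `|c'| <= e / k * `|c'| by rewrite ler_wpM2r// ltW.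
have h3 : `|c| * `|y - c'| <= `|c| * (e / k) by rewrite ler_wpM2l// ltW.
have -> : e = e / k + e / k * `|c'| + `|c| * (e / k).
  by rewrite /k; field; rewrite -/k gt_eqF.
lra.
Qed.

Lemma cvgPZ X c k : cvgP X c -> cvgP (fun n x => k * X n x) (k * c).
Proof. by move=> hX; apply: cvgPM => //; exact: cvgP_cst. Qed.

Lemma cvgPN X c : cvgP X c -> cvgP (fun n x => - X n x) (- c).
Proof.
move=> hX; apply: (cvgP_comp1 (F := fun x => - x) hX) => [n|e e0].
  by apply: measurableT_comp => //; exact: hX.1.
by exists e => // x; rewrite -opprD normrN.
Qed.

Lemma cvgPB X Y c c' : cvgP X c -> cvgP Y c' ->
  cvgP (fun n x => X n x - Y n x) (c - c').
Proof. by move=> hX hY; apply: cvgPD => //; exact: cvgPN. Qed.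

Lemma eq_cvgP X Y c : (forall n x, X n x = Y n x) -> cvgP X c -> cvgP Y c.
Proof.
move=> XY; suff -> : X = Y by [].
by apply: functional_extensionality_dep => n; exact/funext.
Qed.

Lemma cvgP_sum (I : Type) (r : seq I) (Q : pred I) (F : I -> forall n, T n -> R)
    (c : I -> R) : (forall i, Q i -> cvgP (F i) (c i)) ->
  cvgP (fun n x => \sum_(i <- r | Q i) F i n x) (\sum_(i <- r | Q i) c i).
Proof.
move=> h; elim: r => [|i r IH].
  rewrite big_nil; apply: eq_cvgP (cvgP_cst 0) => n x; by rewrite big_nil.
rewrite big_cons; case: ifPn => Qi.
  apply: eq_cvgP (cvgPD (h i Qi) IH) => n x; by rewrite big_cons Qi.
apply: eq_cvgP IH => n x; by rewrite big_cons (negbTE Qi).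
Qed.

Lemma cvgP_prod (I : Type) (r : seq I) (Q : pred I) (F : I -> forall n, T n -> R)
    (c : I -> R) : (forall i, Q i -> cvgP (F i) (c i)) ->
  cvgP (fun n x => \prod_(i <- r | Q i) F i n x) (\prod_(i <- r | Q i) c i).
Proof.
move=> h; elim: r => [|i r IH].
  rewrite big_nil; apply: eq_cvgP (cvgP_cst 1) => n x; by rewrite big_nil.
rewrite big_cons; case: ifPn => Qi.
  apply: eq_cvgP (cvgPM (h i Qi) IH) => n x; by rewrite big_cons Qi.
apply: eq_cvgP IH => n x; by rewrite big_cons (negbTE Qi).
Qed.

Lemma cvgPV X c : c != 0 -> cvgP X c -> cvgP (fun n x => (X n x)^-1) c^-1.
Proof.
move=> c0 hX; apply: (cvgP_comp1 (F := fun x => x^-1) hX) => [n|e e0].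
  by apply: measurable_invr_comp; exact: hX.1.
have c2 : 0 < `|c| / 2 by rewrite divr_gt0 ?normr_gt0.
pose r := Num.min (`|c| / 2) (e * (`|c| / 2 * `|c|)).
exists r; first by rewrite lt_min c2 !mulr_gt0 ?normr_gt0.
move=> x; rewrite lt_min => /andP[x1 x2].
have xc : `|c| / 2 < `|x|.
  have := ler_normB x (x - c); rewrite opprB addrC subrK => h.
  by have := splitr `|c|; lra.
have x0 : x != 0 by rewrite -normr_gt0 (lt_trans c2).
have -> : x^-1 - c^-1 = (c - x) / (x * c) by field; apply/andP.
rewrite normrM normfV distrC ltr_pdivrMr ?normr_gt0 ?mulf_neq0//.
rewrite (lt_le_trans x2)// ler_wpM2l ?(ltW e0)// normrM ler_wpM2r// ltW//.
Qed.

Lemma cvgP_sqrt X c : 0 < c -> cvgP X c ->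
  cvgP (fun n x => Num.sqrt (X n x)) (Num.sqrt c).
Proof.
move=> c0 hX; apply: (cvgP_comp1 (F := @Num.sqrt R) hX) => [n|e e0].
  by apply: measurable_sqrt_comp; exact: hX.1.
have s0 : 0 < Num.sqrt c by rewrite sqrtr_gt0.
exists (Num.min c (e * Num.sqrt c)); first by rewrite lt_min c0 mulr_gt0.
move=> x; rewrite lt_min => /andP[x1 x2].
have x0 : 0 <= x by move: x1; rewrite ltr_norml => /andP[h _]; lra.
rewrite -(ltr_pM2r s0) (le_lt_trans _ x2)//.
have -> : x - c = (Num.sqrt x - Num.sqrt c) * (Num.sqrt x + Num.sqrt c).
  by rewrite -subr_sqr !sqr_sqrtr// ltW.
rewrite normrM ler_wpM2l// ger0_norm ?addr_ge0 ?sqrtr_ge0//.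
by rewrite lerDr sqrtr_ge0.
Qed.

Lemma cvgP_max0 X c : cvgP X c -> cvgP (fun n x => Num.max 0 (X n x)) (Num.max 0 c).
Proof.
move=> hX; apply: (cvgP_comp1 (F := fun x => Num.max 0 x) hX) => [n|e e0].
  by apply: measurable_maxr => //; exact: hX.1.
exists e => // x; apply: le_lt_trans.
rewrite !maxEle; case: ifPn; case: ifPn => //; rewrite -?ltNge => h1 h2.
- by rewrite subr0 ger0_norm// ler_normr; apply/orP; left; lra.
- by rewrite sub0r normrN ger0_norm// ler_normr; apply/orP; right; lra.
- by rewrite subrr normr0.
Qed.

Lemma cvgP_dominated X Y c : (forall n, measurable_fun setT (X n)) ->
  (exists N, forall n x, (N <= n)%N -> `|X n x - c| <= `|Y n x|) ->
  cvgP Y 0 -> cvgP X c.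
Proof.
move=> mX [N XY] [mY hY]; split => // e eta e0 eta0.
have [N' hN'] := hY e eta e0 eta0; exists (maxn N N') => n.
rewrite geq_max => /andP[Nn N'n]; apply: le_trans _ (hN' n N'n).
apply: pr_le; [exact: measurable_dist..|].
by move=> x /= /le_trans; apply; rewrite subr0 XY.
Qed.

Lemma cvgP_L2 X c C : (forall n, bmeas setT (X n)) ->
  (forall n, (2 <= n)%N -> \int[P n]_x ((X n x - c) ^+ 2) <= C / n%:R) ->
  cvgP X c.
Proof.
move=> bX hX; split => [n|e eta e0 eta0]; first exact: (bX n).1.
have e2 : 0 < e ^+ 2 by rewrite exprn_gt0.
exists (maxn 2 (Num.truncn (`|C| / (e ^+ 2 * eta))).+1) => n.
rewrite geq_max => /andP[n2 nK].
have n0 : 0 < n%:R :> R by rewrite ltr0n (leq_trans _ n2).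
have b : bmeas setT (fun x => X n x - c) by bm.
rewrite (le_trans (pr_markov2 (P n) b e0))// ler_pdivrMr//.
rewrite (le_trans (hX n n2))// (le_trans (ler_norm _))// normrM normfV.
have : `|C| / (e ^+ 2 * eta) < n%:R.
  by rewrite (lt_le_trans (truncnS_gt _))// ler_nat.
rewrite (ger0_norm (ltW n0)) ltr_pdivrMr ?mulr_gt0// ler_pdivrMr// => h.
by apply: le_trans (ltW h) _; rewrite le_eqVlt; apply/orP; left; apply/eqP; ring.
Qed.

(** By Chebyshev's inequality a sequence bounded in L2 is tight, so that its
    product with a sequence tending to zero tends to zero. *)
Lemma cvgPM_L2 X Y C : (forall n, bmeas setT (X n)) ->
  (exists N, forall n, (N <= n)%N -> \int[P n]_x (X n x ^+ 2) <= C) ->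
  cvgP Y 0 -> cvgP (fun n x => X n x * Y n x) 0.
Proof.
move=> bX [N hX] [mY hY]; split => [n|e eta e0 eta0].
  by apply: measurable_funM => //; exact: (bX n).1.
have eta2 : 0 < eta / 2 by rewrite divr_gt0.
(* At this level Chebyshev's bound C / K^2 is at most eta / 2. *)
pose K2 := (`|C| + 1) / (eta / 2); pose K := Num.sqrt K2.
have K20 : 0 < K2 by rewrite divr_gt0// ltr_wpDl.
have K0 : 0 < K by rewrite sqrtr_gt0.
have [N' hN'] := hY (e / K) (eta / 2) (divr_gt0 e0 K0) eta2.
exists (maxn N N') => n; rewrite geq_max => /andP[Nn N'n].
have h1 : pr (P n) [set x | K <= `|X n x|] <= eta / 2.
  rewrite (le_trans (pr_markov2 (P n) (bX n) K0))// sqr_sqrtr ?(ltW K20)//.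
  rewrite ler_pdivrMr// mulrC divfK ?gt_eqF// (le_trans (hX n Nn))//.
  by rewrite (le_trans (ler_norm _))// lerDl.
rewrite [eta]splitr; apply: le_trans _ (lerD h1 (hN' n N'n)).
apply: pr_le_setU.
- by apply: measurable_dist; apply: measurable_funM => //; exact: (bX n).1.
- by apply: measurable_ge; apply: measurableT_comp => //; exact: (bX n).1.
- exact: measurable_dist.
move=> x /=; rewrite !subr0 normrM => h.
have [h'|h'] := leP K `|X n x|; [by left|right].
rewrite ler_pdivrMr// (le_trans h)// mulrC ler_wpM2l// ltW//.
Qed.

End convergence_in_probability.

(** * The central limit theorem *)

Section normal_limits.
Context {R : realType} (d : nat -> measure_display)
  (T : forall n, measurableType (d n)) (P : forall n, probability (T n) R).
Notation mu := (@lebesgue_measure R).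
Implicit Types (X Y : forall n, T n -> R).

Definition cvg_normal X := (forall n, measurable_fun setT (X n)) /\
  forall r eta : R, 0 < eta -> exists N, forall n, (N <= n)%N ->
    `|pr (P n) [set x | X n x <= r] - Phi r| <= eta.

Lemma Phi_lipschitz : exists2 K : R, 0 < K &
  forall a b : R, `|Phi b - Phi a| <= K * `|b - a|.
Proof.
exists (normal_peak (1 : R)); first by rewrite normal_peak_gt0// oner_eq0.
move=> a b; apply: (derive_lipschitz _ _ (@is_derive_Phi R)) => t.
rewrite ger0_norm; last exact/ltW/gauss_gt0.
by apply: normal_pdf_ub; exact: oner_neq0.
Qed.

Lemma Phi_close (eta : R) : 0 < eta -> exists2 r : R, 0 < r &
  forall a b : R, `|b - a| <= r -> `|Phi b - Phi a| <= eta.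
Proof.
move=> eta0; have [K K0 h] := Phi_lipschitz.
exists (eta / K); first by rewrite divr_gt0.
by move=> a b ab; rewrite (le_trans (h a b))// mulrC -ler_pdivlMr.
Qed.

(** Off the event that X and Y differ by at least e, the event Y <= r lies
    between X <= r - e and X <= r + e, and Phi is Lipschitz. *)
Lemma cvg_normal_slutsky X Y : cvg_normal X ->
  cvgP P (fun n x => Y n x - X n x) 0 -> (forall n, measurable_fun setT (Y n)) ->
  cvg_normal Y.
Proof.
move=> [mX hX] [_ hD] mY; split => // r eta eta0.
have eta3 : 0 < eta / 3 by rewrite divr_gt0.
have [e e0 he] := Phi_close eta3.
have [N1 h1] := hX (r + e) _ eta3; have [N2 h2] := hX (r - e) _ eta3.
have [N3 h3] := hD e _ e0 eta3.
exists (maxn (maxn N1 N2) N3) => n.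
rewrite !geq_max => /andP[/andP[/h1 {}h1 /h2 {}h2] /h3 {}h3].
have mD : measurable [set x | e <= `|Y n x - X n x - 0|].
  by apply: measurable_dist; exact: measurable_funB.
have ub : pr (P n) [set x | Y n x <= r] <=
    pr (P n) [set x | X n x <= r + e] + pr (P n) [set x | e <= `|Y n x - X n x - 0|].
  apply: pr_le_setU; rewrite //; [exact: measurable_le..|].
  move=> x /= h; have [h'|h'] := leP (X n x) (r + e); first by left.
  by right; rewrite subr0 ler_normr; apply/orP; right; lra.
have lb : pr (P n) [set x | X n x <= r - e] <=
    pr (P n) [set x | Y n x <= r] + pr (P n) [set x | e <= `|Y n x - X n x - 0|].
  apply: pr_le_setU; rewrite //; [exact: measurable_le..|].
  move=> x /= h; have [h'|h'] := leP (Y n x) r; first by left.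
  by right; rewrite subr0 ler_normr; apply/orP; left; lra.
have c1 : `|Phi (r + e) - Phi r| <= eta / 3.
  by apply: he; rewrite addrAC subrr add0r ger0_norm// ltW.
have c2 : `|Phi (r - e) - Phi r| <= eta / 3.
  by apply: he; rewrite addrAC subrr add0r normrN ger0_norm// ltW.
move: h1 h2 c1 c2; rewrite !ler_norml.
by move=> /andP[? ?] /andP[? ?] /andP[? ?] /andP[? ?]; apply/andP; split; lra.
Qed.

Lemma cvg_normal_abs X (z eta : R) : cvg_normal X -> 0 <= z -> 0 < eta ->
  exists N, forall n, (N <= n)%N ->
    `|pr (P n) [set x | `|X n x| <= z] - (Phi z - Phi (- z))| <= eta.
Proof.
move=> [mX hX] z0 eta0.
have eta3 : 0 < eta / 3 by rewrite divr_gt0.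
have [e e0 he] := Phi_close eta3.
have [N1 h1] := hX z _ eta3; have [N2 h2] := hX (- z) _ eta3.
have [N3 h3] := hX (- z - e) _ eta3.
exists (maxn (maxn N1 N2) N3) => n.
rewrite !geq_max => /andP[/andP[/h1 {}h1 /h2 {}h2] /h3 {}h3].
have mle c : measurable [set x | X n x <= c] by exact: measurable_le.
have mA : measurable [set x | `|X n x| <= z].
  by apply: (@measurable_le _ _ _ (fun x => `|X n x|)); exact: measurableT_comp.
have ub : pr (P n) [set x | `|X n x| <= z] <=
    pr (P n) [set x | X n x <= z] - pr (P n) [set x | X n x <= - z - e].
  rewrite -pr_setD//; last by move=> x /=; lra.
  apply: pr_le => //; first exact: measurableD.
  by move=> x /=; rewrite ler_norml => /andP[? ?]; split => //; lra.
have lb : pr (P n) [set x | X n x <= z] - pr (P n) [set x | X n x <= - z] <=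
    pr (P n) [set x | `|X n x| <= z].
  rewrite -pr_setD//; last by move=> x /=; lra.
  apply: pr_le => //; first exact: measurableD.
  move=> x /= [? /negP]; rewrite -ltNge ler_norml => ?; apply/andP; split => //.
  exact: ltW.
have c : `|Phi (- z - e) - Phi (- z)| <= eta / 3.
  by apply: he; rewrite addrAC subrr add0r normrN ger0_norm// ltW.
move: h1 h2 h3 c; rewrite !ler_norml.
by move=> /andP[? ?] /andP[? ?] /andP[? ?] /andP[? ?]; apply/andP; split; lra.
Qed.

Variables (y : R -> R) (s : R).
Hypotheses (by_ : bmeas01 y) (y0 : I1 y = 0) (s0 : 0 < s)
  (ys : I1 (fun u => y u ^+ 2) = s ^+ 2).
Variables (ws : R -> R -> R) (U : forall n, 'I_n -> {RV (P n) >-> R})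
  (A : forall n, 'I_n -> 'I_n -> {RV (P n) >-> bool}).
Hypothesis hd : forall n, one_graph_design ws (@U n) (@A n).

Let W n x : R := standardized y s (@U n) x.

Arguments W : clear implicits.

Let bW n : bmeas setT (W n).
Proof. exact: (bmeas_standardized s by_ (hd n)). Qed.

Let sandwich (a b : R) (h : R -> R) :
  continuous h -> (forall x, 0 <= h x <= 1) ->
  (forall x, x <= a -> h x = 1) -> (forall x, b <= x -> h x = 0) ->
  (forall n, pr (P n) [set x | W n x <= a] <= \int[P n]_x h (W n x) /\
     \int[P n]_x h (W n x) <= pr (P n) [set x | W n x <= b]) /\
  (Phi a <= \int[mu]_t (h t * gauss t) <= Phi b).
Proof.
move=> ch h01 ha hb.
have hle x : h x <= \1_[set t | t <= b] x.
  rewrite indicE; case: (boolP (x \in _)) => [_|]; first by have /andP[] := h01 x.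
  by rewrite notin_setE/= => /negP; rewrite -ltNge => /ltW /hb ->.
have hge x : \1_[set t | t <= a] x <= h x.
  rewrite indicE; case: (boolP (x \in _)) => [|_]; last by have /andP[] := h01 x.
  by rewrite inE/= => /ha ->.
split.
  move=> n; have PT : (P n setT < +oo)%E by rewrite probability_setT ltry.
  have mle c : measurable [set x | W n x <= c] by apply: measurable_le; exact: (bW n).1.
  have bh : bmeas setT (fun x => h (W n x)).
    split; first by apply: measurableT_comp (bW n).1; exact: continuous_measurable_fun.
    by exists 1 => x _; have /andP[? ?] := h01 (W n x); rewrite ger0_norm.
  rewrite !pr_indic//; split; apply: le_Rint => //; try exact: bmeas_indic.
  by move=> x _; have := hge (W n x); rewrite !indicE.
have hn x : `|h x| <= 1 by have /andP[? ?] := h01 x; rewrite ger0_norm.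
have ih := integrable_gauss ch hn.
have ig (c : R) : mu.-integrable setT (EFin \o (fun t => \1_[set u | u <= c] t * gauss t)).
  have -> : (fun t : R => \1_[set u | u <= c] t * gauss t) = gauss \_ [set` `]-oo, c]].
    apply/funext => t; rewrite patchE indicE.
    by case: ifPn => _; rewrite ?mul1r ?mul0r.
  have := @integrable_normal_pdf R 0 1 => i1.
  rewrite -restrict_EFin; apply/integrable_restrict => //.
  by rewrite setTI; apply: integrableS i1.
have Pind (c : R) : Phi c = \int[mu]_t (\1_[set u | u <= c] t * gauss t).
  rewrite /Phi /lower_integral Rintegral_mkcond; apply: eq_Rintegral => t _.
  rewrite patchE indicE.
  by case: ifPn => _; rewrite ?mul0r.
rewrite !Pind; apply/andP; split; apply: le_Rintegral => //; try exact: ig.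
  by move=> t _; rewrite ler_wpM2r// ltW// gauss_gt0.
by move=> t _; rewrite ler_wpM2r// ltW// gauss_gt0.
Qed.

(** Smooth steps squeeze the distribution function of W between values of Phi at
    nearby points, up to the error of [stein_bound]. *)
Lemma clt : cvg_normal W.
Proof.
split=> [n|r eta eta0]; first exact: (bW n).1.
have eta2 : 0 < eta / 2 by rewrite divr_gt0.
have [e e0 he] := Phi_close eta2.
have one a b : a < b -> exists N, forall n, (N <= n)%N ->
    pr (P n) [set x | W n x <= a] <= Phi b + eta / 2 /\
    Phi a - eta / 2 <= pr (P n) [set x | W n x <= b].
  move=> ab; have [h [dh [K [hD h01 dhK ha hb]]]] := smooth_step_exists ab.
  have hn x : `|h x| <= 1 by have /andP[? ?] := h01 x; rewrite ger0_norm.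
  have [C C0 hC] := stein_bound by_ y0 s0 ys hD hn dhK.
  have [hW /andP[Pa Pb]] := sandwich (is_derive_continuous hD) h01 ha hb.
  exists (Num.truncn ((C / (eta / 2)) ^+ 2)).+1 => n Nn.
  have n0 : (0 < n)%N by exact: leq_trans Nn.
  have := hC _ _ _ _ _ _ _ (hd n) n0; rewrite -/(W n).
  have small : (Num.sqrt n%:R)^-1 * C <= eta / 2.
    have sn : 0 < Num.sqrt n%:R :> R by rewrite sqrtr_gt0 ltr0n.
    rewrite mulrC ler_pdivrMr// mulrC -ler_pdivrMr//.
    have q0 : 0 <= C / (eta / 2) by rewrite divr_ge0// ltW.
    rewrite -(ger0_norm q0) -sqrtr_sqr ler_wsqrtr//.
    by rewrite ltW// (lt_le_trans (truncnS_gt _))// ler_nat.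
  have [h1 h2] := hW n.
  rewrite ler_norml => /andP[h3 h4]; split; lra.
have [N1 h1] := one r (r + e) ltac:(by rewrite ltrDl).
have [N2 h2] := one (r - e) r ltac:(by rewrite gtrBl).
exists (maxn N1 N2) => n; rewrite geq_max => /andP[/h1 [h3 _] /h2 [_ h4]].
have c1 : `|Phi (r + e) - Phi r| <= eta / 2.
  by apply: he; rewrite addrAC subrr add0r ger0_norm// ltW.
have c2 : `|Phi (r - e) - Phi r| <= eta / 2.
  by apply: he; rewrite addrAC subrr add0r normrN ger0_norm// ltW.
move: c1 c2; rewrite !ler_norml => /andP[? ?] /andP[? ?]; apply/andP; split; lra.
Qed.

End normal_limits.

(** * The population regression *)

Section population_algebra.
Context {R : realType} {J : nat} (w : 'I_J -> R -> R -> R) (ws : R -> R -> R).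
Hypotheses (hw : forall j, graphon (w j)) (hws : graphon ws).

Definition regressor (k : 'I_J.+1) (u v : R) : R := feature w u v k 0.

Definition misfit (u v : R) : R := ws u v - w_circ w ws u v.

Definition score_kernel (k : 'I_J.+1) (u v : R) : R := misfit u v * regressor k u v.

Lemma regressorE k u v :
  regressor k u v = oapp (fun j => w j u v) 1 (unlift ord0 k).
Proof. by rewrite /regressor mxE. Qed.

Lemma sqbmeas_regressor k : sqbmeas (regressor k).
Proof.
have -> : regressor k = fun u v => oapp (fun j => w j u v) 1 (unlift ord0 k).
  by apply/funext => u; apply/funext => v; rewrite regressorE.
case: (unlift ord0 k) => [j|] /=; first exact: sqbmeas_ws (hw j).
exact: bmeas_cst.
Qed.

Lemma regressor_sym k u v : u \in `[0, 1] -> v \in `[0, 1] ->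
  regressor k u v = regressor k v u.
Proof.
move=> u01 v01; rewrite !regressorE; case: (unlift ord0 k) => //= j.
exact: (graphon_sym (hw j)).
Qed.

Lemma lincombE (b : 'cV[R]_J.+1) u v :
  lincomb w b u v = \sum_k b k 0 * regressor k u v.
Proof. by rewrite /lincomb mxE; apply: eq_bigr => k _; rewrite mxE. Qed.

Lemma sqbmeas_lincomb b : sqbmeas (lincomb w b).
Proof.
have -> : lincomb w b = fun u v => \sum_k b k 0 * regressor k u v.
  by apply/funext => u; apply/funext => v; rewrite lincombE.
apply: (@bmeas_sum _ _ _ _ _ _ _ (fun k (z : R * R) => b k 0 * regressor k z.1 z.2)) => k _.
exact/bmeasZ/sqbmeas_regressor.
Qed.

Lemma lincomb_sym b u v : u \in `[0, 1] -> v \in `[0, 1] ->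
  lincomb w b u v = lincomb w b v u.
Proof.
move=> u01 v01; rewrite !lincombE; apply: eq_bigr => k _.
by rewrite regressor_sym.
Qed.

Lemma sqbmeas_misfit : sqbmeas misfit.
Proof. by apply: bmeasB; [exact: sqbmeas_ws|exact: sqbmeas_lincomb]. Qed.

Lemma misfit_sym u v : u \in `[0, 1] -> v \in `[0, 1] -> misfit u v = misfit v u.
Proof.
by move=> u01 v01; rewrite /misfit (graphon_sym hws)// /w_circ lincomb_sym.
Qed.

Lemma sqbmeas_score_kernel k : sqbmeas (score_kernel k).
Proof. by apply: bmeasM; [exact: sqbmeas_misfit|exact: sqbmeas_regressor]. Qed.

Lemma gramE k l :
  gram w k l = I2 (fun u v => regressor k u v * regressor l u v).
Proof.
rewrite /gram /int_square /mx_Rintegral mxE; apply: eq_Rintegral => z _.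
by rewrite mxE big_ord1 !mxE /regressor !mxE.
Qed.

Lemma gramT : (gram w)^T = gram w.
Proof.
apply/matrixP => k l; rewrite mxE !gramE; apply: eq_Rintegral => z _.
by rewrite mulrC.
Qed.

Lemma I2_sum (I : finType) (c : I -> R) (p : I -> R -> R -> R) :
  (forall i, sqbmeas (p i)) ->
  I2 (fun u v => \sum_i c i * p i u v) = \sum_i c i * I2 (p i).
Proof.
move=> bp; rewrite (@Rint_sum _ _ _ (@lebesgue2 R) _ measurable_square
  lebesgue_square_fin _ _ _ (fun i (z : R * R) => c i * p i z.1 z.2)); last first.
  by move=> i _; exact: bmeasZ (bp i).
apply: eq_bigr => i _.
exact: (@RintZ _ _ _ (@lebesgue2 R) _ measurable_square lebesgue_square_fin _ _ (bp i)).
Qed.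

Let bFF k l : sqbmeas (fun u v => regressor k u v * regressor l u v).
Proof. by apply: bmeasM; exact: sqbmeas_regressor. Qed.

Lemma gram_lincomb b l :
  (gram w *m b) l 0 = I2 (fun u v => lincomb w b u v * regressor l u v).
Proof.
rewrite mxE; under eq_bigr do rewrite gramE mulrC.
rewrite -(@I2_sum _ (fun k => b k 0)
  (fun k u v => regressor l u v * regressor k u v))//; apply: eq_Rintegral => z _.
rewrite lincombE mulr_suml; apply: eq_bigr => k _.
by rewrite mulrAC mulrA.
Qed.

Lemma gram_quadratic b :
  (b^T *m gram w *m b) 0 0 = I2 (fun u v => lincomb w b u v ^+ 2).
Proof.
rewrite -mulmxA mxE; under eq_bigr do rewrite mxE gram_lincomb.
rewrite -(@I2_sum _ (fun k => b k 0)
  (fun k u v => lincomb w b u v * regressor k u v)); last first.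
  by move=> k; apply: bmeasM; [exact: sqbmeas_lincomb|exact: sqbmeas_regressor].
apply: eq_Rintegral => z _; rewrite expr2 {3}lincombE mulr_sumr.
by apply: eq_bigr => k _; rewrite mulrCA.
Qed.

(** A vector in the kernel of the Gram matrix gives a combination of the features
    with zero mean square, which linear independence forbids. *)
Lemma gram_unit : features_free w -> gram w \in unitmx.
Proof.
move=> hfree; rewrite unitmxE unitfE; apply/negP => /det0P[v v0 vG].
have b0 : v^T = 0.
  apply: hfree.
  have := gram_quadratic v^T; rewrite trmxK vG mul0mx mxE => /esym h.
  have bL := bmeasX 2 (sqbmeas_lincomb v^T).
  have mf : measurable_fun (@unit_square R)
     (fun z : R * R => (lincomb w v^T z.1 z.2 ^+ 2)%:E).
    by apply/measurable_EFinP; exact: bL.1.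
  have [+ _] := ae_eq_integral_abs (@lebesgue2 R) measurable_square mf.
  have h0 : (\int[@lebesgue2 R]_(z in @unit_square R)
      `|(lincomb w v^T z.1 z.2 ^+ 2)%:E| = 0)%E.
    transitivity (\int[@lebesgue2 R]_(z in @unit_square R)
      (lincomb w v^T z.1 z.2 ^+ 2)%:E)%E.
      by apply: eq_integral => z _; rewrite gee0_abs// lee_fin sqr_ge0.
    rewrite -(@EFin_Rint _ _ _ (@lebesgue2 R) _ measurable_square
      lebesgue_square_fin _ bL).
    by rewrite h.
  move=> /(_ h0); apply: filterS => z + zS => /(_ zS) => -[/eqP].
  by rewrite sqrf_eq0 => /eqP.
by move: v0; rewrite -(trmxK v) b0 trmx0 eqxx.
Qed.

(** By the choice of beta_circ the misfit is orthogonal to every feature, which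
    centres the score kernels. *)
Lemma normal_equations l : features_free w -> I2 (score_kernel l) = 0.
Proof.
move=> hfree.
have h : (gram w *m beta_circ w ws) l 0 = I2 (fun u v => ws u v * regressor l u v).
  rewrite /beta_circ mulKVmx ?gram_unit// mxE.
  by apply: eq_Rintegral => z _; rewrite mxE.
rewrite gram_lincomb in h.
transitivity (I2 (fun u v => ws u v * regressor l u v - w_circ w ws u v * regressor l u v)).
  by apply: eq_Rintegral => z _; rewrite /score_kernel /misfit mulrBl.
rewrite (@RintB _ _ _ (@lebesgue2 R) _ measurable_square lebesgue_square_fin
  (fun z : R * R => ws z.1 z.2 * regressor l z.1 z.2)
  (fun z : R * R => w_circ w ws z.1 z.2 * regressor l z.1 z.2)).
- by rewrite /w_circ h subrr.
- by apply: bmeasM; [exact: sqbmeas_ws|exact: sqbmeas_regressor].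
- by apply: bmeasM; [exact: sqbmeas_lincomb|exact: sqbmeas_regressor].
Qed.

Lemma score_dyadic_kernel k : features_free w ->
  dyadic_kernel (regressor k) (score_kernel k).
Proof.
move=> hfree; split.
- exact: sqbmeas_regressor.
- by move=> u v u01 v01; exact: regressor_sym.
- exact: sqbmeas_score_kernel.
- by move=> u v u01 v01; rewrite /score_kernel misfit_sym// regressor_sym.
- by rewrite -I2_marginal ?normal_equations//; exact: sqbmeas_score_kernel.
Qed.

Lemma g_projE k u : g_proj w ws u k 0 = marginal (score_kernel k) u.
Proof.
rewrite /g_proj /mx_Rintegral mxE; apply: eq_Rintegral => v _.
by rewrite mxE.
Qed.

Lemma Sigma_gE k l :
  Sigma_g w ws k l = marginal_cov (score_kernel k) (score_kernel l).
Proof.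
rewrite /Sigma_g /mx_Rintegral mxE; apply: eq_Rintegral => u _.
by rewrite mxE big_ord1 [_^T _ _]mxE !g_projE.
Qed.

Lemma M_mxE k l : M_mx w ws k l =
  kernel_var ws (regressor k) (score_kernel k) (regressor l) (score_kernel l).
Proof.
rewrite /M_mx /int_square /mx_Rintegral mxE; apply: eq_Rintegral => z _.
rewrite mxE mxE big_ord1 !mxE /sigma2 /score_kernel /misfit /regressor !mxE.
by ring.
Qed.

End population_algebra.

(** * Exact moments of the score and of the robust covariance *)

Lemma sum_upper (R : realType) n (F : 'I_n -> 'I_n -> R) :
  (forall i j, F i j = F j i) ->
  \sum_(i < n) \sum_(j < n | (i < j)%N) F i j =
  2^-1 * \sum_(i < n) \sum_(j < n | j != i) F i j.
Proof.
move=> FC.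
have split_other i : \sum_(j < n | j != i) F i j =
    \sum_(j < n | (i < j)%N) F i j + \sum_(j < n | (j < i)%N) F i j.
  rewrite (bigID (fun j : 'I_n => (i < j)%N))/=; congr (_ + _);
    apply: eq_bigl => j; rewrite neq_ltn.
    by case: (ltngtP i j) => //; rewrite ?orbT.
  by case: (ltngtP i j) => //; rewrite ?orbT ?andbF.
under [in RHS]eq_bigr do rewrite split_other.
rewrite big_split/= (exchange_big_dep predT)//=.
under [X in _ + X]eq_bigr => j _ do under eq_bigr do rewrite FC.
by rewrite -mulr2n -[X in _ * X]mulr_natl mulKf.
Qed.

Section exact_moments.
Context d (T : measurableType d) (R : realType) (P : probability T R) (n : nat)
  (J : nat).
Variables (w : 'I_J -> R -> R -> R) (ws : R -> R -> R).
Variables (U : 'I_n -> {RV P >-> R}) (A : 'I_n -> 'I_n -> {RV P >-> bool}).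
Hypotheses (hw : forall j, graphon (w j)) (hws : graphon ws)
  (hfree : features_free w).
Hypothesis hd : one_graph_design ws U A.

Local Notation E := (Rintegral P setT).
Local Notation nR := (n%:R : R).
Let PT : (P setT < +oo)%E. Proof. by rewrite probability_setT ltry. Qed.

Let hk k := score_dyadic_kernel hw hws k hfree.

Definition score_dyad k : 'I_n -> 'I_n -> T -> R :=
  dyad ws U A (regressor w k) (score_kernel w ws k).

Definition score_row k : 'I_n -> T -> R :=
  dyad_row ws U A (regressor w k) (score_kernel w ws k).

Definition score_total k : T -> R :=
  dyad_total ws U A (regressor w k) (score_kernel w ws k).

Lemma residual_dyad k i j x :
  residual w U A (beta_circ w ws) i j x * Fpair w U i j x k 0 =
  score_dyad k i j x.
Proof.
rewrite /residual /score_dyad /dyad /noise /score_kernel /misfit /w_circ.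
by rewrite /lincomb /Fpair /regressor; ring.
Qed.

Lemma bmeas_score_dyad k i j : bmeas setT (score_dyad k i j).
Proof. exact: (bmeas_dyad hws hd (hk k)). Qed.

Lemma bmeas_score_row k i : bmeas setT (score_row k i).
Proof. exact: (bmeas_dyad_row hws hd _ (hk k)). Qed.

Lemma bmeas_score_total k : bmeas setT (score_total k).
Proof. exact: (bmeas_dyad_total hws hd (hk k)). Qed.

Lemma scoreE k x :
  score w U A ws x k 0 = (@npairs R n)^-1 * (2^-1 * score_total k x).
Proof.
rewrite /score mxE summxE; congr (_ * _).
rewrite -(sum_upper (F := fun i j => score_dyad k i j x)); last first.
  by move=> i j; exact: (dyadC hws hd (hk k)).
apply: eq_bigr => i _; rewrite summxE; apply: eq_bigr => j _.
by rewrite mxE -residual_dyad.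
Qed.

Lemma row_scoreE k i x : row_score w U A (beta_circ w ws) i x k 0 = score_row k i x.
Proof.
rewrite /row_score summxE; apply: eq_bigr => j _.
by rewrite mxE residual_dyad.
Qed.

Lemma V_hatE k l x : V_hat w U A (beta_circ w ws) x k l =
  (@npairs R n ^+ 2)^-1 * (\sum_(i < n) score_row k i x * score_row l i x -
    \sum_(i < n) \sum_(j < n | (i < j)%N) score_dyad k i j x * score_dyad l i j x).
Proof.
rewrite /V_hat mxE; congr (_ * _); rewrite !mxE !summxE; congr (_ - _).
  apply: eq_bigr => i _.
  by rewrite mxE big_ord1 [_^T _ _]mxE !row_scoreE.
apply: eq_bigr => i _; rewrite summxE; apply: eq_bigr => j _.
by rewrite mxE mxE big_ord1 [_^T _ _]mxE -!residual_dyad; ring.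
Qed.

Lemma dyadic_varE k l : dyadic_var w ws n k l =
  (@npairs R n)^-1 * M_mx w ws k l
  + (4 * (nR - 2) / (nR * (nR - 1))) * Sigma_g w ws k l.
Proof. by rewrite /dyadic_var !mxE. Qed.

Lemma covariance_score k l : (2 <= n)%N ->
  covariance P (fun x => score w U A ws x k 0) (fun x => score w U A ws x l 0)
  = (dyadic_var w ws n k l)%:E.
Proof.
move=> n2.
pose c := (@npairs R n)^-1 * 2^-1.
have sE h : (fun x => score w U A ws x h 0) = (fun x => c * score_total h x).
  by apply/funext => x; rewrite scoreE mulrA.
have bc h : bmeas setT (fun x => c * score_total h x).
  exact/bmeasZ/bmeas_score_total.
have E0 h : expectation P (fun x => c * score_total h x) = 0%E.
  rewrite unlock -(EFin_Rint measurableT PT (bc h)).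
  rewrite RintZ//; last exact: bmeas_score_total.
  by rewrite (expectation_dyad_total hws hd (hk h)) mulr0.
rewrite !sE unlock !E0 unlock/=.
transitivity ((E (fun x => c ^+ 2 * (score_total k x * score_total l x)))%:E).
  rewrite EFin_Rint//; last first.
    by apply: bmeasZ; apply: bmeasM; exact: bmeas_score_total.
  apply: eq_integral => x _; congr (_%:E).
  by rewrite -[LHS]/((c * score_total k x - 0) * (c * score_total l x - 0)); ring.
rewrite RintZ//; last by apply: bmeasM; exact: bmeas_score_total.
rewrite (expectation_total2 hws hd (hk k) (hk l)) -M_mxE -Sigma_gE dyadic_varE.
congr (_%:E); rewrite /c /npairs.
have n0 : nR != 0 by rewrite pnatr_eq0 -lt0n (leq_trans _ n2).
have n1 : nR - 1 != 0 by rewrite subr_eq0 (eqr_nat _ n 1) gtn_eqF.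
by field; apply/andP.
Qed.

Lemma npairs_degenerate : (n < 2)%N -> @npairs R n = 0.
Proof.
by rewrite /npairs; case: (n) => [|[|m]]//; rewrite ?subrr ?mulr0 ?mul0r.
Qed.

(** In the sum of squared row sums each pair occurs in the two rows of its
    indices. The subtracted squares remove one of the two copies, which leaves
    N M, while the products of distinct pairs contribute n (n-1) (n-2) Sigma_g. *)
Lemma expectation_V_hat k l :
  expectation P (fun x => V_hat w U A (beta_circ w ws) x k l)
  = (dyadic_var w ws n k l)%:E.
Proof.
rewrite unlock.
have bR : bmeas setT (fun x => \sum_(i < n) score_row k i x * score_row l i x).
  by apply: bmeas_sum => i _; apply: bmeasM; exact: bmeas_score_row.
have bD i j : bmeas setT (fun x => score_dyad k i j x * score_dyad l i j x).
  by apply: bmeasM; exact: bmeas_score_dyad.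
have bDD : bmeas setT (fun x => \sum_(i < n) \sum_(j < n | (i < j)%N)
    score_dyad k i j x * score_dyad l i j x).
  by apply: bmeas_sum => i _; apply: bmeas_sum => j _.
pose M := M_mx w ws k l; pose S := Sigma_g w ws k l.
have ER : E (fun x => \sum_(i < n) score_row k i x * score_row l i x) =
    nR * ((nR - 1) * (M + (nR - 2) * S)).
  rewrite Rint_sum//; last by move=> i _; apply: bmeasM; exact: bmeas_score_row.
  rewrite (eq_bigr (fun=> (nR - 1) * (M + (nR - 2) * S))).
    by rewrite sumr_const card_ord mulr_natl.
  move=> i _; rewrite (expectation_row2 hws hd (hk k) (hk l)).
  by rewrite -M_mxE -Sigma_gE.
have ED : E (fun x => \sum_(i < n) \sum_(j < n | (i < j)%N)
    score_dyad k i j x * score_dyad l i j x) = 2^-1 * (nR * ((nR - 1) * M)).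
  rewrite Rint_sum//; last by move=> i _; apply: bmeas_sum.
  rewrite (eq_bigr (fun i : 'I_n => \sum_(j < n | (i < j)%N) M)).
    rewrite (sum_upper (F := fun _ _ => M))//; congr (_ * _).
    rewrite (eq_bigr (fun=> (nR - 1) * M)); last by move=> i _; rewrite sum_other_cst.
    by rewrite sumr_const card_ord mulr_natl.
  move=> i _; rewrite Rint_sum//; apply: eq_bigr => j ij.
  have neq : i != j by rewrite neq_ltn ij.
  rewrite (expectation_dyad2 hws hd (hk k) (hk l))// -M_mxE -Sigma_gE !eqxx.
  by rewrite (negbTE neq) [j == i]eq_sym (negbTE neq) /= -/M -/S; ring.
transitivity ((E (fun x => V_hat w U A (beta_circ w ws) x k l))%:E).
  rewrite EFin_Rint//.
  apply: (eq_bmeas _ (bmeasZ ((@npairs R n ^+ 2)^-1) (bmeasB bR bDD))) => x _.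
  by rewrite V_hatE.
under eq_Rintegral do rewrite V_hatE.
rewrite RintZ ?RintB//; last exact: bmeasB.
rewrite ER ED dyadic_varE -/M -/S; congr (_%:E).
have [n2|n2] := ltnP n 2.
  (* Without pairs both sides vanish, since the inverse of 0 is 0. *)
  rewrite (npairs_degenerate n2) expr0n/= invr0 !mul0r.
  by case: (n) n2 => [|[|m]]//; rewrite ?subrr ?(mulr0, mul0r, invr0, addr0).
rewrite /npairs.
have n0 : nR != 0 by rewrite pnatr_eq0 -lt0n (leq_trans _ n2).
have n1 : nR - 1 != 0 by rewrite subr_eq0 (eqr_nat _ n 1) gtn_eqF.
by field; apply/andP.
Qed.

End exact_moments.

(** * Rates in quadratic mean *)

Lemma natr_pred_bounds (R : realType) n : (2 <= n)%N ->
  [/\ 0 < n%:R :> R, 1 <= n%:R - 1 :> R & n%:R / 2 <= n%:R - 1 :> R].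
Proof.
move=> n2; have : (2 : R) <= n%:R by rewrite (ler_nat _ 2).
by move=> h; split; lra.
Qed.

Section rates.
Context d (T : measurableType d) (R : realType) (P : probability T R) (n : nat).
Variables (ws : R -> R -> R) (U : 'I_n -> {RV P >-> R})
  (A : 'I_n -> 'I_n -> {RV P >-> bool}).
Hypotheses (hws : graphon ws) (hd : one_graph_design ws U A) (n2 : (2 <= n)%N).
Variables (phi m : R -> R -> R) (hk : dyadic_kernel phi m).

Local Notation E := (Rintegral P setT).
Local Notation N := (n%:R : R).
Local Notation M := (kernel_var ws phi m phi m).
Local Notation S := (marginal_cov m m).
Local Notation tot := (dyad_total ws U A phi m).
Local Notation row := (dyad_row ws U A phi m).
Local Notation g := (marginal m).

Let PT : (P setT < +oo)%E. Proof. by rewrite probability_setT ltry. Qed.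

(** A crude constant that serves all three rates. *)
Definition rate_cst : R := 4 * `|M| + 8 * `|S|.

Let bt : bmeas setT tot. Proof. exact: (bmeas_dyad_total hws hd hk). Qed.
Let bg : bmeas01 g. Proof. exact: bmeas_marginal (kernel_m hk). Qed.
Let bG : bmeas setT (coord_total U g). Proof. exact: (bmeas_coord_total hd). Qed.

Lemma dyad_total_rate :
  E (fun x => (tot x / (N * (N - 1))) ^+ 2) <= rate_cst / N.
Proof.
have [n0 n1 _] := natr_pred_bounds R n2.
have n10 : 0 < N - 1 by lra.
have e x : (tot x / (N * (N - 1))) ^+ 2 = (N * (N - 1)) ^- 2 * (tot x * tot x).
  by rewrite expr_div_n mulrC expr2.
under eq_Rintegral do rewrite e.
rewrite RintZ//; last exact: bmeasM.
rewrite (expectation_total2 hws hd hk hk).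
have -> : (N * (N - 1)) ^- 2 * (N * (N - 1) * (2 * M + 4 * (N - 2) * S)) =
    (2 * M + 4 * (N - 2) * S) / (N - 1) / N.
  by field; rewrite !gt_eqF.
rewrite ler_pM2r ?invr_gt0// ler_pdivrMr// /rate_cst.
have h1 := ler_norm M; have h2 := ler_norm S.
have h3 := normr_ge0 M; have h4 := normr_ge0 S.
have N2 : 0 <= N - 2 by lra.
have : (N - 2) * S <= (N - 2) * `|S| by rewrite ler_wpM2l.
have : `|M| <= `|M| * (N - 1) by rewrite ler_peMr.
have : (N - 2) * `|S| <= `|S| * (N - 1) by rewrite mulrC ler_wpM2l//; lra.
nra.
Qed.

(** The score, its projection and their cross moment share the leading term
    4 S / n, which cancels in the squared difference. *)
Lemma hajek_rate :
  E (fun x => (Num.sqrt N * (tot x / (N * (N - 1)) - 2 / N * coord_total U g x)) ^+ 2)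
  <= rate_cst / N.
Proof.
have [n0 n1 nhalf] := natr_pred_bounds R n2.
have n10 : 0 < N - 1 by lra.
have e x : (Num.sqrt N * (tot x / (N * (N - 1)) - 2 / N * coord_total U g x)) ^+ 2 =
    N * (N * (N - 1)) ^- 2 * (tot x * tot x)
    - 4 / (N * (N - 1)) * (tot x * coord_total U g x)
    + 4 / N * (coord_total U g x * coord_total U g x).
  by rewrite exprMn sqr_sqrtr ?(ltW n0)//; field; rewrite !gt_eqF.
under eq_Rintegral do rewrite e.
have b1 : bmeas setT (fun x => tot x * tot x) by exact: bmeasM.
have b2 : bmeas setT (fun x => tot x * coord_total U g x) by exact: bmeasM.
have b3 : bmeas setT (fun x => coord_total U g x * coord_total U g x) by exact: bmeasM.
rewrite RintD ?RintB ?RintZ//; try (by repeat first [assumption | exact: bmeasZ | apply: bmeasB]).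
rewrite (expectation_total2 hws hd hk hk).
rewrite (expectation_total_coord hws hd hk bg (kernel_centred hk)).
rewrite (expectation_coord_total2 hd bg bg (kernel_centred hk)).
rewrite -/(marginal_cov m m).
have -> : N * (N * (N - 1)) ^- 2 * (N * (N - 1) * (2 * M + 4 * (N - 2) * S)) -
    4 / (N * (N - 1)) * (N * (N - 1) * (2 * S)) + 4 / N * (N * S) =
    (2 * M - 4 * S) / (N - 1).
  by field; rewrite !gt_eqF.
rewrite ler_pdivrMr// mulrAC ler_pdivlMr// /rate_cst.
have h1 := ler_norm M; have h2 := ler_norm (- S); rewrite normrN in h2.
have h3 := normr_ge0 M; have h4 := normr_ge0 S.
have : (2 * M - 4 * S) * N <= (2 * `|M| + 4 * `|S|) * N by rewrite ler_pM2r//; lra.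
have : (4 * `|M| + 8 * `|S|) * (N / 2) <= (4 * `|M| + 8 * `|S|) * (N - 1).
  by rewrite ler_wpM2l//; lra.
lra.
Qed.

(** Given U i the row is a sum of n - 1 terms with mean g (U i), correlated only
    through U i. *)
Lemma row_rate i :
  E (fun x => (row i x / (N - 1) - g (U i x)) ^+ 2) <= rate_cst / N.
Proof.
have [n0 n1 nhalf] := natr_pred_bounds R n2.
have n10 : 0 < N - 1 by lra.
have br : bmeas setT (row i) by exact: (bmeas_dyad_row hws hd _ hk).
have bgi : bmeas setT (fun x => g (U i x)) by exact: (bmeas_coord hd).
have e x : (row i x / (N - 1) - g (U i x)) ^+ 2 =
   (N - 1) ^- 2 * (row i x * row i x) - 2 / (N - 1) * (row i x * g (U i x))
   + g (U i x) * g (U i x).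
  by field; rewrite gt_eqF.
under eq_Rintegral do rewrite e.
have b1 : bmeas setT (fun x => row i x * row i x) by exact: bmeasM.
have b2 : bmeas setT (fun x => row i x * g (U i x)) by exact: bmeasM.
have b3 : bmeas setT (fun x => g (U i x) * g (U i x)) by exact: bmeasM.
rewrite RintD ?RintB ?RintZ//; try (by repeat first [assumption | exact: bmeasZ | apply: bmeasB]).
rewrite (expectation_row2 hws hd hk hk).
rewrite (expectation_row_coord hws hd hk bg (kernel_centred hk)).
rewrite (expectation_coord2 hd i i bg bg (kernel_centred hk)) eqxx mul1r.
rewrite -/(marginal_cov m m).
have -> : (N - 1) ^- 2 * ((N - 1) * (M + (N - 2) * S)) -
    2 / (N - 1) * ((N - 1) * S) + S = (M - S) / (N - 1).
  by field; rewrite gt_eqF.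
rewrite ler_pdivrMr// mulrAC ler_pdivlMr// /rate_cst.
have h1 := ler_norm M; have h2 := ler_norm (- S); rewrite normrN in h2.
have h3 := normr_ge0 M; have h4 := normr_ge0 S.
have : (M - S) * N <= (`|M| + `|S|) * N by rewrite ler_pM2r//; lra.
have : (4 * `|M| + 8 * `|S|) * (N / 2) <= (4 * `|M| + 8 * `|S|) * (N - 1).
  by rewrite ler_wpM2l//; lra.
have : 0 <= `|S| * N by rewrite mulr_ge0// ltW.
have : 0 <= `|M| * N by rewrite mulr_ge0// ltW.
lra.
Qed.

End rates.

(** * Random matrices *)

Section measurable_matrices.
Context d (T : measurableType d) (R : realType).

Definition mxmeasurable p q (X : T -> 'M[R]_(p, q)) :=
  forall i j, measurable_fun setT (fun x => X x i j).

Lemma mxmeasurable_mul p q r (X : T -> 'M[R]_(p, q)) (Y : T -> 'M[R]_(q, r)) :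
  mxmeasurable X -> mxmeasurable Y -> mxmeasurable (fun x => X x *m Y x).
Proof.
move=> mX mY i j; under eq_fun do rewrite mxE.
by apply: measurable_sum => k; exact: measurable_funM.
Qed.

Lemma mxmeasurable_cst p q (X : 'M[R]_(p, q)) : mxmeasurable (fun=> X).
Proof. by move=> i j; exact: measurable_cst. Qed.

Lemma measurable_det p (X : T -> 'M[R]_p) : mxmeasurable X ->
  measurable_fun setT (fun x => \det (X x)).
Proof.
move=> mX; rewrite /determinant; apply: measurable_sum => s.
apply: measurable_funM => //.
by apply: measurable_prod => i _; exact: mX.
Qed.

Lemma mxmeasurable_adj p (X : T -> 'M[R]_p) : mxmeasurable X ->
  mxmeasurable (fun x => \adj (X x)).
Proof.
move=> mX i j; under eq_fun do rewrite mxE /cofactor.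
apply: measurable_funM; first exact: measurable_cst.
apply: measurable_det => k l; under eq_fun do rewrite !mxE.
exact: mX.
Qed.

(** Cramer's rule: off the zero set of the determinant the inverse is a quotient
    of polynomials in the entries. *)
Lemma mxmeasurable_invmx p (X : T -> 'M[R]_p) : mxmeasurable X ->
  mxmeasurable (fun x => invmx (X x)).
Proof.
move=> mX i j.
have -> : (fun x => invmx (X x) i j) = (fun x =>
    if \det (X x) == 0 then X x i j else (\det (X x))^-1 * \adj (X x) i j).
  apply/funext => x; rewrite /invmx unitmxE unitfE.
  by case: eqVneq => //= _; rewrite mxE.
apply: measurable_fun_ifT.
- by apply: measurable_fun_eqr => //; exact: measurable_det.
- exact: mX.
- apply: measurable_funM; last exact: mxmeasurable_adj.
  exact/measurable_invr_comp/measurable_det.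
Qed.

End measurable_matrices.

Section matrix_convergence.
Context {R : realType} (d : nat -> measure_display)
  (T : forall n, measurableType (d n)) (P : forall n, probability (T n) R).

Definition mxcvgP p q (X : forall n, T n -> 'M[R]_(p, q)) (C : 'M[R]_(p, q)) :=
  forall i j, cvgP P (fun n x => X n x i j) (C i j).

Lemma cvgP_eventually (X Y : forall n, T n -> R) c :
  (forall n, measurable_fun setT (Y n)) ->
  (exists N, forall n x, (N <= n)%N -> X n x = Y n x) ->
  cvgP P X c -> cvgP P Y c.
Proof.
move=> mY [N XY] hX; have h := cvgPB hX (cvgP_cst P c); rewrite subrr in h.
apply: (cvgP_dominated mY _ h); exists N => n x Nn.
by rewrite XY.
Qed.

Lemma mxcvgP_mul p q r (X : forall n, T n -> 'M[R]_(p, q))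
    (Y : forall n, T n -> 'M[R]_(q, r)) C D :
  mxcvgP X C -> mxcvgP Y D -> mxcvgP (fun n x => X n x *m Y n x) (C *m D).
Proof.
move=> hX hY i j; rewrite mxE.
have h : cvgP P (fun n x => \sum_k X n x i k * Y n x k j) (\sum_k C i k * D k j).
  apply: (@cvgP_sum _ _ _ _ _ _ _ (fun k n x => X n x i k * Y n x k j)) => k _.
  exact: cvgPM.
by apply: eq_cvgP h => n x; rewrite mxE.
Qed.

Lemma mxcvgP_cst p q (C : 'M[R]_(p, q)) : mxcvgP (fun n _ => C) C.
Proof. by move=> i j; exact: cvgP_cst. Qed.

Lemma cvgP_det p (X : forall n, T n -> 'M[R]_p) C : mxcvgP X C ->
  cvgP P (fun n x => \det (X n x)) (\det C).
Proof.
move=> hX; rewrite /determinant.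
apply: (@cvgP_sum _ _ _ _ _ _ _ (fun s n x => (-1) ^+ perm.odd_perm s * \prod_i X n x i (perm.fun_of_perm s i))) => s _.
apply: cvgPZ.
by apply: (@cvgP_prod _ _ _ _ _ _ _ (fun i n x => X n x i (perm.fun_of_perm s i))) => i _.
Qed.

Lemma mxcvgP_adj p (X : forall n, T n -> 'M[R]_p) C : mxcvgP X C ->
  mxcvgP (fun n x => \adj (X n x)) (\adj C).
Proof.
move=> hX i j; rewrite mxE /cofactor.
have h : mxcvgP (fun n x => row' j (col' i (X n x))) (row' j (col' i C)).
  move=> k l; rewrite !mxE; apply: eq_cvgP (hX _ _) => n x.
  by rewrite !mxE.
apply: eq_cvgP (cvgPZ ((-1) ^+ (j + i)) (cvgP_det h)) => n x.
by rewrite mxE /cofactor.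
Qed.

(** By Cramer's rule, from the convergence of determinant and adjugate. *)
Lemma mxcvgP_inv p (X : forall n, T n -> 'M[R]_p) C :
  (exists N, forall n x, (N <= n)%N -> X n x \in unitmx) -> C \in unitmx ->
  mxcvgP X C -> mxcvgP (fun n x => invmx (X n x)) (invmx C).
Proof.
move=> [N uX] uC hX i j.
have dC : \det C != 0 by rewrite -unitfE -unitmxE.
have h := cvgPM (cvgPV dC (cvgP_det hX)) (mxcvgP_adj hX i j).
have -> : invmx C i j = (\det C)^-1 * \adj C i j by rewrite /invmx uC mxE.
apply: (cvgP_eventually _ _ h).
  by move=> n; apply: mxmeasurable_invmx => k l; exact: (hX k l).1.
by exists N => n x Nn; rewrite /invmx uX//= [RHS]mxE.
Qed.

Lemma cvgP_rate (u : nat -> R) (c C : R) :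
  (forall n, (2 <= n)%N -> `|u n - c| <= C / n%:R) -> cvgP P (fun n _ => u n) c.
Proof.
move=> h; apply: (cvgP_L2 (C := C ^+ 2)) => [n|n n2]; first exact: bmeas_cst.
rewrite Rint_probability_cst.
have [n0 n1 _] := natr_pred_bounds R n2.
have C0 : 0 <= C by have := le_trans (normr_ge0 _) (h n n2); rewrite ler_pdivlMr// mul0r.
rewrite -real_normK ?num_real// (@le_trans _ _ ((C / n%:R) ^+ 2))//.
  by rewrite ler_pXn2r ?nnegrE ?divr_ge0// ?(ltW n0)// h.
rewrite expr_div_n ler_wpM2l ?sqr_ge0// lef_pV2 ?posrE ?exprn_gt0//.
by rewrite expr2 ler_peMr// ?(ltW n0)//; lra.
Qed.

End matrix_convergence.

(** * Laws of large numbers for dyadic averages *)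

Section dyadic_limits.
Context {R : realType} (d : nat -> measure_display)
  (T : forall n, measurableType (d n)) (P : forall n, probability (T n) R).
Variables (ws : R -> R -> R) (U : forall n, 'I_n -> {RV (P n) >-> R})
  (A : forall n, 'I_n -> 'I_n -> {RV (P n) >-> bool}).
Hypotheses (hws : graphon ws)
  (hd : forall n, one_graph_design ws (@U n) (@A n)).

Lemma cvgP_coord_mean (q : R -> R) : bmeas01 q ->
  cvgP P (fun n x => n%:R^-1 * coord_total (@U n) q x) (I1 q).
Proof.
move=> bq; set c := I1 q; pose q0 u := q u - c.
have bq0 : bmeas01 q0 by apply: bmeasB => //; exact: bmeas_cst.
have q00 : I1 q0 = 0.
  rewrite (@RintB _ _ _ lebesgue_measure _ measurable01 lebesgue01_fin q (cst c))//.
    rewrite Rintegral_cst; last exact: measurable01.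
    by rewrite [X in fine X](_ : _ = 1%E) ?mulr1 ?subrr//; exact: lebesgue01.
  exact: bmeas_cst.
apply: (cvgP_L2 (C := I1 (fun u => q0 u * q0 u))) => [n|n n2].
  exact/bmeasZ/(bmeas_coord_total (hd n)).
have [n0 n1 _] := natr_pred_bounds R n2.
have e x : (n%:R^-1 * coord_total (@U n) q x - c) ^+ 2 =
    n%:R ^- 2 * (coord_total (@U n) q0 x * coord_total (@U n) q0 x).
  have -> : coord_total (@U n) q0 x = coord_total (@U n) q x - n%:R * c.
    by rewrite /coord_total sumrB sumr_const card_ord mulr_natl.
  by field; rewrite gt_eqF.
under eq_Rintegral do rewrite e.
have PT : (P n setT < +oo)%E by rewrite probability_setT ltry.
rewrite RintZ//; last by apply: bmeasM; exact: (bmeas_coord_total (hd n)).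
rewrite (expectation_coord_total2 (hd n) bq0 bq0 q00).
rewrite le_eqVlt; apply/orP; left; apply/eqP.
by field; rewrite gt_eqF.
Qed.

Section kernel.
Variables (phi m : R -> R -> R) (hk : dyadic_kernel phi m).

Let bt n : bmeas setT (dyad_total ws (@U n) (@A n) phi m).
Proof. exact: (bmeas_dyad_total hws (hd n) hk). Qed.

Let bG n : bmeas setT (coord_total (@U n) (marginal m)).
Proof. exact: (bmeas_coord_total (hd n) (bmeas_marginal (kernel_m hk))). Qed.

Lemma cvgP_dyad_mean :
  cvgP P (fun n x => dyad_total ws (@U n) (@A n) phi m x / (n%:R * (n%:R - 1))) 0.
Proof.
apply: (cvgP_L2 (C := rate_cst ws phi m)) => [n|n n2].
  by apply: bmeasM => //; exact: bmeas_cst.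
under eq_Rintegral do rewrite subr0.
exact: (dyad_total_rate hws (hd n) n2 hk).
Qed.

Lemma cvgP_hajek : cvgP P (fun n x => Num.sqrt n%:R *
  (dyad_total ws (@U n) (@A n) phi m x / (n%:R * (n%:R - 1))
   - 2 / n%:R * coord_total (@U n) (marginal m) x)) 0.
Proof.
apply: (cvgP_L2 (C := rate_cst ws phi m)) => [n|n n2].
  apply: bmeasZ; apply: bmeasB; last exact: bmeasZ.
  by apply: bmeasM => //; exact: bmeas_cst.
under eq_Rintegral do rewrite subr0.
exact: (hajek_rate hws (hd n) n2 hk).
Qed.

End kernel.

End dyadic_limits.

(** * The estimators at a fixed sample size *)

Section matrix_measurability.
Context d (T : measurableType d) (R : realType).

Lemma mxmeasurable_sum p q (I : Type) (r : seq I) (Q : pred I)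
    (F : I -> T -> 'M[R]_(p, q)) :
  (forall i, Q i -> mxmeasurable (F i)) ->
  mxmeasurable (fun x => \sum_(i <- r | Q i) F i x).
Proof.
move=> mF k l; elim: r => [|i r IH].
  by under eq_fun do rewrite big_nil; exact: measurable_cst.
case/boolP: (Q i) => [Qi|/negbTE Qi]; under eq_fun do rewrite big_cons Qi; last exact: IH.
by under eq_fun do rewrite mxE; apply: measurable_funD => //; exact: mF.
Qed.

Lemma mxmeasurableZ p q (c : T -> R) (X : T -> 'M[R]_(p, q)) :
  measurable_fun setT c -> mxmeasurable X -> mxmeasurable (fun x => c x *: X x).
Proof.
by move=> mc mX k l; under eq_fun do rewrite mxE; exact: measurable_funM.
Qed.

Lemma mxmeasurableD p q (X Y : T -> 'M[R]_(p, q)) :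
  mxmeasurable X -> mxmeasurable Y -> mxmeasurable (fun x => X x + Y x).
Proof.
by move=> mX mY k l; under eq_fun do rewrite mxE; exact: measurable_funD.
Qed.

Lemma mxmeasurableB p q (X Y : T -> 'M[R]_(p, q)) :
  mxmeasurable X -> mxmeasurable Y -> mxmeasurable (fun x => X x - Y x).
Proof.
by move=> mX mY k l; under eq_fun do rewrite !mxE; exact: measurable_funB.
Qed.

Lemma mxmeasurable_tr p q (X : T -> 'M[R]_(p, q)) :
  mxmeasurable X -> mxmeasurable (fun x => (X x)^T).
Proof. by move=> mX k l; under eq_fun do rewrite mxE; exact: mX. Qed.

End matrix_measurability.

Section estimators.
Context d (T : measurableType d) (R : realType) (P : probability T R) (n : nat)
  (J : nat).
Variables (w : 'I_J -> R -> R -> R) (ws : R -> R -> R).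
Variables (U : 'I_n -> {RV P >-> R}) (A : 'I_n -> 'I_n -> {RV P >-> bool}).
Variables (nu tau : R).
Hypotheses (hw : forall j, graphon (w j)) (hd : one_graph_design ws U A).

Let N : R := @npairs R n.
Let kappa : R := nu / (N * tau ^+ 2).

Lemma FpairE i j x k : Fpair w U i j x k 0 = regressor w k (U i x) (U j x).
Proof. by []. Qed.

Lemma mxmeasurable_Fpair i j : mxmeasurable (Fpair w U i j).
Proof.
move=> k l; rewrite (_ : l = 0) ?ord1//.
exact: (bmeas_pair hd i j (sqbmeas_regressor hw k)).1.
Qed.

Lemma mxmeasurable_ridge_gram : mxmeasurable (ridge_gram w U nu tau).
Proof.
apply: mxmeasurableD; last exact: mxmeasurable_cst.
apply: mxmeasurableZ; first exact: measurable_cst.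
apply: mxmeasurable_sum => i _; apply: mxmeasurable_sum => j _.
by apply: mxmeasurable_mul; [|apply: mxmeasurable_tr]; exact: mxmeasurable_Fpair.
Qed.

Let mA i j : measurable_fun setT (fun x => (A i j x)%:R : R).
Proof. exact: (bmeas_edge A i j).1. Qed.

Lemma mxmeasurable_beta_hat : mxmeasurable (beta_hat w U A nu tau).
Proof.
apply: mxmeasurable_mul; first exact/mxmeasurable_invmx/mxmeasurable_ridge_gram.
apply: mxmeasurableZ; first exact: measurable_cst.
apply: mxmeasurable_sum => i _; apply: mxmeasurable_sum => j _.
by apply: mxmeasurableZ => //; exact: mxmeasurable_Fpair.
Qed.

Lemma mxmeasurable_V_hat (b : T -> 'cV[R]_J.+1) : mxmeasurable b ->
  mxmeasurable (fun x => V_hat w U A (b x) x).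
Proof.
move=> mb.
have mr i j : measurable_fun setT (fun x => residual w U A (b x) i j x).
  apply: measurable_funB => //.
  apply: mxmeasurable_mul; last exact: mxmeasurable_Fpair.
  exact: mxmeasurable_tr.
have mR i : mxmeasurable (fun x => row_score w U A (b x) i x).
  apply: mxmeasurable_sum => j _.
  by apply: mxmeasurableZ => //; exact: mxmeasurable_Fpair.
apply: mxmeasurableZ; first exact: measurable_cst.
apply: mxmeasurableB.
  apply: mxmeasurable_sum => i _.
  by apply: mxmeasurable_mul => //; exact: mxmeasurable_tr.
apply: mxmeasurable_sum => i _; apply: mxmeasurable_sum => j _.
apply: mxmeasurableZ; first exact: measurable_funX.
by apply: mxmeasurable_mul; [|apply: mxmeasurable_tr]; exact: mxmeasurable_Fpair.
Qed.

Lemma mxmeasurable_Sigma_dy : mxmeasurable (Sigma_dy w U A nu tau).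
Proof.
have mi := mxmeasurable_invmx mxmeasurable_ridge_gram.
apply: mxmeasurable_mul => //; apply: mxmeasurable_mul => //.
exact/mxmeasurable_V_hat/mxmeasurable_beta_hat.
Qed.

Lemma measurable_std_err l : measurable_fun setT (std_err w U A nu tau l).
Proof.
apply: measurable_sqrt_comp; apply: measurable_maxr => //.
apply: mxmeasurable_mul; last exact: mxmeasurable_cst.
by apply: mxmeasurable_mul; [exact: mxmeasurable_cst|exact: mxmeasurable_Sigma_dy].
Qed.

Lemma measurable_beta_hat_dir (l b : 'cV[R]_J.+1) :
  measurable_fun setT (fun x => (l^T *m (beta_hat w U A nu tau x - b)) 0 0).
Proof.
apply: mxmeasurable_mul; first exact: mxmeasurable_cst.
by apply: mxmeasurableB; [exact: mxmeasurable_beta_hat|exact: mxmeasurable_cst].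
Qed.

Lemma measurable_t_stat l : measurable_fun setT (t_stat w U A ws nu tau l).
Proof.
apply: measurable_funM; first exact: measurable_beta_hat_dir.
exact/measurable_invr_comp/measurable_std_err.
Qed.

Lemma npairs_gt0 : (2 <= n)%N -> 0 < N.
Proof.
move=> n2; have [n0 n1 _] := natr_pred_bounds R n2.
by rewrite /N /npairs divr_gt0// mulr_gt0//; lra.
Qed.

Lemma gram_hat_nneg (v : 'rV[R]_J.+1) x : (2 <= n)%N ->
  0 <= (v *m gram_hat w U x *m v^T) 0 0.
Proof.
move=> n2; rewrite /gram_hat -scalemxAr -scalemxAl mxE.
rewrite mulr_ge0 ?invr_ge0 ?(ltW (npairs_gt0 n2))//.
rewrite mulmx_sumr mulmx_suml summxE; apply: sumr_ge0 => i _.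
rewrite mulmx_sumr mulmx_suml summxE; apply: sumr_ge0 => j _.
rewrite [v *m _]mulmxA -[_ *m v^T]mulmxA -trmx_mul mxE big_ord1.
by rewrite [_^T _ _]mxE -expr2 sqr_ge0.
Qed.

Hypotheses (nu0 : 0 < nu) (tau0 : 0 < tau).

(** The sample Gram matrix is positive semidefinite and the ridge term is positive
    definite. *)
Lemma ridge_gram_unit x : (2 <= n)%N -> ridge_gram w U nu tau x \in unitmx.
Proof.
move=> n2; rewrite unitmxE unitfE; apply/negP => /det0P[v v0 vA].
have k0 : 0 < kappa by rewrite divr_gt0// mulr_gt0 ?npairs_gt0// exprn_gt0.
have : (v *m ridge_gram w U nu tau x *m v^T) 0 0 = 0 by rewrite vA mul0mx mxE.
rewrite /ridge_gram mulmxDr mulmxDl mxE mul_mx_scalar -scalemxAl [X in _ + X]mxE.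
have := gram_hat_nneg v x n2; set q := (_ *m _ *m _) 0 0 => q0.
have s0 k : 0 <= v 0 k * v^T k 0 by rewrite mxE -expr2 sqr_ge0.
rewrite mxE => /eqP; rewrite paddr_eq0//; last first.
  by rewrite mulr_ge0 ?(ltW k0)// sumr_ge0.
rewrite mulf_eq0 (gt_eqF k0)/= => /andP[_]; rewrite psumr_eq0// => /allP h.
move/negP: v0; apply; apply/eqP/rowP => k; rewrite [RHS]mxE.
by have := h k (mem_index_enum k); rewrite mxE mulf_eq0 orbb => /eqP.
Qed.

Lemma normal_rhs x :
  N^-1 *: \sum_(i < n) \sum_(j < n | (i < j)%N) (A i j x)%:R *: Fpair w U i j x
  = score w U A ws x + gram_hat w U x *m beta_circ w ws.
Proof.
rewrite /score /gram_hat -scalemxAl -scalerDr mulmx_suml -big_split/=; congr (_ *: _).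
apply: eq_bigr => i _; rewrite mulmx_suml -big_split/=; apply: eq_bigr => j _.
rewrite -mulmxA [X in _ *m X](_ : _ = (w_circ w ws (U i x) (U j x))%:M).
  by rewrite mul_mx_scalar -scalerDl subrK.
apply/matrixP => a b; rewrite !ord1 [RHS]mxE eqxx mulr1n /w_circ /lincomb.
rewrite [LHS]mxE [RHS]mxE; apply: eq_bigr => k _; rewrite ![_^T _ _]mxE; exact: mulrC.
Qed.

Lemma beta_hat_error x : (2 <= n)%N ->
  beta_hat w U A nu tau x - beta_circ w ws =
  invmx (ridge_gram w U nu tau x) *m
    (score w U A ws x - kappa *: beta_circ w ws).
Proof.
move=> n2; rewrite /beta_hat -/N normal_rhs.
rewrite -[X in _ - X](mulKmx (ridge_gram_unit x n2)) -mulmxBr; congr (_ *m _).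
by rewrite {1}/ridge_gram mulmxDl mul_scalar_mx -/N -/kappa opprD addrA addrK.
Qed.

End estimators.

(** * Consistency of the ridge estimator *)

Section least_squares_limits.
Context {R : realType} {J : nat} (d : nat -> measure_display)
  (T : forall n, measurableType (d n)) (P : forall n, probability (T n) R).
Variables (w : 'I_J -> R -> R -> R) (ws : R -> R -> R).
Variables (U : forall n, 'I_n -> {RV (P n) >-> R})
  (A : forall n, 'I_n -> 'I_n -> {RV (P n) >-> bool}) (nu tau : R).
Hypotheses (hw : forall j, graphon (w j)) (hws : graphon ws)
  (hfree : features_free w) (nu0 : 0 < nu) (tau0 : 0 < tau)
  (hd : forall n, one_graph_design ws (@U n) (@A n)).

Let kappa n : R := nu / (@npairs R n * tau ^+ 2).

Let hk k := score_dyadic_kernel hw hws k hfree.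

Let gram_kernel k l (u v : R) := regressor w k u v * regressor w l u v - gram w k l.

(** A centred entry of the sample Gram matrix is a dyadic average without
    noise. *)
Lemma gram_dyadic_kernel k l : dyadic_kernel (fun _ _ => 0) (gram_kernel k l).
Proof.
have bp : sqbmeas (fun u v => regressor w k u v * regressor w l u v).
  by apply: bmeasM; exact: sqbmeas_regressor.
have bk : sqbmeas (gram_kernel k l) by apply: bmeasB => //; exact: bmeas_cst.
split=> //; first exact: bmeas_cst.
  by move=> u v u01 v01; rewrite /gram_kernel !(regressor_sym hw _ u01 v01).
rewrite -I2_marginal// (@RintB _ _ _ (@lebesgue2 R) _ measurable_square
  lebesgue_square_fin _ (cst (gram w k l)) bp (bmeas_cst _ _)).
rewrite Rintegral_cst; last exact: measurable_square.
by rewrite [X in fine X]lebesgue_square mulr1 gramE subrr.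
Qed.

Lemma npairs_neq0 n : (2 <= n)%N -> n%:R != 0 :> R /\ n%:R - 1 != 0 :> R.
Proof.
by move=> n2; have [n0 n1 _] := natr_pred_bounds R n2; split; rewrite gt_eqF//; lra.
Qed.

Lemma mxcvgP_gram_hat : mxcvgP P (fun n => gram_hat w (@U n)) (gram w).
Proof.
move=> k l.
have h := cvgPD (cvgP_dyad_mean hws hd (gram_dyadic_kernel k l))
  (cvgP_cst P (gram w k l)).
rewrite add0r in h; apply: (cvgP_eventually _ _ h).
  move=> n; apply: mxmeasurableZ; first exact: measurable_cst.
  apply: mxmeasurable_sum => i _; apply: mxmeasurable_sum => j _.
  by apply: mxmeasurable_mul; [|apply: mxmeasurable_tr]; exact: (mxmeasurable_Fpair hw (@hd n)).
exists 2%N => n x n2; have [n0 n1] := npairs_neq0 n2.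
rewrite /gram_hat [RHS]mxE summxE.
have e i j : (Fpair w (@U n) i j x *m (Fpair w (@U n) i j x)^T) k l =
    regressor w k (U i x) (U j x) * regressor w l (U i x) (U j x).
  by rewrite mxE big_ord1 [_^T _ _]mxE.
under [in RHS]eq_bigr do rewrite summxE.
under [in RHS]eq_bigr do under eq_bigr do rewrite e.
rewrite sum_upper; last first.
  move=> i j; have U01 := design_range (hd n).
  by rewrite !(regressor_sym hw _ (U01 i x) (U01 j x)).
have -> : dyad_total ws (@U n) (@A n) (fun _ _ => 0) (gram_kernel k l) x =
   \sum_(i < n) \sum_(j < n | j != i)
     regressor w k (U i x) (U j x) * regressor w l (U i x) (U j x)
   - n%:R * ((n%:R - 1) * gram w k l).
  rewrite /dyad_total /dyad_row.
  under eq_bigr => i _ do under eq_bigr => j _ do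
    rewrite /dyad mulr0 add0r /gram_kernel.
  under eq_bigr do rewrite sumrB sum_other_cst.
  by rewrite sumrB sumr_const card_ord [X in _ = _ - X]mulr_natl.
by rewrite /npairs; field; apply/andP.
Qed.

(** The ridge term is of order n^-2, hence negligible even after multiplication by
    sqrt n. *)
Lemma kappa_bound n : (2 <= n)%N ->
  `|Num.sqrt n%:R * kappa n - 0| <= 4 * nu / tau ^+ 2 / n%:R.
Proof.
move=> n2; have [n0 n1 nhalf] := natr_pred_bounds R n2.
have t2 : 0 < tau ^+ 2 by rewrite exprn_gt0.
have n10 : 0 < n%:R - 1 :> R by lra.
have k0 : 0 < kappa n by rewrite divr_gt0// mulr_gt0 ?npairs_gt0.
rewrite subr0 ger0_norm; last by apply: mulr_ge0; [exact: sqrtr_ge0|exact: ltW].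
have sn : Num.sqrt n%:R <= n%:R :> R.
  rewrite -[leRHS]ger0_norm ?(ltW n0)// -sqrtr_sqr ler_wsqrtr// expr2 ler_peMr//.
  by lra.
apply: (@le_trans _ _ (n%:R * kappa n)); first by rewrite ler_wpM2r// ltW.
have -> : n%:R * kappa n = 2 * nu / tau ^+ 2 / (n%:R - 1).
  by rewrite /kappa /npairs; field; rewrite !gt_eqF.
rewrite ler_pdivrMr// [leRHS]mulrAC ler_pdivlMr//.
have -> : 4 * nu / tau ^+ 2 = 2 * (2 * nu / tau ^+ 2) by ring.
have : 0 < 2 * nu / tau ^+ 2 by rewrite divr_gt0// mulr_gt0.
by set c := 2 * nu / tau ^+ 2 => c0; nra.
Qed.

Lemma cvgP_sqrt_kappa : cvgP P (fun n _ => Num.sqrt n%:R * kappa n) 0.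
Proof. exact: cvgP_rate kappa_bound. Qed.

Lemma cvgP_kappa : cvgP P (fun n _ => kappa n) 0.
Proof.
apply: (@cvgP_dominated _ _ _ _ _ (fun n _ => Num.sqrt n%:R * kappa n)).
- by move=> n; exact: measurable_cst.
- exists 2%N => n x n2; rewrite subr0 [leRHS]normrM ler_peMl//.
  have [n0 n1 _] := natr_pred_bounds R n2.
  by rewrite ger0_norm// -[leLHS]sqrtr1 ler_wsqrtr//; lra.
- exact: cvgP_sqrt_kappa.
Qed.

Lemma mxcvgP_invmx_ridge_gram :
  mxcvgP P (fun n x => invmx (ridge_gram w (@U n) nu tau x)) (invmx (gram w)).
Proof.
apply: mxcvgP_inv; [|exact: gram_unit|].
  by exists 2%N => n x n2; exact: ridge_gram_unit.
move=> k l; rewrite -[gram w k l]addr0 -[X in _ + X](mul0r (k == l)%:R).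
apply: eq_cvgP (cvgPD (mxcvgP_gram_hat k l) (cvgPM cvgP_kappa (cvgP_cst P (k == l)%:R))).
by move=> n x; rewrite [RHS]mxE [X in _ = _ + X]mxE mulr_natr.
Qed.

Lemma score_totalE n k x : (2 <= n)%N ->
  score w (@U n) (@A n) ws x k 0 = score_total w ws (@U n) (@A n) k x / (n%:R * (n%:R - 1)).
Proof.
move=> n2; have [n0 n1] := npairs_neq0 n2.
by rewrite (scoreE hw hws hfree (hd n)) /npairs; field; apply/andP.
Qed.

Lemma mxmeasurable_score n : mxmeasurable (score w (@U n) (@A n) ws).
Proof.
move=> k l; rewrite (_ : l = 0) ?ord1//.
under eq_fun do rewrite (scoreE hw hws hfree (hd n)).
do 2 apply: (measurable_funM (measurable_cst _)).
exact: (bmeas_score_total hw hws hfree (hd n) k).1.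
Qed.

Lemma mxcvgP_score : mxcvgP P (fun n => score w (@U n) (@A n) ws) 0.
Proof.
move=> k l; rewrite (_ : l = 0) ?ord1// [X in cvgP _ _ X]mxE.
apply: (cvgP_eventually _ _ (cvgP_dyad_mean hws hd (hk k))).
  by move=> n; exact: mxmeasurable_score.
by exists 2%N => n x n2; rewrite score_totalE.
Qed.

Lemma mxcvgP_beta_hat :
  mxcvgP P (fun n => beta_hat w (@U n) (@A n) nu tau) (beta_circ w ws).
Proof.
have h1 : mxcvgP P (fun n x => score w (@U n) (@A n) ws x - kappa n *: beta_circ w ws) 0.
  move=> k l; have := cvgPB (mxcvgP_score k l) (cvgPM cvgP_kappa (cvgP_cst P (beta_circ w ws k l))).
  rewrite [X in cvgP _ _ X -> _](_ : _ = (0 : 'cV[R]_J.+1) k l); last first.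
    by rewrite mul0r subr0.
  by apply: eq_cvgP => n x; rewrite [RHS]mxE [X in _ = _ + X]mxE [X in _ = _ + - X]mxE.
have h2 := mxcvgP_mul mxcvgP_invmx_ridge_gram h1.
move=> k l; have := cvgPD (h2 k l) (cvgP_cst P (beta_circ w ws k l)).
rewrite mulmx0 [X in cvgP _ _ (X + _)]mxE add0r; apply: cvgP_eventually.
  by move=> n; exact: (mxmeasurable_beta_hat nu tau hw (hd n)).
exists 2%N => n x n2.
rewrite -(beta_hat_error w ws (@U n) (@A n) nu0 tau0)//.
by rewrite mxE [X in _ + X + _]mxE subrK.
Qed.

End least_squares_limits.

(** * Limit of the robust covariance *)

Section dyadic_form.
Context {R : realType} (n : nat).
Implicit Types (X Y : 'I_n -> 'I_n -> R).

(** An entry of V_hat as a bilinear form in the arrays of residuals times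
    regressors that belong to its two indices. *)
Definition dyadic_form X Y : R := (@npairs R n ^+ 2)^-1 *
  (\sum_(i < n) (\sum_(j < n | j != i) X i j) * (\sum_(j < n | j != i) Y i j)
   - \sum_(i < n) \sum_(j < n | (i < j)%N) X i j * Y i j).

Lemma mul_perturb (a a' b b' D B : R) : `|a - b| <= D -> `|a' - b'| <= D ->
  `|b| <= B -> `|b'| <= B -> `|a * a' - b * b'| <= D * (2 * B + D).
Proof.
move=> h h' k k'.
have -> : a * a' - b * b' = (a - b) * (a' - b') + (a - b) * b' + b * (a' - b') by ring.
apply: le_trans (ler_normD _ _) _; apply: le_trans (lerD (ler_normD _ _) (lexx _)) _.
rewrite !normrM.
have h1 : `|a - b| * `|a' - b'| <= D * D by rewrite ler_pM.
have h2 : `|a - b| * `|b'| <= D * B by rewrite ler_pM.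
have h3 : `|b| * `|a' - b'| <= B * D by rewrite ler_pM.
by apply: le_trans (lerD (lerD h1 h2) h3) _; rewrite le_eqVlt; apply/orP; left; apply/eqP; ring.
Qed.

Lemma row_sum_bound X (K : R) i : (forall j, `|X i j| <= K) ->
  `|\sum_(j < n | j != i) X i j| <= (n%:R - 1) * K.
Proof.
move=> XK; rewrite -(sum_other_cst i K).
by apply: le_trans (ler_norm_sum _ _ _) _; exact: ler_sum.
Qed.

Lemma upper_sum_bound X (K : R) : (forall i j, `|X i j| <= K) ->
  `|\sum_(i < n) \sum_(j < n | (i < j)%N) X i j| <= 2^-1 * (n%:R * ((n%:R - 1) * K)).
Proof.
move=> XK; apply: (@le_trans _ _ (\sum_(i < n) \sum_(j < n | (i < j)%N) K)).
  apply: le_trans (ler_norm_sum _ _ _) _; apply: ler_sum => i _.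
  by apply: le_trans (ler_norm_sum _ _ _) _; exact: ler_sum.
rewrite (sum_upper (F := fun _ _ => K))//.
under eq_bigr do rewrite sum_other_cst.
by rewrite sumr_const card_ord -[X in _ * X <= _]mulr_natl.
Qed.

Hypothesis n2 : (2 <= n)%N.

(** The rows contribute n products of size at most (n-1)^2 D (2 B + D) and the
    diagonal correction n (n-1) / 2 products of size D (2 B + D); with the weight
    n / N^2 = 4 / (n (n-1)^2) the total is bounded uniformly in n. *)
Lemma dyadic_form_perturb X X' Y Y' (D B : R) :
  (forall i j, `|X i j - Y i j| <= D) -> (forall i j, `|X' i j - Y' i j| <= D) ->
  (forall i j, `|Y i j| <= B) -> (forall i j, `|Y' i j| <= B) ->
  `|n%:R * dyadic_form X X' - n%:R * dyadic_form Y Y'| <= 6 * (D * (2 * B + D)).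
Proof.
move=> hX hX' hY hY'; have [n0 n1 nhalf] := natr_pred_bounds R n2.
set N := (n%:R : R) in n0 n1 nhalf *; set L := D * (2 * B + D).
have n10 : 0 < N - 1 by lra.
have L0 : 0 <= L.
  have i := Ordinal (ltnW n2).
  exact: le_trans (mul_perturb (hX i i) (hX' i i) (hY i i) (hY' i i)).
pose a i := (\sum_(j < n | j != i) X i j) * (\sum_(j < n | j != i) X' i j)
  - (\sum_(j < n | j != i) Y i j) * (\sum_(j < n | j != i) Y' i j).
pose b i j := X i j * X' i j - Y i j * Y' i j.
have -> : N * dyadic_form X X' - N * dyadic_form Y Y' =
    N * (@npairs R n ^+ 2)^-1 *
      (\sum_(i < n) a i - \sum_(i < n) \sum_(j < n | (i < j)%N) b i j).
  have -> : \sum_(i < n) \sum_(j < n | (i < j)%N) b i j =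
      \sum_(i < n) \sum_(j < n | (i < j)%N) X i j * X' i j
      - \sum_(i < n) \sum_(j < n | (i < j)%N) Y i j * Y' i j.
    by rewrite -sumrB; apply: eq_bigr => i _; rewrite sumrB.
  by rewrite /dyadic_form /a sumrB; ring.
have ha : `|\sum_(i < n) a i| <= N * ((N - 1) ^+ 2 * L).
  apply: le_trans (ler_norm_sum _ _ _) _.
  have -> : N * ((N - 1) ^+ 2 * L) = \sum_(i < n) (N - 1) ^+ 2 * L.
    by rewrite sumr_const card_ord -[RHS]mulr_natl.
  apply: ler_sum => i _.
  apply: (@le_trans _ _ (((N - 1) * D) * (2 * ((N - 1) * B) + (N - 1) * D))).
    apply: mul_perturb; rewrite -?sumrB.
    - exact: (row_sum_bound (X := fun i j => X i j - Y i j)).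
    - exact: (row_sum_bound (X := fun i j => X' i j - Y' i j)).
    - exact: row_sum_bound.
    - exact: row_sum_bound.
  by rewrite le_eqVlt /L; apply/orP; left; apply/eqP; ring.
have hb : `|\sum_(i < n) \sum_(j < n | (i < j)%N) b i j| <= 2^-1 * (N * ((N - 1) * L)).
  by apply: upper_sum_bound => i j; exact: mul_perturb.
rewrite normrM ger0_norm; last by rewrite mulr_ge0 ?(ltW n0)// invr_ge0 sqr_ge0.
apply: (@le_trans _ _ (N * (npairs n ^+ 2)^-1 *
   (N * ((N - 1) ^+ 2 * L) + 2^-1 * (N * ((N - 1) * L))))).
  rewrite ler_wpM2l//; first by rewrite mulr_ge0 ?(ltW n0)// invr_ge0 sqr_ge0.
  by apply: le_trans (ler_normB _ _) _; exact: lerD.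
have -> : N * (npairs n ^+ 2)^-1 *
   (N * ((N - 1) ^+ 2 * L) + 2^-1 * (N * ((N - 1) * L))) = (4 + 2 / (N - 1)) * L.
  by rewrite /npairs -/N; field; rewrite !gt_eqF.
rewrite ler_wpM2r// -lerBrDl ler_pdivrMr//; lra.
Qed.

Lemma mean_sq (z : 'I_n -> R) :
  (n%:R^-1 * \sum_(i < n) z i) ^+ 2 <= n%:R^-1 * \sum_(i < n) z i ^+ 2.
Proof.
have [n0 _ _] := natr_pred_bounds R n2; set N := (n%:R : R) in n0 *.
set s := \sum_(i < n) z i; set q := \sum_(i < n) _.
have : 0 <= \sum_(i < n) (z i - N^-1 * s) ^+ 2 by apply: sumr_ge0 => i _; exact: sqr_ge0.
have -> : \sum_(i < n) (z i - N^-1 * s) ^+ 2 = q - N^-1 * s ^+ 2.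
  have e i : (z i - N^-1 * s) ^+ 2 = z i ^+ 2 - (2 * (N^-1 * s)) * z i + (N^-1 * s) ^+ 2 by ring.
  under eq_bigr do rewrite e.
  rewrite big_split/= sumrB -mulr_sumr sumr_const card_ord -[X in _ + X]mulr_natl -/N -/s -/q.
  by field; rewrite gt_eqF.
rewrite subr_ge0 exprMn expr2 -mulrA => h.
by rewrite ler_pM2l ?invr_gt0.
Qed.

End dyadic_form.

Section row_products.
Context {R : realType} (d : nat -> measure_display)
  (T : forall n, measurableType (d n)) (P : forall n, probability (T n) R).
Variables (ws : R -> R -> R) (U : forall n, 'I_n -> {RV (P n) >-> R})
  (A : forall n, 'I_n -> 'I_n -> {RV (P n) >-> bool}).
Hypotheses (hws : graphon ws)
  (hd : forall n, one_graph_design ws (@U n) (@A n)).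

Lemma dyad_bound phi m : dyadic_kernel phi m -> exists2 K : R, 0 < K &
  forall n i j x, `|dyad ws (@U n) (@A n) phi m i j x| <= K.
Proof.
move=> hk; have [K1 K10 h1] := bmeas_bound (kernel_phi hk).
have [K2 K20 h2] := bmeas_bound (kernel_m hk).
exists (K1 + K2); first by rewrite addr_gt0.
move=> n i j x; have U01 := design_range (hd n).
have UU : unit_square (U i x, U j x) by split; exact: U01.
apply: le_trans (ler_normD _ _) _; rewrite lerD ?(h2 _ UU)// normrM.
rewrite -[leRHS]mul1r ler_pM// ?(h1 _ UU)// /noise.
have /andP[w0 w1] := graphon_range hws (U01 i x) (U01 j x).
by case: (A i j x); rewrite ?mulr1n ?mulr0n ler_norml; apply/andP; split; lra.
Qed.

Variables (phi m phi' m' : R -> R -> R).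
Hypotheses (hk : dyadic_kernel phi m) (hk' : dyadic_kernel phi' m').

Let a n i x := dyad_row ws (@U n) (@A n) phi m i x / (n%:R - 1).
Let a' n i x := dyad_row ws (@U n) (@A n) phi' m' i x / (n%:R - 1).
Let g n i x := marginal m (@U n i x).
Let g' n i x := marginal m' (@U n i x).

Let row_bound phi0 m0 : dyadic_kernel phi0 m0 -> exists2 K : R, 0 < K &
  forall n i x, (2 <= n)%N ->
   `|dyad_row ws (@U n) (@A n) phi0 m0 i x / (n%:R - 1)| <= K /\
   `|marginal m0 (@U n i x)| <= K.
Proof.
move=> h0; have [K K0 hK] := dyad_bound h0.
have [K' K'0 hK'] := bmeas_bound (bmeas_marginal (kernel_m h0)).
exists (K + K'); first by rewrite addr_gt0.
move=> n i x n2; have [n0 n1 _] := natr_pred_bounds R n2.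
have n10 : 0 < n%:R - 1 :> R by lra.
split; last first.
  by rewrite (le_trans (hK' _ (design_range (hd n) i x)))// lerDr ltW.
rewrite normrM normfV (ger0_norm (ltW n10)) ler_pdivrMr//.
have h := row_sum_bound
  (X := fun i j => dyad ws (@U n) (@A n) phi0 m0 i j x) (fun j => hK n i j x).
by apply: le_trans h _; rewrite mulrC ler_wpM2r ?(ltW n10)// lerDl ltW.
Qed.

(** In L2 the normalised rows are close to their projections, whose products are
    independent and obey the law of large numbers. *)
Lemma cvgP_row_product :
  cvgP P (fun n x => n%:R^-1 * \sum_(i < n) a i x * a' i x) (marginal_cov m m').
Proof.
have [K K0 hK] := row_bound hk; have [K' K'0 hK'] := row_bound hk'.
have br n i : bmeas setT (@a n i).
  by apply: bmeasM; [exact: (bmeas_dyad_row hws (hd n) _ hk)|exact: bmeas_cst].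
have br' n i : bmeas setT (@a' n i).
  by apply: bmeasM; [exact: (bmeas_dyad_row hws (hd n) _ hk')|exact: bmeas_cst].
have bg n i : bmeas setT (@g n i).
  exact: (bmeas_coord (hd n) i (bmeas_marginal (kernel_m hk))).
have bg' n i : bmeas setT (@g' n i).
  exact: (bmeas_coord (hd n) i (bmeas_marginal (kernel_m hk'))).
have PT n : (P n setT < +oo)%E by rewrite probability_setT ltry.
pose e n (i : 'I_n) x := a i x * a' i x - g i x * g' i x.
pose q n (i : 'I_n) x := 2 * K' ^+ 2 * (a i x - g i x) ^+ 2
  + 2 * K ^+ 2 * (a' i x - g' i x) ^+ 2.
have be n i : bmeas setT (@e n i).
  by apply: bmeasB; apply: bmeasM; [exact: br|exact: br'|exact: bg|exact: bg'].
have bp n i : bmeas setT (fun x => (@a n i x - g i x) ^+ 2).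
  by apply: bmeasX; apply: bmeasB; [exact: br|exact: bg].
have bp' n i : bmeas setT (fun x => (@a' n i x - g' i x) ^+ 2).
  by apply: bmeasX; apply: bmeasB; [exact: br'|exact: bg'].
have bq n i : bmeas setT (@q n i) by apply: bmeasD; exact: bmeasZ.
have eq_le n i x : (2 <= n)%N -> @e n i x ^+ 2 <= q n i x.
  move=> n2; have [h1 h2] := hK n i x n2; have [h3 h4] := hK' n i x n2.
  rewrite -/(a i x) -/(g i x) in h1 h2; rewrite -/(a' i x) -/(g' i x) in h3 h4.
  have -> : e n i x = (a i x - g i x) * a' i x + g i x * (a' i x - g' i x).
    by rewrite /e; ring.
  have s1 : a' i x ^+ 2 <= K' ^+ 2.
    by rewrite -real_normK ?num_real// ler_pXn2r ?nnegrE// ltW.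
  have s2 : g i x ^+ 2 <= K ^+ 2.
    by rewrite -real_normK ?num_real// ler_pXn2r ?nnegrE// ltW.
  have t1 : (a i x - g i x) ^+ 2 * a' i x ^+ 2 <= (a i x - g i x) ^+ 2 * K' ^+ 2.
    by rewrite ler_wpM2l ?sqr_ge0.
  have t2 : g i x ^+ 2 * (a' i x - g' i x) ^+ 2 <= K ^+ 2 * (a' i x - g' i x) ^+ 2.
    by rewrite ler_wpM2r ?sqr_ge0.
  have := sqr_ge0 ((a i x - g i x) * a' i x - g i x * (a' i x - g' i x)).
  rewrite /q; set p1 := a i x - g i x in t1 *; set p2 := a' i x - g' i x in t2 *.
  rewrite -exprMn in t1; rewrite -exprMn in t2.
  rewrite (_ : (p1 * a' i x + g i x * p2) ^+ 2 = 2 * (p1 * a' i x) ^+ 2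
    + 2 * (g i x * p2) ^+ 2 - (p1 * a' i x - g i x * p2) ^+ 2); last by ring.
  by move=> t3; lra.
pose C := 2 * K' ^+ 2 * rate_cst ws phi m + 2 * K ^+ 2 * rate_cst ws phi' m'.
have h0 : cvgP P (fun n x => n%:R^-1 * \sum_(i < n) @e n i x) 0.
  apply: (cvgP_L2 (C := C)) => [n|n n2].
    by apply: bmeasZ; apply: bmeas_sum => i _.
  have [n0 n1 _] := natr_pred_bounds R n2.
  apply: (@le_trans _ _ (\int[P n]_x (n%:R^-1 * \sum_(i < n) q n i x))).
    apply: (le_Rint measurableT (PT n)).
    - apply: bmeasX; apply: bmeasB; last exact: bmeas_cst.
      by apply: bmeasZ; apply: bmeas_sum => i _.
    - by apply: bmeasZ; apply: bmeas_sum => i _.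
    move=> x _; rewrite subr0; apply: le_trans (mean_sq n2 _) _.
    by rewrite ler_pM2l ?invr_gt0//; apply: ler_sum => i _; exact: eq_le.
  rewrite (RintZ measurableT (PT n)); last by apply: bmeas_sum => i _.
  rewrite (Rint_sum measurableT (PT n))// ler_pdivrMl//.
  have -> : n%:R * (C / n%:R) = \sum_(i < n) C / n%:R.
    by rewrite sumr_const card_ord -[RHS]mulr_natl.
  apply: ler_sum => i _.
  rewrite /q (RintD measurableT (PT n)); [|exact: bmeasZ..].
  rewrite !(RintZ measurableT (PT n))//.
  rewrite /C [leRHS]mulrDl; apply: lerD; rewrite -[leRHS]mulrA; apply: ler_wpM2l.
  - by rewrite mulr_ge0// sqr_ge0.
  - exact: (row_rate hws (hd n) n2 hk i).
  - by rewrite mulr_ge0// sqr_ge0.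
  - exact: (row_rate hws (hd n) n2 hk' i).
have h1 := cvgP_coord_mean hd (bmeas_marginal_cov hk hk').
have := cvgPD h0 h1; rewrite add0r; apply: eq_cvgP => n x.
by rewrite -mulrDr /coord_total -big_split/=; congr (_ * _); apply: eq_bigr => i _;
  rewrite /e subrK.
Qed.

(** Up to the factor 4 the rows are averaged as in [cvgP_row_product]; the
    correction consists of O(n^2) bounded terms of weight O(n^-3). *)
Lemma cvgP_dyadic_form : cvgP P (fun n x => n%:R * dyadic_form
  (fun i j => dyad ws (@U n) (@A n) phi m i j x)
  (fun i j => dyad ws (@U n) (@A n) phi' m' i j x)) (4 * marginal_cov m m').
Proof.
have [K K0 hK] := dyad_bound hk; have [K' K'0 hK'] := dyad_bound hk'.
pose D n x := \sum_(i < n) \sum_(j < n | (i < j)%N)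
  dyad ws (@U n) (@A n) phi m i j x * dyad ws (@U n) (@A n) phi' m' i j x.
have bD n : bmeas setT (@D n).
  apply: bmeas_sum => i _; apply: bmeas_sum => j _.
  by apply: bmeasM; [exact: (bmeas_dyad hws (hd n) hk)|exact: (bmeas_dyad hws (hd n) hk')].
have h0 : cvgP P (fun n x => - (n%:R * (@npairs R n ^+ 2)^-1 * D n x)) 0.
  apply: (@cvgP_dominated _ _ _ _ _ (fun n _ => 4 * (K * K') / n%:R)).
  - move=> n; apply: measurableT_comp => //.
    by apply: measurable_funM; [exact: measurable_cst|exact: (bD n).1].
  - exists 2%N => n x n2; have [n0 n1 nhalf] := natr_pred_bounds R n2.
    have KK : 0 < K * K' by rewrite mulr_gt0.
    have n10 : 0 < n%:R - 1 :> R by lra.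
    rewrite subr0 normrN (ger0_norm (divr_ge0 _ _)) ?(ltW n0)//; last first.
      by rewrite mulr_ge0// ltW.
    rewrite normrM ger0_norm; last by rewrite mulr_ge0 ?(ltW n0)// invr_ge0 sqr_ge0.
    have hD : `|D n x| <= 2^-1 * (n%:R * ((n%:R - 1) * (K * K'))).
      by apply: upper_sum_bound => i j; rewrite normrM ler_pM.
    apply: (@le_trans _ _ (n%:R * (npairs n ^+ 2)^-1 *
       (2^-1 * (n%:R * ((n%:R - 1) * (K * K')))))).
      by rewrite ler_wpM2l// mulr_ge0 ?(ltW n0)// invr_ge0 sqr_ge0.
    have -> : n%:R * (npairs n ^+ 2)^-1 * (2^-1 * (n%:R * ((n%:R - 1) * (K * K'))))
       = 2 * (K * K') / (n%:R - 1).
      by rewrite /npairs; field; rewrite !gt_eqF.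
    rewrite ler_pdivrMr// [leRHS]mulrAC ler_pdivlMr//.
    set c := K * K' in KK *; nra.
  - apply: (@cvgP_rate _ _ _ _ _ _ (4 * (K * K'))) => n n2; rewrite subr0 ger0_norm//.
    by rewrite divr_ge0// mulr_ge0// mulr_ge0// ltW.
have := cvgPD (cvgPZ 4 cvgP_row_product) h0; rewrite addr0; apply: cvgP_eventually.
  move=> n; apply: measurable_funM; first exact: measurable_cst.
  apply: measurable_funM; first exact: measurable_cst.
  apply: measurable_funB; last exact: (bD n).1.
  have : bmeas setT (fun x => \sum_(i < n) dyad_row ws (@U n) (@A n) phi m i x
      * dyad_row ws (@U n) (@A n) phi' m' i x).
    apply: bmeas_sum => i _; apply: bmeasM.
      exact: (bmeas_dyad_row hws (hd n) _ hk).
    exact: (bmeas_dyad_row hws (hd n) _ hk').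
  by case.
exists 2%N => n x n2; have [n0 n1 nhalf] := natr_pred_bounds R n2.
have n10 : 0 < n%:R - 1 :> R by lra.
have -> : \sum_(i < n) a i x * a' i x = (n%:R - 1) ^- 2 *
   \sum_(i < n) dyad_row ws (@U n) (@A n) phi m i x
      * dyad_row ws (@U n) (@A n) phi' m' i x.
  rewrite mulr_sumr; apply: eq_bigr => i _; rewrite /a /a'.
  by field; rewrite gt_eqF.
rewrite /dyadic_form -/(D n x) /dyad_row.
set s := \sum_(i < n) _ * _; rewrite /npairs.
by field; rewrite !gt_eqF.
Qed.

End row_products.

Section robust_covariance_limit.
Context {R : realType} {J : nat} (d : nat -> measure_display)
  (T : forall n, measurableType (d n)) (P : forall n, probability (T n) R).
Variables (w : 'I_J -> R -> R -> R) (ws : R -> R -> R).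
Variables (U : forall n, 'I_n -> {RV (P n) >-> R})
  (A : forall n, 'I_n -> 'I_n -> {RV (P n) >-> bool}) (nu tau : R).
Hypotheses (hw : forall j, graphon (w j)) (hws : graphon ws)
  (hfree : features_free w) (nu0 : 0 < nu) (tau0 : 0 < tau)
  (hd : forall n, one_graph_design ws (@U n) (@A n)).

Let hk k := score_dyadic_kernel hw hws k hfree.

Let summand n (b : 'cV[R]_J.+1) k x (i j : 'I_n) : R :=
  residual w (@U n) (@A n) b i j x * Fpair w (@U n) i j x k 0.

Lemma V_hat_form n b k l x : V_hat w (@U n) (@A n) b x k l =
  dyadic_form (summand b k x) (summand b l x).
Proof.
have rE h i : row_score w (@U n) (@A n) b i x h 0 =
    \sum_(j < n | j != i) summand b h x i j.
  by rewrite /row_score summxE; apply: eq_bigr => j _; rewrite mxE.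
rewrite /V_hat mxE; congr (_ * _); rewrite !mxE !summxE; congr (_ - _).
  by apply: eq_bigr => i _; rewrite mxE big_ord1 [_^T _ _]mxE !rE.
apply: eq_bigr => i _; rewrite summxE; apply: eq_bigr => j _.
by rewrite mxE mxE big_ord1 [_^T _ _]mxE /summand; ring.
Qed.

Lemma cvgP_V_hat_circ k l : cvgP P (fun n x =>
  n%:R * V_hat w (@U n) (@A n) (beta_circ w ws) x k l) (4 * Sigma_g w ws k l).
Proof.
rewrite Sigma_gE; apply: eq_cvgP (cvgP_dyadic_form hws hd (hk k) (hk l)) => n x.
rewrite V_hat_form; congr (_ * dyadic_form _ _); apply/funext => i;
  apply/funext => j; by rewrite /summand residual_dyad.
Qed.

Let dist n x := \sum_(k < J.+1)
  `|beta_hat w (@U n) (@A n) nu tau x k 0 - beta_circ w ws k 0|.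

Lemma cvgP_dist : cvgP P dist 0.
Proof.
rewrite -[0](@big1_eq R 0 +%R _ (index_enum 'I_J.+1) xpredT).
apply: (@cvgP_sum _ _ _ _ _ _ _ (fun k n x =>
  `|beta_hat w (@U n) (@A n) nu tau x k 0 - beta_circ w ws k 0|)) => k _.
have h := mxcvgP_beta_hat hw hws hfree nu0 tau0 hd k 0.
have := cvgPB h (cvgP_cst P (beta_circ w ws k 0)); rewrite subrr.
apply: cvgP_dominated; last by exists 0%N => n x _; rewrite subr0 normr_id.
move=> n; apply: measurableT_comp => //.
by apply: measurable_funB; [exact: h.1|exact: measurable_cst].
Qed.

Let Fpair_le1 n (i j : 'I_n) x k : `|Fpair w (@U n) i j x k 0| <= 1.
Proof.
rewrite FpairE regressorE; case: (unlift ord0 k) => [h|]/=; last by rewrite normr1.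
have U01 := design_range (hd n).
have /andP[w0 w1] := graphon_range (hw h) (U01 i x) (U01 j x).
by rewrite ger0_norm.
Qed.

Let summand_perturb n (i j : 'I_n) k x :
  `|summand (beta_hat w (@U n) (@A n) nu tau x) k x i j
    - summand (beta_circ w ws) k x i j| <= dist x.
Proof.
rewrite /summand -mulrBl normrM -[leRHS]mulr1 ler_pM// /residual.
set b := beta_hat _ _ _ _ _ _.
rewrite opprB addrC addrA subrK !mxE -sumrB; apply: le_trans (ler_norm_sum _ _ _) _.
apply: ler_sum => h _; rewrite [b^T _ _]mxE [_^T _ _]mxE -mulrBl normrM distrC.
by rewrite -[leRHS]mulr1 ler_wpM2l.
Qed.

(** The residuals at beta_hat and beta_circ differ by at most the distance of the
    two parameters, as the features are bounded by one. *)
Lemma cvgP_V_hat k l : cvgP P (fun n x =>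
    n%:R * V_hat w (@U n) (@A n) (beta_hat w (@U n) (@A n) nu tau x) x k l)
  (4 * Sigma_g w ws k l).
Proof.
have [K K0 hK] := dyad_bound hws hd (hk k).
have [K' K'0 hK'] := dyad_bound hws hd (hk l).
pose B := K + K'.
have hB n (i j : 'I_n) x : `|summand (beta_circ w ws) k x i j| <= B /\
    `|summand (beta_circ w ws) l x i j| <= B.
  rewrite /summand !residual_dyad; split.
    by apply: le_trans (hK n i j x) _; rewrite lerDl ltW.
  by apply: le_trans (hK' n i j x) _; rewrite lerDr ltW.
have mV n (b : T n -> 'cV[R]_J.+1) : mxmeasurable b ->
    measurable_fun setT (fun x => n%:R * V_hat w (@U n) (@A n) (b x) x k l).
  move=> mb; apply: measurable_funM; first exact: measurable_cst.
  exact: (mxmeasurable_V_hat hw (hd n) mb).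
have mb n : mxmeasurable (beta_hat w (@U n) (@A n) nu tau).
  exact: (mxmeasurable_beta_hat nu tau hw (hd n)).
have h : cvgP P (fun n x =>
    n%:R * V_hat w (@U n) (@A n) (beta_hat w (@U n) (@A n) nu tau x) x k l
    - n%:R * V_hat w (@U n) (@A n) (beta_circ w ws) x k l) 0.
  apply: (@cvgP_dominated _ _ _ _ _ (fun n x => 6 * (dist x * (2 * B + dist x)))).
  - move=> n; apply: measurable_funB; apply: mV => //; exact: mxmeasurable_cst.
  - exists 2%N => n x n2; rewrite subr0 !V_hat_form.
    apply: le_trans _ (ler_norm _); apply: (dyadic_form_perturb n2) => // i j.
      by have [] := hB n i j x.
    by have [] := hB n i j x.
  - have := cvgPZ 6 (cvgPM cvgP_dist (cvgPD (cvgP_cst P (2 * B)) cvgP_dist)).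
    by rewrite mul0r mulr0.
have := cvgPD h (cvgP_V_hat_circ k l); rewrite add0r.
by apply: eq_cvgP => n x; rewrite subrK.
Qed.

End robust_covariance_limit.

(** * Studentisation and coverage *)

Section normal_quantile.
Context {R : realType}.

(** The infimum that defines the quantile is attained with equality because Phi is
    monotone and continuous. *)
Lemma Phi_quantile (p : R) : 0 < p < 1 ->
  Phi (quantile (normal_prob (0 : R) 1) p) = p.
Proof.
move=> /andP[p0 p1]; pose S := [set r : R | p <= Phi r].
have -> : quantile (normal_prob (0 : R) 1) p = inf S.
  congr inf; apply/seteqP; split => r /=; by rewrite PhiE lee_fin.
have hS : has_inf S.
  split.
    have q0 : 0 < 1 - p by lra.
    have [X hX] := Phi_limits q0; exists X; rewrite /S /=.
    by have [h _] := hX X (lexx _); lra.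
  have p2 : 0 < p / 2 by rewrite divr_gt0.
  have [X hX] := Phi_limits p2; exists (- X) => r; rewrite /S /= => Sr.
  rewrite leNgt; apply/negP => /ltW rX.
  have [_ h] := hX X (lexx _); have := Phi_ndecr rX; lra.
apply/eqP; rewrite eq_le; apply/andP; split; rewrite leNgt; apply/negP => h.
  have e0 : 0 < (Phi (inf S) - p) / 2 by lra.
  have [r r0 hr] := Phi_close e0.
  have : `|Phi (inf S - r) - Phi (inf S)| <= (Phi (inf S) - p) / 2.
    by apply: hr; rewrite addrAC subrr add0r normrN ger0_norm// ltW.
  rewrite ler_norml => /andP[h1 _].
  have /(ge_inf hS.2) : S (inf S - r) by rewrite /S /=; lra.
  by lra.
have e0 : 0 < (p - Phi (inf S)) / 2 by lra.
have [r r0 hr] := Phi_close e0.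
have : `|Phi (inf S + r) - Phi (inf S)| <= (p - Phi (inf S)) / 2.
  by apply: hr; rewrite addrAC subrr add0r ger0_norm// ltW.
rewrite ler_norml => /andP[_ h1].
have : inf S + r <= inf S.
  apply: lb_le_inf; first exact: hS.1.
  move=> t; rewrite /S /= => St; rewrite leNgt; apply/negP => /ltW tr.
  by have := Phi_ndecr tr; lra.
by lra.
Qed.

Lemma quantile_ge0 (p : R) : 2^-1 < p < 1 ->
  0 <= quantile (normal_prob (0 : R) 1) p.
Proof.
move=> /andP[p2 p1]; have hp : 0 < p < 1 by apply/andP; split; lra.
rewrite leNgt; apply/negP => z0.
set z := quantile _ _ in z0.
have zz : z <= - z by lra.
have := Phi_ndecr zz; rewrite Phi_symm (Phi_quantile hp); lra.
Qed.

End normal_quantile.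

Section studentization.
Context {R : realType} {J : nat} (d : nat -> measure_display)
  (T : forall n, measurableType (d n)) (P : forall n, probability (T n) R).
Variables (w : 'I_J -> R -> R -> R) (ws : R -> R -> R).
Variables (U : forall n, 'I_n -> {RV (P n) >-> R})
  (A : forall n, 'I_n -> 'I_n -> {RV (P n) >-> bool}) (nu tau : R).
Hypotheses (hw : forall j, graphon (w j)) (hws : graphon ws)
  (hfree : features_free w) (nu0 : 0 < nu) (tau0 : 0 < tau)
  (hd : forall n, one_graph_design ws (@U n) (@A n)).
Variable l : 'cV[R]_J.+1.

Let hk k := score_dyadic_kernel hw hws k hfree.

Let v := (l^T *m invmx (gram w) *m Sigma_g w ws *m invmx (gram w) *m l) 0 0.
Hypothesis v0 : 0 < v.

Let s := Num.sqrt v.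
Let s0 : 0 < s. Proof. by rewrite sqrtr_gt0. Qed.

Let c k := (l^T *m invmx (gram w)) 0 k.

Let y u := \sum_k c k * marginal (score_kernel w ws k) u.

Let bg k : bmeas01 (marginal (score_kernel w ws k)).
Proof. exact: bmeas_marginal (kernel_m (hk k)). Qed.

Let by_ : bmeas01 y.
Proof. by apply: bmeas_sum => k _; exact/bmeasZ/bg. Qed.

Let y0 : I1 y = 0.
Proof.
rewrite (@Rint_sum _ _ _ (@lebesgue_measure R) _ measurable01 lebesgue01_fin); last by move=> k _; exact/bmeasZ/bg.
rewrite big1// => k _; rewrite (@RintZ _ _ _ (@lebesgue_measure R) _ measurable01 lebesgue01_fin _ _ (bg k)).
by rewrite (kernel_centred (hk k)) mulr0.
Qed.

Let ys : I1 (fun u => y u ^+ 2) = s ^+ 2.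
Proof.
rewrite sqr_sqrtr ?(ltW v0)//.
have e u : y u ^+ 2 = \sum_k \sum_h (c k * c h) *
    (marginal (score_kernel w ws k) u * marginal (score_kernel w ws h) u).
  rewrite expr2 {1}/y mulr_suml; apply: eq_bigr => k _.
  by rewrite /y mulr_sumr; apply: eq_bigr => h _; ring.
under eq_Rintegral do rewrite e.
have b k h : bmeas01 (fun u => (c k * c h) *
    (marginal (score_kernel w ws k) u * marginal (score_kernel w ws h) u)).
  by apply: bmeasZ; apply: bmeasM; exact: bg.
rewrite (@Rint_sum _ _ _ (@lebesgue_measure R) _ measurable01 lebesgue01_fin); last first.
  by move=> k _; apply: bmeas_sum => h _; exact: b.
have -> : v = \sum_k \sum_h c k * c h * Sigma_g w ws k h.
  have ch h : c h = (invmx (gram w) *m l) h 0.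
    by rewrite /c -[invmx (gram w) in LHS]trmxK trmx_inv gramT -trmx_mul mxE.
  rewrite /v -mulmxA mxE exchange_big/=; apply: eq_bigr => h _.
  rewrite -ch mxE mulr_suml; apply: eq_bigr => k _; rewrite -/(c k); ring.
apply: eq_bigr => k _.
rewrite (@Rint_sum _ _ _ (@lebesgue_measure R) _ measurable01 lebesgue01_fin); last by move=> h _; exact: b.
apply: eq_bigr => h _.
rewrite (@RintZ _ _ _ (@lebesgue_measure R) _ measurable01 lebesgue01_fin); last by apply: bmeasM; exact: bg.
by rewrite Sigma_gE.
Qed.

Let W n x : R := standardized y s (@U n) x.

Arguments W : clear implicits.

Let t k n x := score_total w ws (@U n) (@A n) k x / (n%:R * (n%:R - 1)).

Let a k n x := (l^T *m invmx (ridge_gram w (@U n) nu tau x)) 0 k.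

Lemma cvgP_direction k : cvgP P (a k) (c k).
Proof.
exact: (mxcvgP_mul (mxcvgP_cst P l^T)
  (mxcvgP_invmx_ridge_gram hw hws hfree nu0 tau0 hd) 0 k).
Qed.

Let D n x := Num.sqrt n%:R *
  (l^T *m (beta_hat w (@U n) (@A n) nu tau x - beta_circ w ws)) 0 0.

(** With a = l^T A^-1 and c = l^T G^-1, each coordinate of the error splits into
    (a_k - c_k) sqrt n S_k, which is o(1) times an L2-bounded sequence, the
    projection error c_k sqrt n (S_k - (2/n) sum_i g_k(U_i)), and the ridge bias
    a_k beta_k sqrt n kappa. *)
Lemma cvgP_linearization : cvgP P (fun n x => D x - 2 * s * W n x) 0.
Proof.
pose z k n x := (Num.sqrt n%:R * t k x) * (a k x - c k)
  + c k * (Num.sqrt n%:R * (t k x - 2 / n%:R *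
            coord_total (@U n) (marginal (score_kernel w ws k)) x))
  - a k x * beta_circ w ws k 0 * (Num.sqrt n%:R * (nu / (@npairs R n * tau ^+ 2))).
have hz k : cvgP P (z k) 0.
  have bt n : bmeas setT (fun x : T n => Num.sqrt n%:R * t k x).
    apply: bmeasZ; apply: bmeasM; last exact: bmeas_cst.
    exact: (bmeas_score_total hw hws hfree (hd n)).
  have h1 : cvgP P (fun n x => (Num.sqrt n%:R * t k x) * (a k x - c k)) 0.
    apply: (cvgPM_L2 (C := rate_cst ws (regressor w k) (score_kernel w ws k)) bt).
      exists 2%N => n n2; have [n0 n1 _] := natr_pred_bounds R n2.
      have PT : (P n setT < +oo)%E by rewrite probability_setT ltry.
      have e x : (Num.sqrt n%:R * @t k n x) ^+ 2 = n%:R * @t k n x ^+ 2.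
        by rewrite exprMn sqr_sqrtr// ltW.
      under eq_Rintegral do rewrite e.
      rewrite (RintZ measurableT PT); last first.
        apply: bmeasX; apply: bmeasM; last exact: bmeas_cst.
        exact: (bmeas_score_total hw hws hfree (hd n)).
      rewrite -ler_pdivlMl// mulrC.
      exact: (dyad_total_rate hws (hd n) n2 (hk k)).
    by have := cvgPB (cvgP_direction k) (cvgP_cst P (c k)); rewrite subrr.
  have h2 := cvgPZ (c k) (cvgP_hajek hws hd (hk k)).
  have h3 := cvgPM (cvgPM (cvgP_direction k) (cvgP_cst P (beta_circ w ws k 0)))
    (cvgP_sqrt_kappa P nu0 tau0).
  have := cvgPB (cvgPD h1 h2) h3.
  by rewrite !mulr0 addr0 subr0.
have := @cvgP_sum _ _ _ _ _ (index_enum 'I_J.+1) xpredT z (fun=> 0) (fun k _ => hz k).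
rewrite big1//; apply: cvgP_eventually.
  move=> n; apply: measurable_funB.
    apply: measurable_funM; first exact: measurable_cst.
    exact: (measurable_beta_hat_dir nu tau hw (hd n)).
  apply: measurable_funM; first exact: measurable_cst.
  exact: (bmeas_standardized s by_ (hd n)).1.
exists 2%N => n x n2; have [n0 n1 _] := natr_pred_bounds R n2.
rewrite /D (beta_hat_error w ws (@U n) (@A n) nu0 tau0)// mulmxA [X in _ * X - _]mxE.
have -> : 2 * s * W n x = \sum_k c k * (Num.sqrt n%:R * (2 / n%:R) *
    coord_total (@U n) (marginal (score_kernel w ws k)) x).
  have -> : W n x = (s * Num.sqrt n%:R)^-1 * \sum_k c k *
      coord_total (@U n) (marginal (score_kernel w ws k)) x.
    rewrite /W /standardized; congr (_ * _).
    rewrite /coord_total /y exchange_big/=; apply: eq_bigr => k _.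
    by rewrite mulr_sumr.
  rewrite !mulr_sumr; apply: eq_bigr => k _.
  have sn : Num.sqrt n%:R != 0 :> R by rewrite sqrtr_eq0 -ltNge.
  have en : n%:R = Num.sqrt n%:R ^+ 2 :> R by rewrite sqr_sqrtr// ltW.
  set r := Num.sqrt n%:R in sn en *; rewrite en.
  by field; rewrite sn gt_eqF.
rewrite mulr_sumr -sumrB; apply: eq_bigr => k _.
rewrite [X in _ * (_ * X) - _]mxE [X in _ * (_ * (_ + X)) - _]mxE.
rewrite [X in _ * (_ * (_ + - X)) - _]mxE (score_totalE hw hws hfree hd)//.
rewrite /z /t -/(a k x); ring.
Qed.

Lemma cvgP_std_err : cvgP P
  (fun n x => Num.sqrt n%:R * std_err w (@U n) (@A n) nu tau l x) (2 * s).
Proof.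
pose nV n x := n%:R *: V_hat w (@U n) (@A n) (beta_hat w (@U n) (@A n) nu tau x) x.
have hV : mxcvgP P nV (4 *: Sigma_g w ws).
  move=> k h; rewrite [X in cvgP _ _ X]mxE; apply: eq_cvgP (cvgP_V_hat hw hws hfree nu0 tau0 hd k h).
  by move=> n x; rewrite [RHS]mxE.
have hA := mxcvgP_invmx_ridge_gram hw hws hfree nu0 tau0 hd.
have hl := mxcvgP_cst P l; have hlT := mxcvgP_cst P l^T.
have := mxcvgP_mul (mxcvgP_mul (mxcvgP_mul (mxcvgP_mul hlT hA) hV) hA) hl 0 0.
have -> : (l^T *m invmx (gram w) *m (4 *: Sigma_g w ws) *m invmx (gram w) *m l) 0 0
    = 4 * v.
  by rewrite -scalemxAr -!scalemxAl mxE.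
move=> /cvgP_max0; rewrite (max_r (_ : 0 <= 4 * v)); last by rewrite mulr_ge0// ltW.
have v4 : 0 < 4 * v by rewrite mulr_gt0.
move=> /(cvgP_sqrt v4).
have -> : Num.sqrt (4 * v) = 2 * s.
  rewrite sqrtrM//; congr (_ * _).
  by rewrite (_ : 4 = 2 ^+ 2) ?sqrtr_sqr ?ger0_norm//; ring.
apply: eq_cvgP => n x; rewrite /std_err /dir_var /Sigma_dy -sqrtrM//; congr Num.sqrt.
rewrite maxr_pMr// mulr0 /nV; congr (Num.max _ _).
by rewrite -scalemxAr -!scalemxAl mxE !mulmxA.
Qed.

(** With r the reciprocal of sqrt n times the standard error, t - W equals
    (D - 2 s W) r + 2 s W (r - 1 / (2 s)), and both terms tend to zero. *)
Lemma t_stat_normal : cvg_normal P (fun n => t_stat w (@U n) (@A n) ws nu tau l).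
Proof.
apply: (cvg_normal_slutsky (X := W)).
- exact: (clt by_ y0 s0 ys hd).
- have s2 : 2 * s != 0 by rewrite mulf_neq0// gt_eqF.
  have hr := cvgPV s2 cvgP_std_err.
  have h1 := cvgPM cvgP_linearization hr.
  have bW n : bmeas setT (fun x => 2 * s * W n x).
    by apply: bmeasZ; exact: (bmeas_standardized s by_ (hd n)).
  have h2 : cvgP P (fun n x => 2 * s * W n x *
      ((Num.sqrt n%:R * std_err w (@U n) (@A n) nu tau l x)^-1 - (2 * s)^-1)) 0.
    apply: (cvgPM_L2 (C := 4 * s ^+ 2) bW).
      exists 1%N => n n1.
      have n0 : 0 < n%:R :> R by rewrite ltr0n.
      have e x : (2 * s * W n x) ^+ 2 =
          4 / n%:R * (coord_total (@U n) y x * coord_total (@U n) y x).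
        rewrite /W /standardized.
        have sn : Num.sqrt n%:R != 0 :> R by rewrite sqrtr_eq0 -ltNge.
        have en : n%:R = Num.sqrt n%:R ^+ 2 :> R by rewrite sqr_sqrtr// ltW.
        set r := Num.sqrt n%:R in sn en *; rewrite en.
        by field; rewrite sn gt_eqF.
      have PT : (P n setT < +oo)%E by rewrite probability_setT ltry.
      have bc : bmeas setT (coord_total (@U n) y) by exact: (bmeas_coord_total (hd n)).
      under eq_Rintegral do rewrite e.
      rewrite (RintZ measurableT PT); last exact: bmeasM.
      rewrite (expectation_coord_total2 (hd n) by_ by_ y0).
      have -> : I1 (fun u => y u * y u) = s ^+ 2.
        by rewrite -ys; apply: eq_Rintegral => u _; rewrite expr2.
      by rewrite le_eqVlt; apply/orP; left; apply/eqP; field; rewrite gt_eqF.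
    by have := cvgPB hr (cvgP_cst P (2 * s)^-1); rewrite subrr.
  have := cvgPD h1 h2; rewrite mul0r addr0; apply: cvgP_eventually.
    move=> n; apply: measurable_funB.
      exact: (measurable_t_stat nu tau hw (hd n)).
    exact: (bmeas_standardized s by_ (hd n)).1.
  exists 1%N => n x n1.
  have n0 : 0 < n%:R :> R by rewrite ltr0n.
  have sn : Num.sqrt n%:R != 0 :> R by rewrite sqrtr_eq0 -ltNge.
  rewrite /t_stat /D; set q := (_ *m _) 0 0; set e := std_err _ _ _ _ _ _ _.
  rewrite mulrBr mulrBl addrA subrK.
  by rewrite [2 * s * _]mulrC mulfK// invfM mulrACA divff// mul1r.
- by move=> n; exact: (measurable_t_stat nu tau hw (hd n)).
Qed.

Lemma t_stat_cvg_in_distribution : cvg_in_distribution P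
  (fun n x => t_stat w (@U n) (@A n) ws nu tau l x) (normal_prob (0 : R) 1).
Proof.
have [mt ht] := t_stat_normal => r _.
rewrite [X in _ --> X](_ : _ = (Phi r)%:E); last exact: PhiE.
apply: cvg_ereal_eps.
  by move=> n; exact: measurable_le.
by move=> eta /(ht r).
Qed.

(** Where the standard error is positive, the interval covers the target exactly
    when |t| <= z. The exceptional event has vanishing probability because
    sqrt n times the standard error tends to 2 s > 0. *)
Lemma interval_coverage (alpha : R) : 0 < alpha < 1 ->
  P n [set x |
    let c := (l^T *m beta_hat w (@U n) (@A n) nu tau x) 0 0 in
    let h := quantile (normal_prob (0 : R) 1) (1 - alpha / 2)
             * std_err w (@U n) (@A n) nu tau l x in
    (l^T *m beta_circ w ws) 0 0 \in `[c - h, c + h]]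
    @[n --> \oo] --> (1 - alpha)%:E.
Proof.
move=> /andP[al0 al1]; pose z := quantile (normal_prob (0 : R) 1) (1 - alpha / 2).
have z0 : 0 <= z by apply: quantile_ge0; apply/andP; split; lra.
have zE : Phi z = 1 - alpha / 2 by apply: Phi_quantile; apply/andP; split; lra.
pose se n x := std_err w (@U n) (@A n) nu tau l x.
pose q n x := (l^T *m (beta_hat w (@U n) (@A n) nu tau x - beta_circ w ws)) 0 0.
pose ts n x := t_stat w (@U n) (@A n) ws nu tau l x.
have eC n : [set x |
    let c := (l^T *m beta_hat w (@U n) (@A n) nu tau x) 0 0 in
    let h := z * std_err w (@U n) (@A n) nu tau l x in
    (l^T *m beta_circ w ws) 0 0 \in `[c - h, c + h]] =
    [set x | `|q n x| - z * se n x <= 0].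
  have qE x : q n x = (l^T *m beta_hat w (@U n) (@A n) nu tau x) 0 0
      - (l^T *m beta_circ w ws) 0 0.
    by rewrite /q mulmxBr mxE; congr (_ + _); rewrite mxE.
  apply/seteqP; split => x /=; rewrite in_itv/= subr_le0 qE ler_norml /se;
    by move=> /andP[? ?]; apply/andP; split; lra.
have -> : (fun n => P n [set x |
    let c := (l^T *m beta_hat w (@U n) (@A n) nu tau x) 0 0 in
    let h := quantile (normal_prob (0 : R) 1) (1 - alpha / 2)
             * std_err w (@U n) (@A n) nu tau l x in
    (l^T *m beta_circ w ws) 0 0 \in `[c - h, c + h]]) =
    (fun n => P n [set x | `|q n x| - z * se n x <= 0]).
  by apply/funext => n; rewrite -eC.
have mse n : measurable_fun setT (se n).
  exact: (measurable_std_err nu tau hw (hd n)).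
have mC n : measurable [set x | `|q n x| - z * se n x <= 0].
  apply: (@measurable_le _ _ _ (fun x => `|q n x| - z * se n x)).
  apply: measurable_funB; last by apply: measurable_funM.
  apply: measurableT_comp => //.
  exact: (measurable_beta_hat_dir nu tau hw (hd n)).
have [mt _] := t_stat_normal.
have mT n : measurable [set x | `|ts n x| <= z].
  apply: (@measurable_le _ _ _ (fun x => `|ts n x|)).
  by apply: measurableT_comp => //; exact: mt.
apply: cvg_ereal_eps => // eta eta0.
have eta2 : 0 < eta / 2 by rewrite divr_gt0.
have [N1 h1] := cvg_normal_abs t_stat_normal z0 eta2.
have s2 : 0 < 2 * s by rewrite mulr_gt0.
have [_ /(_ _ _ s2 eta2)[N2 h2]] := cvgP_std_err.
exists (maxn N1 N2) => n; rewrite geq_max => /andP[/h1 {}h1 /h2 {}h2].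
set E := [set x | _ <= _] in h2.
have mE : measurable E.
  by apply: measurable_dist; apply: measurable_funM => //; exact: mse.
have eq_off x : ~ E x -> (`|q n x| - z * se n x <= 0) = (`|ts n x| <= z).
  move=> /negP; rewrite -ltNge => hE.
  have se0 : 0 < se n x.
    rewrite lt_neqAle sqrtr_ge0 andbT; apply/negP => /eqP e0.
    by move: hE; rewrite -/(se n x) -e0 mulr0 sub0r normrN ger0_norm ?ltxx// ltW.
  rewrite /ts /t_stat -/(q n x) -/(se n x) normrM normfV (ger0_norm (ltW se0)).
  by rewrite ler_pdivrMr// subr_le0.
have i1 : pr (P n) [set x | `|q n x| - z * se n x <= 0] <=
    pr (P n) [set x | `|ts n x| <= z] + pr (P n) E.
  apply: pr_le_setU => // x /= h.
  by have [hE|hE] := pselect (E x); [right|left; rewrite /= -eq_off].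
have i2 : pr (P n) [set x | `|ts n x| <= z] <=
    pr (P n) [set x | `|q n x| - z * se n x <= 0] + pr (P n) E.
  apply: pr_le_setU => // x /= h.
  by have [hE|hE] := pselect (E x); [right|left; rewrite /= eq_off].
move: h1; rewrite -/(ts n) Phi_symm zE !ler_norml => /andP[h3 h4].
by apply/andP; split; lra.
Qed.

End studentization.

Theorem proposition2 (R : realType) (J : nat)
    (w : 'I_J -> R -> R -> R) (ws : R -> R -> R)
    (hw : forall j, graphon (w j)) (hws : graphon ws)
    (hfree : features_free w)
    (nu tau : R) (hnu : 0 < nu) (htau : 0 < tau)
    (d : nat -> measure_display) (T : forall n, measurableType (d n))
    (P : forall n, probability (T n) R)
    (U : forall n, 'I_n -> {RV (P n) >-> R})
    (A : forall n, 'I_n -> 'I_n -> {RV (P n) >-> bool})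
    (hdesign : forall n, one_graph_design ws (@U n) (@A n)) :
  (* (i) *)
  (forall n, (3 <= n)%N -> forall k l : 'I_J.+1,
     covariance (P n) (fun x => score w (@U n) (@A n) ws x k 0)
                      (fun x => score w (@U n) (@A n) ws x l 0)
     = (dyadic_var w ws n k l)%:E) /\
  (* (ii) *)
  ((forall n (k l : 'I_J.+1),
      expectation (P n)
        (fun x => V_hat w (@U n) (@A n) (beta_circ w ws) x k l)
      = (dyadic_var w ws n k l)%:E) /\
   (forall k l : 'I_J.+1,
      cvg_in_probability P
        (fun n x =>
           n%:R * V_hat w (@U n) (@A n) (beta_hat w (@U n) (@A n) nu tau x) x k l)
        (4 * Sigma_g w ws k l))) /\
  (* (iii) *)
  (forall l : 'cV[R]_J.+1,
     0 < (l^T *m invmx (gram w) *m Sigma_g w ws *m invmx (gram w) *m l) 0 0 ->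
     cvg_in_distribution P
       (fun n x => t_stat w (@U n) (@A n) ws nu tau l x)
       (normal_prob (0 : R) 1) /\
     (forall alpha : R, 0 < alpha < 1 ->
        P n [set x |
          let c := (l^T *m beta_hat w (@U n) (@A n) nu tau x) 0 0 in
          let h := quantile (normal_prob (0 : R) 1) (1 - alpha / 2)
                   * std_err w (@U n) (@A n) nu tau l x in
          (l^T *m beta_circ w ws) 0 0 \in `[c - h, c + h]]
          @[n --> \oo] --> (1 - alpha)%:E)).
Proof.
split=> [n n3 k l|].
  exact: (covariance_score hw hws hfree (hdesign n) k l (ltnW n3)).
split.
  split=> [n k l|k l]; first exact: (expectation_V_hat hw hws hfree (hdesign n)).
  exact/cvgP_cvg/(cvgP_V_hat hw hws hfree hnu htau hdesign).
move=> l hl; split.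
  exact: (t_stat_cvg_in_distribution hw hws hfree hnu htau hdesign hl).
move=> alpha.
exact: (interval_coverage hw hws hfree hnu htau hdesign hl).
Qed.
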